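(* Let $(\boldsymbol u,\boldsymbol\omega,p)$ be the solution of the continuous rotation-based elasticity problem and let $(\boldsymbol u_h,\boldsymbol\omega_h,p_h)$ be the solution of the discrete problem (either the plain Galerkin problem or its jump-stabilised version). Let $\Theta$ be the global residual estimator and $\widetilde\Upsilon$ the global data oscillation. Then there is a constant $C_{\mathrm{eff}}>0$, independent of the mesh size and of the Lamé parameters, such that $$\Theta\le C_{\mathrm{eff}}\,\big(|||(\boldsymbol u-\boldsymbol u_h,\boldsymbol\omega-\boldsymbol\omega_h,p-p_h)|||+\widetilde\Upsilon\big).$$
   Context: Setting. $\Omega\subset\mathbb R^d$, $d\in\{2,3\}$, is a bounded Lipschitz (polygonal/polyhedral) domain with boundary $\Gamma$; $\mu^E>0$, $\lambda^E\ge 0$ are constant Lamé coefficients; $\boldsymbol f^E\in L^2(\Omega)^d$; $\|\cdot\|_{0,S}$ is the $L^2(S)$ norm. Rotations are in $\mathbf L^2(\Omega)$: vector-valued for $d=3$ and scalar-valued for $d=2$, where $\mathbf{curl}\,\boldsymbol v=\partial_1v_2-\partial_2v_1$ for vector $\boldsymbol v$, $\mathbf{curl}\,\omega=(\partial_2\omega,-\partial_1\omega)$ for scalar $\omega$, and $\omega\times\boldsymbol n=\omega(-n_2,n_1)$. Continuous problem. Find $(\boldsymbol u,\boldsymbol\omega,p)\in \mathbf H^1_0(\Omega)\times\mathbf L^2(\Omega)\times L^2(\Omega)$ with $B_E((\boldsymbol u,\boldsymbol\omega,p),(\boldsymbol v,\boldsymbol\theta,q))=-\int_\Omega \boldsymbol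 f^E\cdot\boldsymbol v$ for all $(\boldsymbol v,\boldsymbol\theta,q)$ in the same space, where $$B_E((\boldsymbol u,\boldsymbol\omega,p),(\boldsymbol v,\boldsymbol\theta,q)):=-\sqrt{\mu^E}\int_\Omega \mathbf{curl}\,\boldsymbol v\cdot\boldsymbol\omega+\int_\Omega p\,\mathrm{div}\,\boldsymbol v+\int_\Omega\boldsymbol\omega\cdot\boldsymbol\theta-\sqrt{\mu^E}\int_\Omega\boldsymbol\theta\cdot\mathbf{curl}\,\boldsymbol u+\int_\Omega q\,\mathrm{div}\,\boldsymbol u+\frac1{2\mu^E+\lambda^E}\int_\Omega pq .$$ Norm. With $q_0:=q-|\Omega|^{-1}\int_\Omega q$, $$|||(\boldsymbol v,\boldsymbol\theta,q)|||^2:=\mu^E\|\mathbf{curl}\,\boldsymbol v\|_{0,\Omega}^2+\mu^E\|\mathrm{div}\,\boldsymbol v\|_{0,\Omega}^2+\|\boldsymbol\theta\|_{0,\Omega}^2+(2\mu^E+\lambda^E)^{-1}\|q\|_{0,\Omega}^2+(\mu^E)^{-1}\|q_0\|_{0,\Omega}^2 .$$ Discretisation. $\{\mathcal T_h\}_h$ is a shape-regular family of simplicial partitions of $\overline\Omega$; $h_K$, $h_e$ are the diameters of an element $K$ and of an edge (facet if $d=3$) $e$; $\mathcal E(\mathcal T_h)$ is the set of all edges/facets; $[\![\cdot]\!]$ is the jump across an interior edge. For fixed $k\ge 0$: $\mathbf V_h$ = continuous functions in $\mathbf H^1_0(\Omega)$ that are in $\mathbb P_{k+1}(K)^d$ on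 each $K$; $\mathbf W_h$ = rotation fields in $\mathbf L^2(\Omega)$ with components in $\mathbb P_k(K)$ on each $K$; $Z_h$ = functions in $L^2(\Omega)$ that are in $\mathbb P_k(K)$ on each $K$. Plain discrete problem: find $(\boldsymbol u_h,\boldsymbol\omega_h,p_h)\in\mathbf V_h\times\mathbf W_h\times Z_h$ with $B_E((\boldsymbol u_h,\boldsymbol\omega_h,p_h),(\boldsymbol v,\boldsymbol\theta,q))=-\int_\Omega\boldsymbol f^E\cdot\boldsymbol v$ for all $(\boldsymbol v,\boldsymbol\theta,q)\in\mathbf V_h\times\mathbf W_h\times Z_h$. Stabilised version: the same with $\mu^{-1}\sum_{e\in\mathcal E(\mathcal T_h)}h_e\int_e[\![p_h]\!][\![q]\!]$ added to the left-hand side, where $\mu>0$ is a stabilisation parameter (boundary edges contribute zero). Estimator. $\boldsymbol f_h^E$ is a piecewise polynomial approximation of $\boldsymbol f^E$ (of fixed degree). On each $K$: $\mathbf R_1:=\boldsymbol f_h^E-\sqrt{\mu^E}\,\mathbf{curl}\,\boldsymbol\omega_h-\nabla p_h$, $\mathbf R_2:=\boldsymbol\omega_h-\sqrt{\mu^E}\,\mathbf{curl}\,\boldsymbol u_h$, $R_3:=\mathrm{div}\,\boldsymbol u_h+(2\mu^E+\lambda^E)^{-1}p_h$; on edges, $\mathbf R_e:=\frac12[\![\sqrt{\mu^E}\,\boldsymbol\omega_h\times\boldsymbol n+p_h\boldsymbol n]\!]_e$ if $e\not\subset\Gamma$ and $\mathbf R_e:=\boldsymbol 0$ if $e\subset\Gamma$.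 Then $$\Theta_K^2:=\frac{h_K^2}{\mu^E}\|\mathbf R_1\|_{0,K}^2+\sum_{e\subset\partial K}\frac{h_e}{\mu^E}\|\mathbf R_e\|_{0,e}^2+\|\mathbf R_2\|_{0,K}^2+\Big(\frac1{\mu^E}+\frac1{2\mu^E+\lambda^E}\Big)^{-1}\|R_3\|_{0,K}^2,\qquad \widetilde\Upsilon_K^2:=\frac{h_K^2}{\mu^E}\|\boldsymbol f^E-\boldsymbol f_h^E\|_{0,K}^2,$$ $\Theta^2:=\sum_{K\in\mathcal T_h}\Theta_K^2$, $\widetilde\Upsilon^2:=\sum_{K\in\mathcal T_h}\widetilde\Upsilon_K^2$. *)

(* Defs.v *)
From HB Require Import structures.
From mathcomp Require Import all_boot all_order all_algebra.
From mathcomp Require Import all_classical all_reals all_analysis.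

Set Implicit Arguments.
Unset Strict Implicit.
Unset Printing Implicit Defensive.
Import Order.TTheory GRing.Theory Num.Theory.
Import numFieldNormedType.Exports.

Local Open Scope classical_set_scope.
Local Open Scope ring_scope.

Definition measure_rV_display : measure_display. Proof. exact: default_measure_display. Qed.

(* The sigma-algebra on R^n is the one generated by the coordinates, that is,
   the Borel one.  *)
Section measurable_rV.
Variables (R : realType) (n : nat).

Definition coord_rV (i : 'I_n) (x : 'rV[R]_n) : measurableTypeR R := x 0 i.

Let rV_set0 : g_sigma_preimage coord_rV set0.
Proof. exact: sigma_algebra0. Qed.

Let rV_setC A : g_sigma_preimage coord_rV A -> g_sigma_preimage coord_rV (~` A).
Proof. exact: sigma_algebraC. Qed.

Let rV_bigcup (F : (set 'rV[R]_n)^nat) :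
  (forall i, g_sigma_preimage coord_rV (F i)) ->
  g_sigma_preimage coord_rV (\bigcup_i (F i)).
Proof. exact: sigma_algebra_bigcup. Qed.

HB.instance Definition _ := @isMeasurable.Build measure_rV_display
  'rV[R]_n (g_sigma_preimage coord_rV) rV_set0 rV_setC rV_bigcup.

End measurable_rV.

Section measurable_rV_theory.
Context {R : realType}.

Lemma measurable_coord_rV n (i : 'I_n) :
  measurable_fun [set: 'rV[R]_n] (@coord_rV R n i).
Proof.
move=> _ Y mY; rewrite setTI; apply: sub_sigma_algebra => /=.
rewrite -bigcup_seq/=; exists i => /=; first by rewrite mem_index_enum.
by exists Y => //; rewrite setTI.
Qed.

Lemma measurable_fun_rV d (T : measurableType d) n (f : T -> 'rV[R]_n) :
  (forall i, measurable_fun [set: T] (@coord_rV R n i \o f)) ->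
  measurable_fun [set: T] f.
Proof.
move=> mf _ A mA; rewrite setTI.
have : g_sigma_preimage (fun i => @coord_rV R n i \o f) (f @^-1` A).
  by rewrite g_sigma_preimage_comp; exists A => //; rewrite setTI.
apply: smallest_sub; first exact: sigma_algebra_measurable.
case: n => [|n] in f mf A mA *; first by rewrite big_ord0.
rewrite -bigcup_mkord_ord; apply: bigcup_sub => i Ii.
by move=> B [C mC <-]; exact: mf.
Qed.

Definition cons_rV n (p : measurableTypeR R * 'rV[R]_n) : 'rV[R]_n.+1 :=
  \row_i if unlift ord0 i is Some j then p.2 0 j else p.1.

Definition uncons_rV n (z : 'rV[R]_n.+1) : measurableTypeR R * 'rV[R]_n :=
  (z 0 ord0, \row_j z 0 (lift ord0 j)).

Lemma cons_rVK n : cancel (@cons_rV n) (@uncons_rV n).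
Proof.
move=> [x y]; congr pair; first by rewrite mxE unlift_none.
by apply/rowP => j; rewrite !mxE liftK.
Qed.

Lemma measurable_cons_rV n : measurable_fun setT (@cons_rV n).
Proof.
apply: measurable_fun_rV => i.
case: (unliftP ord0 i) => [j|] ->.
- rewrite (_ : _ \o _ = @coord_rV R n j \o snd); last first.
    by apply/funext => p /=; rewrite /coord_rV mxE liftK.
  exact: measurableT_comp (measurable_coord_rV j) measurable_snd.
- rewrite (_ : _ \o _ = fst); first exact: measurable_fst.
  by apply/funext => p /=; rewrite /coord_rV mxE unlift_none.
Qed.

Lemma measurable_uncons_rV n : measurable_fun setT (@uncons_rV n).
Proof.
apply: measurable_fun_pair; first exact: (measurable_coord_rV ord0).
apply: measurable_fun_rV => i.
rewrite (_ : _ \o _ = @coord_rV R n.+1 (lift ord0 i)).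
  exact: measurable_coord_rV.
by apply/funext => p /=; rewrite /coord_rV mxE.
Qed.

Section step.
Variables (n : nat) (mu : {sigma_finite_measure set 'rV[R]_n -> \bar R}).

Definition lebesgue_cons : set 'rV[R]_n.+1 -> \bar R :=
  pushforward (@lebesgue_measure R \x mu)%E (@cons_rV n).

Let m : {measure set (measurableTypeR R * 'rV[R]_n)%type -> \bar R} :=
  (@lebesgue_measure R \x mu)%E.

Let lebesgue_cons0 : lebesgue_cons set0 = 0%E.
Proof. by rewrite /lebesgue_cons /pushforward preimage_set0 measure0. Qed.

Let lebesgue_cons_ge0 A : (0 <= lebesgue_cons A)%E.
Proof. exact: (@measure_ge0 _ _ _ m). Qed.

Let lebesgue_cons_sigma_additive : semi_sigma_additive lebesgue_cons.
Proof.
move=> F mF tF mUF; rewrite /lebesgue_cons /pushforward preimage_bigcup.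
have mpre A : measurable A -> measurable (@cons_rV n @^-1` A).
  by move=> mA; rewrite -[X in measurable X]setTI; exact: measurable_cons_rV.
apply: (@measure_semi_sigma_additive _ _ _ m (fun k => @cons_rV n @^-1` F k)).
- by move=> k; exact: mpre.
- apply/trivIsetP => /= i j _ _ ij; rewrite -preimage_setI.
  by move/trivIsetP : tF => /(_ _ _ _ _ ij) ->//; rewrite preimage_set0.
- by rewrite -preimage_bigcup; exact: mpre.
Qed.

HB.instance Definition _ := isMeasure.Build _ _ _
  lebesgue_cons lebesgue_cons0 lebesgue_cons_ge0 lebesgue_cons_sigma_additive.

Let lebesgue_cons_sigma_finite : sigma_finite setT lebesgue_cons.
Proof.
have /sigma_finiteP[F [TF ndF Foo]] := sigma_finiteT (@lebesgue_measure R).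
have /sigma_finiteP[G [TG ndG Goo]] := sigma_finiteT mu.
exists (fun k => @uncons_rV n @^-1` (F k `*` G k)).
  rewrite -preimage_bigcup -[LHS](@preimage_setT _ _ (@uncons_rV n)).
  congr (_ @^-1` _); apply/seteqP; split=> // -[x y] _.
  have [i _ Fix] : (\bigcup_i F i) x by rewrite -TF.
  have [j _ Gjy] : (\bigcup_i G i) y by rewrite -TG.
  exists (maxn i j) => //; split => /=.
    by move: x Fix; exact/subsetPset/ndF/leq_maxl.
  by move: y Gjy; exact/subsetPset/ndG/leq_maxr.
move=> k; have [mF Fk] := Foo k; have [mG Gk] := Goo k; split.
  by rewrite -[X in measurable X]setTI; apply: measurable_uncons_rV => //;
    exact: measurableX.
rewrite /lebesgue_cons /pushforward -comp_preimage (_ : _ \o _ = id); last first.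
  by apply/funext => z /=; rewrite cons_rVK.
by rewrite preimage_id product_measure1E// lte_mul_pinfty// ge0_fin_numE.
Qed.

HB.instance Definition _ := Measure_isSigmaFinite.Build _ _ _
  lebesgue_cons lebesgue_cons_sigma_finite.

End step.
End measurable_rV_theory.

Fixpoint lebesgue_rV (R : realType) (n : nat) :
    {sigma_finite_measure set 'rV[R]_n -> \bar R} :=
  match n return {sigma_finite_measure set 'rV[R]_n -> \bar R} with
  | 0 => dirac (0 : 'rV[R]_0)
  | m.+1 => lebesgue_cons (lebesgue_rV R m)
  end.

Section euclidean.
Variables (R : realType) (n : nat).
Implicit Types (x y : 'rV[R]_n) (A : set 'rV[R]_n).

Definition dotv x y : R := \sum_i x 0 i * y 0 i.

(* [`|x|] is the sup norm of the library, hence this one. *)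
Definition enorm x : R := Num.sqrt (dotv x x).

Definition diam A : R := sup [set enorm (x - y) | x in A & y in A].

Definition inball_diam A : R :=
  sup [set 2 * r | r in [set r | 0 <= r /\
    exists c, forall x, enorm (x - c) <= r -> A x]].

End euclidean.

(* In the Cartesian coordinates [z] centred at the boundary point [x], the set is
   locally the strict epigraph of [phi], the first coordinate being the height. *)
Definition lipschitz_boundary (R : realType) (n : nat)
    (Omega : set 'rV[R]_n.+1) : Prop :=
  forall x, (closure Omega `\` Omega) x ->
  exists (Q : 'M[R]_n.+1) (phi : 'rV[R]_n -> R),
    [/\ Q *m Q^T = 1%:M, lipschitz phi &
        \forall y \near x, let z := (y - x) *m Q in
          Omega y <-> phi (col' ord0 z) < z 0 ord0].

Definition lipschitz_domain (R : realType) (n : nat)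
    (Omega : set 'rV[R]_n.+1) : Prop :=
  [/\ Omega !=set0, open Omega, connected Omega, bounded_set Omega &
      lipschitz_boundary Omega].

Section spaces.
Variables (R : realType) (n : nat).
Local Notation leb := (lebesgue_rV R n).
Implicit Types (Omega S : set 'rV[R]_n) (f g phi : 'rV[R]_n -> R) (i : 'I_n).

Definition partial i f : 'rV[R]_n -> R := fun x => 'D_(delta_mx 0 i) f x.

Definition smooth f : Prop :=
  forall (s : seq 'I_n) x, differentiable (foldr partial f s) x.

Definition test_function Omega phi : Prop := smooth phi /\
  exists K, [/\ compact K, K `<=` Omega & forall x, ~ K x -> phi x = 0].

Definition L2 S f : Prop := measurable_fun S f /\
  leb.-integrable S (EFin \o (fun x => f x ^+ 2)).

Definition L2_vec m S (F : 'rV[R]_n -> 'rV[R]_m) : Prop :=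
  forall j, L2 S (fun x => F x 0 j).

Definition sqnormL2 S f : R := \int[leb]_(x in S) f x ^+ 2.

Definition sqnormL2_vec m S (F : 'rV[R]_n -> 'rV[R]_m) : R :=
  \int[leb]_(x in S) dotv (F x) (F x).

Definition is_weak_partial Omega i f g : Prop := L2 Omega g /\
  forall phi, test_function Omega phi ->
    \int[leb]_(x in Omega) (f x * partial i phi x) =
    - \int[leb]_(x in Omega) (g x * phi x).

(* A representative of the weak derivative, which is unique up to a null set;
   the zero function if there is none in L2. *)
Definition wpartial Omega i f : 'rV[R]_n -> R :=
  xget (fun=> 0) [set g | is_weak_partial Omega i f g].

Definition H1 Omega f : Prop :=
  L2 Omega f /\ forall i, exists g, is_weak_partial Omega i f g.

Definition H10 Omega f : Prop := H1 Omega f /\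
  forall eps, 0 < eps -> exists2 phi, test_function Omega phi &
    sqnormL2 Omega (f \- phi) +
    \sum_i sqnormL2 Omega (wpartial Omega i f \- partial i phi) < eps.

Definition H10_vec m Omega (v : 'rV[R]_n -> 'rV[R]_m) : Prop :=
  forall j, H10 Omega (fun x => v x 0 j).

(* Polynomials of total degree at most k, [a] being the exponent multi-index. *)
Definition polynomial_on k S f : Prop :=
  exists c : {ffun 'I_n -> 'I_k.+1} -> R, forall x, S x ->
    f x = \sum_(a : {ffun 'I_n -> 'I_k.+1} | (\sum_i a i <= k)%N)
            c a * \prod_i x 0 i ^+ a i.

End spaces.

Inductive spacedim := Two | Three.

Definition facet_dim d := match d with Two => 1%N | Three => 2%N end.
Definition space_dim d := (facet_dim d).+1.
Definition rot_dim d := match d with Two => 1%N | Three => 3%N end.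

Section calculus.
Variable R : realType.

(* The operators are parametrised by the partial derivatives they use: weak
   ones on the domain or classical ones inside an element. *)
Definition derivation n := 'I_n -> ('rV[R]_n -> R) -> 'rV[R]_n -> R.

Definition div n (D : derivation n) (v : 'rV[R]_n -> 'rV[R]_n) (x : 'rV[R]_n) : R :=
  \sum_i D i (fun y => v y 0 i) x.

Definition grad n (D : derivation n) (p : 'rV[R]_n -> R) (x : 'rV[R]_n) : 'rV[R]_n :=
  \row_i D i p x.

(* Indices in ['I_3] are added modulo 3. *)
Definition cross3 (a b : 'rV[R]_3) : 'rV[R]_3 :=
  \row_j (a 0 (j + 1) * b 0 (j + 2) - a 0 (j + 2) * b 0 (j + 1)).

Definition curl3 (D : derivation 3) (v : 'rV[R]_3 -> 'rV[R]_3) (x : 'rV[R]_3) :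
    'rV[R]_3 :=
  \row_j (D (j + 1) (fun y => v y 0 (j + 2)) x
          - D (j + 2) (fun y => v y 0 (j + 1)) x).

Definition curl (d : spacedim) : derivation (space_dim d) ->
    ('rV[R]_(space_dim d) -> 'rV[R]_(space_dim d)) -> 'rV[R]_(space_dim d) -> 'rV[R]_(rot_dim d) :=
  match d return derivation (space_dim d) ->
      ('rV[R]_(space_dim d) -> 'rV[R]_(space_dim d)) -> 'rV[R]_(space_dim d) -> 'rV[R]_(rot_dim d)
  with
  | Two => fun (D : derivation 2) (v : 'rV[R]_2 -> 'rV[R]_2) x =>
      \row_(_ < 1) (D 0 (fun y => v y 0 1) x - D 1 (fun y => v y 0 0) x)
  | Three => curl3
  end.

Definition curl_rot (d : spacedim) : derivation (space_dim d) ->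
    ('rV[R]_(space_dim d) -> 'rV[R]_(rot_dim d)) -> 'rV[R]_(space_dim d) -> 'rV[R]_(space_dim d) :=
  match d return derivation (space_dim d) ->
      ('rV[R]_(space_dim d) -> 'rV[R]_(rot_dim d)) -> 'rV[R]_(space_dim d) -> 'rV[R]_(space_dim d)
  with
  | Two => fun (D : derivation 2) (w : 'rV[R]_2 -> 'rV[R]_1) x =>
      \row_(j < 2) (if j == 0 then D 1 (fun y => w y 0 0) x
                    else - D 0 (fun y => w y 0 0) x)
  | Three => curl3
  end.

Definition cross_rot (d : spacedim) :
    'rV[R]_(rot_dim d) -> 'rV[R]_(space_dim d) -> 'rV[R]_(space_dim d) :=
  match d return 'rV[R]_(rot_dim d) -> 'rV[R]_(space_dim d) -> 'rV[R]_(space_dim d) with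
  | Two => fun (w : 'rV[R]_1) (nu : 'rV[R]_2) =>
      \row_(j < 2) (if j == 0 then - (w 0 0 * nu 0 1) else w 0 0 * nu 0 0)
  | Three => cross3
  end.

End calculus.

(* Elements are given by their sets of vertices. *)
Record mesh (R : realType) (n : nat) := Mesh {
  nverts : nat;
  vertex : 'I_nverts -> 'rV[R]_n.+1;
  elements : {set {set 'I_nverts}} }.

Section mesh.
Variables (R : realType) (n : nat) (T : mesh R n).
Local Notation simplex := {set 'I_(nverts T)}.
Implicit Types (s K e : simplex) (x : 'rV[R]_n.+1).

Definition hull s : set 'rV[R]_n.+1 := [set x | exists c : 'I_(nverts T) -> R,
  [/\ forall a, 0 <= c a, \sum_(a in s) c a = 1 &
      x = \sum_(a in s) c a *: vertex a]].

Definition affinely_independent s : Prop := forall c : 'I_(nverts T) -> R,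
  \sum_(a in s) c a = 0 -> \sum_(a in s) c a *: vertex a = 0 ->
  forall a, a \in s -> c a = 0.

Definition simplicial_partition (Omega : set 'rV[R]_n.+1) : Prop :=
  [/\ forall K, K \in elements T -> #|K| = n.+2 /\ affinely_independent K,
      closure Omega = \bigcup_(K in [set` elements T]) hull K &
      forall K K', K \in elements T -> K' \in elements T ->
        hull K `&` hull K' = hull (K :&: K')].

Definition facets : {set simplex} :=
  [set e : simplex | (#|e| == n.+1)%N && [exists K in elements T, e \subset K]]%SET.

(* The length or area integral over a facet, by its affine parametrisation
   over the unit simplex of R^n. *)
Definition facet_integral e (g : 'rV[R]_n.+1 -> R) : R :=
  let a i := nth 0 [seq vertex v | v <- enum e] i in
  let M : 'M[R]_(n, n.+1) := \matrix_(i < n) (a i.+1 - a 0%N) in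
  Num.sqrt (\det (M *m M^T)) *
  \int[lebesgue_rV R n]_(t in [set t | (forall i, 0 <= t 0 i) /\ \sum_i t 0 i <= 1])
    g (a 0%N + t *m M).

(* One of the two unit normals; the choice does not matter below. *)
Definition facet_normal e : 'rV[R]_n.+1 :=
  xget 0 [set nu | enorm nu = 1 /\
    forall a b, a \in e -> b \in e -> dotv nu (vertex a - vertex b) = 0].

Definition trace_from (V : normedModType R) K (f : 'rV[R]_n.+1 -> V) x : V :=
  lim (f y @[y --> within (hull K)^° (nbhs x)]).

(* The two neighbours are ordered by the enumeration of [{set 'I__}], and
   only expressions independent of this order are used below. A facet with a
   single neighbour lies on the boundary. *)
Definition jump (V : normedModType R) e (f : 'rV[R]_n.+1 -> V) x : V :=
  if enum [set K in elements T | e \subset K]%SET is [:: K1; K2]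
  then trace_from K1 f x - trace_from K2 f x else 0.

End mesh.

Definition shape_regular (R : realType) (n : nat) (I : Type)
    (T : I -> mesh R n) : Prop :=
  exists sigma : R, forall i (K : {set 'I_(nverts (T i))}),
    K \in elements (T i) -> diam (hull K) <= sigma * inball_diam (hull K).

Section elasticity.
Variables (R : realType) (d : spacedim).
Local Notation point := 'rV[R]_(space_dim d).
Local Notation rotation := 'rV[R]_(rot_dim d).
Local Notation leb := (lebesgue_rV R (space_dim d)).
Variables (Omega : set point) (muE lamE : R).
Implicit Types (u v f : point -> point) (w th : point -> rotation)
  (p q : point -> R).

Local Notation wD := (wpartial Omega).

Definition formE u w p v th q : R :=
  - Num.sqrt muE * \int[leb]_(x in Omega) dotv (curl wD v x) (w x)
  + \int[leb]_(x in Omega) (p x * div wD v x)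
  + \int[leb]_(x in Omega) dotv (w x) (th x)
  - Num.sqrt muE * \int[leb]_(x in Omega) dotv (th x) (curl wD u x)
  + \int[leb]_(x in Omega) (q x * div wD u x)
  + (2 * muE + lamE)^-1 * \int[leb]_(x in Omega) (p x * q x).

Definition load f v : R := - \int[leb]_(x in Omega) dotv (f x) (v x).

Definition continuous_solution f u w p : Prop :=
  [/\ H10_vec Omega u, L2_vec Omega w, L2 Omega p &
      forall v th q, H10_vec Omega v -> L2_vec Omega th -> L2 Omega q ->
        formE u w p v th q = load f v].

Definition mean_free q : point -> R :=
  fun x => q x - (fine (leb Omega))^-1 * \int[leb]_(y in Omega) q y.

Definition energy_norm v th q : R := Num.sqrt (
  muE * sqnormL2_vec Omega (curl wD v) + muE * sqnormL2 Omega (div wD v)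
  + sqnormL2_vec Omega th + (2 * muE + lamE)^-1 * sqnormL2 Omega q
  + muE^-1 * sqnormL2 Omega (mean_free q)).

Section discrete.
Variables (T : mesh R (facet_dim d)) (k : nat).

(* Values on the element boundaries are irrelevant for discontinuous
   functions. *)
Definition piecewise_polynomial m l (F : point -> 'rV[R]_m) : Prop :=
  L2_vec Omega F /\ forall K j, K \in elements T ->
    polynomial_on l (@hull _ _ T K)^° (fun x => F x 0 j).

Definition Vh v : Prop :=
  [/\ {within closure Omega, continuous v}, H10_vec Omega v &
      forall K j, K \in elements T ->
        polynomial_on k.+1 (@hull _ _ T K) (fun x => v x 0 j)].

Definition Wh w : Prop := piecewise_polynomial k w.

Definition Zh q : Prop := L2 Omega q /\
  forall K, K \in elements T -> polynomial_on k (@hull _ _ T K)^° q.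

Definition galerkin_solution f u w p : Prop :=
  [/\ Vh u, Wh w, Zh p & forall v th q, Vh v -> Wh th -> Zh q ->
      formE u w p v th q = load f v].

Definition jump_form p q : R := \sum_(e in facets T)
  diam (hull e) * facet_integral e (fun x => jump e p x * jump e q x).

Definition stabilised_solution (mu : R) f u w p : Prop :=
  [/\ Vh u, Wh w, Zh p & forall v th q, Vh v -> Wh th -> Zh q ->
      formE u w p v th q + mu^-1 * jump_form p q = load f v].

Section estimator.
Variables (f fh uh : point -> point) (wh : point -> rotation) (ph : point -> R).
Local Notation D := (@partial R (space_dim d)).
Implicit Types (K e : {set 'I_(nverts T)}).

Definition res1 : point -> point :=
  fun x => fh x - Num.sqrt muE *: curl_rot D wh x - grad D ph x.

Definition res2 : point -> rotation :=
  fun x => wh x - Num.sqrt muE *: curl D uh x.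

Definition res3 : point -> R :=
  fun x => div D uh x + (2 * muE + lamE)^-1 * ph x.

Definition res_facet e : point -> point := fun x =>
  if `[< hull e `<=` closure Omega `\` Omega >] then 0 else
  2^-1 *: jump e (fun y => Num.sqrt muE *: cross_rot (wh y) (facet_normal e)
                           + ph y *: facet_normal e) x.

(* The integrals are over the interiors of the elements, where the classical
   derivatives make sense. *)
Definition local_estimator_sq K : R :=
  diam (hull K) ^+ 2 / muE * sqnormL2_vec (hull K)^° res1
  + \sum_(e in facets T | e \subset K) diam (hull e) / muE *
      facet_integral e (fun x => dotv (res_facet e x) (res_facet e x))
  + sqnormL2_vec (hull K)^° res2
  + (muE^-1 + (2 * muE + lamE)^-1)^-1 * sqnormL2 (hull K)^° res3.

Definition local_oscillation_sq K : R :=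
  diam (hull K) ^+ 2 / muE * sqnormL2_vec (hull K)^° (f \- fh).

Definition estimator : R :=
  Num.sqrt (\sum_(K in elements T) local_estimator_sq K).

Definition oscillation : R :=
  Num.sqrt (\sum_(K in elements T) local_oscillation_sq K).

End estimator.
End discrete.
End elasticity.

(* Main.v *)
Require Import Defs.
From HB Require Import structures.
From mathcomp Require Import all_boot all_order all_algebra.
From mathcomp Require Import all_classical all_reals all_analysis.
From mathcomp Require Import perm measurable_realfun zify ring lra.

Set Implicit Arguments.
Unset Strict Implicit.
Unset Printing Implicit Defensive.
Import Order.TTheory GRing.Theory Num.Theory.
Import numFieldNormedType.Exports.

Local Open Scope classical_set_scope.
Local Open Scope ring_scope.

(** Each term of the estimator is bounded by testing the continuous weak equations
    with an explicit smooth function; of the discrete solution only the piecewise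
    polynomial structure matters.  The constitutive equations hold almost everywhere,
    which gives the residuals [R2] and [R3].  For [R1] the test function is a smooth
    radial bump, supported in a ball inscribed in the element, times [R1]; equivalence
    of norms for polynomials on the scale of the ball transfers the estimate to the
    whole element.  For a facet the bump is centred at the barycentre, in a ball
    contained in the two neighbours, and multiplied by the jump extended to be constant
    along the normal.  Integrating by parts on the two half-balls turns the jump term
    into the integral over a half-space of the squared jump against minus the normal
    derivative of the bump, which is bounded below on a cube inside the half-ball; the
    facet integral itself enters only through its bound by the maximum of the jump.
    Summation over the mesh uses that the interiors of the elements are disjoint and
    that a simplex has boundedly many facets. *)

(** * Lebesgue measure under dilations *)

(** Polynomial bubble functions lie in [H10] only through a density argument, and the facet terms of
    the usual proof need a trace theorem and a surface measure. Smooth bumps avoid both: every test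
    field is made of [test_function]s, whose weak derivatives are classical up to a null function,
    and boundary terms occur only as half-space integrals of normal derivatives. Independence of the
    Lamé parameters has two sources. The momentum equation pairs the pressure error only with the
    divergence of a compactly supported field, so any constant may be subtracted from it; with the
    mean as constant, the weight [muE^-1] is the one of [mean_free] in the norm. The weight of
    [res3] is at most [muE], and its product with [(2 * muE + lamE)^-1] is at most 1. Bumps must be
    supported in the open set [Omega], whereas the elements cover its closure; the graph description
    of the boundary bridges this gap. The shape of an element enters only through the ratio of its
    diameter to the radius of an inscribed ball; there is no reference element. *)

Section measurability.
Context {R : realType} {n : nat}.
Implicit Types (a b c x y : 'rV[R]_n).

Definition box a b : set 'rV[R]_n := [set x | forall i, a 0 i < x 0 i < b 0 i].

Definition cube c (r : R) : set 'rV[R]_n := box (c - const_mx r) (c + const_mx r).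

Lemma measurable_box a b : measurable (box a b).
Proof.
rewrite (_ : box a b = \bigcap_(i in [set: 'I_n]) (@coord_rV R n i @^-1` `]a 0 i, b 0 i[)).
  apply: fin_bigcap_measurable => [|i _]; first exact: finite_finset.
  rewrite -[X in measurable X]setTI.
  by apply: measurable_coord_rV => //; exact: measurable_itv.
apply/seteqP; split=> x /=.
  by move=> h i _; rewrite /= in_itv/=; exact: h.
by move=> h i; have := h i Logic.I; rewrite /= in_itv.
Qed.

Lemma nbhs_box x (A : set 'rV[R]_n) : nbhs x A ->
  exists2 e, 0 < e & box (x - const_mx e) (x + const_mx e) `<=` A.
Proof.
move=> /nbhs_ballP[e e0 xA]; exists e => // y h; apply: xA; split=> // i j.
by rewrite ord1 /ball/= ltr_distlC; have := h j; rewrite !mxE.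
Qed.

(** The sigma-algebra is generated by the coordinates, so open sets have to be rebuilt: an open set
    is the union of the rational boxes that it contains. The other boxes are replaced by [set0],
    which keeps the index type countable. *)
Lemma open_measurable_rV (U : set 'rV[R]_n) : open U -> measurable U.
Proof.
rewrite openE => oU.
pose rb (p : 'rV[rat]_n * 'rV[rat]_n) : set 'rV[R]_n :=
  box (map_mx ratr p.1) (map_mx ratr p.2).
rewrite (_ : U = \bigcup_p (if `[< rb p `<=` U >] then rb p else set0)).
  apply: countable_bigcupT_measurable => [|p]; first exact: countableP.
  by case: ifPn => // _; exact: measurable_box.
apply/seteqP; split => x.
  move=> /oU/nbhs_box[e e0 eU].
  have /choice[q1 hq1] : forall i, exists q : rat, ratr q \in `]x 0 i - e, x 0 i[.
    by move=> i; apply: rat_in_itvoo; lra.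
  have /choice[q2 hq2] : forall i, exists q : rat, ratr q \in `]x 0 i, x 0 i + e[.
    by move=> i; apply: rat_in_itvoo; lra.
  exists (\row_i q1 i, \row_i q2 i) => //.
  case: ifPn => [_ i/=|/asboolPn]; last first.
    case=> y hy; apply: eU => i; have := hy i.
    by rewrite /= !mxE; move: (hq1 i) (hq2 i); rewrite !in_itv/=; lra.
  by rewrite !mxE; move: (hq1 i) (hq2 i); rewrite !in_itv/=; lra.
by move=> [p _]; case: ifPn => // /asboolP; apply.
Qed.

Lemma continuous_measurable_rV (f : 'rV[R]_n -> R) :
  continuous f -> measurable_fun setT f.
Proof.
move=> /continuousP cf.
apply: (measurability _ (RGenOpens.measurableE R)).
move=> _ [_ [a [b ->] <-]]; rewrite setTI; apply: open_measurable_rV.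
exact/cf/interval_open.
Qed.

End measurability.

(** The bundled measure, so that it can be scaled by [mscale] and passed on where a measure is
    expected. *)
Definition pushforward_measure d d' (T1 : measurableType d) (T2 : measurableType d')
    (R : realType) (m : {measure set T1 -> \bar R}) (f : T1 -> T2)
    (mf : measurable_fun setT f) : {measure set T2 -> \bar R} :=
  measure_function_pushforward__canonical__measure_function_Measure m mf.

Section dilation.
Context {R : realType}.

Definition dil1 (c r : R) (x : measurableTypeR R) : measurableTypeR R := c + r * x.

Lemma measurable_dil1 c r : measurable_fun setT (dil1 c r).
Proof. by apply: measurable_funD => //; exact: measurable_funM. Qed.

(** Lebesgue measure is determined by its values on half-open intervals, so the scaled pushforward
    is compared with it on those only. *)
Lemma lebesgue_dil1 c (r : R) (r0 : 0 <= r) A : 0 < r -> measurable A ->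
  lebesgue_measure A = mscale (NngNum r0) (pushforward_measure
    (@lebesgue_measure R) (@measurable_dil1 c r)) A.
Proof.
move=> rgt0; apply: lebesgue_measure_unique => _ [[a b] _ <-].
transitivity (r%:E * lebesgue_measure (dil1 c r @^-1` `]a, b]))%E; last by [].
rewrite (_ : _ @^-1` _ = `](a - c) / r, (b - c) / r]%classic); last first.
  apply/seteqP; split => x /=; rewrite !in_itv/= /dil1.
    by move=> /andP[? ?]; rewrite ltr_pdivrMr// ler_pdivlMr//; apply/andP; split; lra.
  by rewrite ltr_pdivrMr// ler_pdivlMr//; move=> /andP[? ?]; apply/andP; split; lra.
rewrite /= !lebesgue_measure_itv/= !lte_fin ltr_pM2r ?invr_gt0// ltrD2r.
case: ifP => _; last by rewrite mule0.
by rewrite !EFinN -!EFinB -EFinM; congr EFin; field; lra.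
Qed.

Lemma ge0_integral_dil1 c (r : R) (f : measurableTypeR R -> \bar R) : 0 < r ->
  measurable_fun setT f -> (forall x, 0 <= f x)%E ->
  (\int[lebesgue_measure]_x f x = r%:E * \int[lebesgue_measure]_x f (dil1 c r x))%E.
Proof.
move=> r0 mf f0; have r0' := ltW r0.
rewrite (eq_measure_integral (mscale (NngNum r0') (pushforward_measure
    (@lebesgue_measure R) (@measurable_dil1 c r)))).
  rewrite ge0_integral_mscale//=; congr *%E.
  by rewrite ge0_integral_pushforward//; exact: measurable_dil1.
by move=> A mA _; exact: lebesgue_dil1.
Qed.

Lemma lebesgue_rVS n (A : set 'rV[R]_n.+1) : lebesgue_rV R n.+1 A =
  (\int[lebesgue_measure]_x lebesgue_rV R n [set y | A (cons_rV (x, y))])%E.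
Proof.
rewrite /= /lebesgue_cons /pushforward/= /product_measure1.
apply: eq_integral => x _ /=; congr (lebesgue_rV R n _).
by apply/seteqP; split => y /=; rewrite /xsection/= inE.
Qed.

Definition dil n (c : 'rV[R]_n) (r : R) (x : 'rV[R]_n) : 'rV[R]_n := c + r *: x.

Lemma measurable_dil n c r : measurable_fun setT (@dil n c r).
Proof.
apply: measurable_fun_rV => i.
rewrite (_ : _ \o _ = dil1 (c 0 i) r \o (@coord_rV R n i)); last first.
  by apply/funext => x; rewrite /dil /dil1 /coord_rV /= !mxE.
by apply: measurableT_comp; [exact: measurable_dil1|exact: measurable_coord_rV].
Qed.

Lemma cons_rV_xsection n (A : set 'rV[R]_n.+1) x :
  [set y | A (cons_rV (x, y))] = xsection (@cons_rV R n @^-1` A) x.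
Proof. by apply/seteqP; split => y /=; rewrite /xsection/= inE. Qed.

Lemma measurable_preT d d' (T : measurableType d) (U : measurableType d') (f : T -> U) A :
  measurable_fun setT f -> measurable A -> measurable (f @^-1` A).
Proof. by move=> mf mA; rewrite -[X in measurable X]setTI; exact: mf. Qed.

(** Slicing along the first coordinate splits the dilation into a one-dimensional one, treated by
    [ge0_integral_dil1], and the dilation of each slice, treated by induction. *)
Lemma lebesgue_dil n (c : 'rV[R]_n) (r : R) A : 0 < r -> measurable A ->
  (lebesgue_rV R n A = (r ^+ n)%:E * lebesgue_rV R n (dil c r @^-1` A))%E.
Proof.
move=> r0; elim: n c A => [|n IH] c A mA.
  have E0 (x : 'rV[R]_0) : x = 0 by apply/rowP => -[].
  rewrite /= expr0 mul1e !diracE; rewrite (_ : (0 \in A) = (0 \in dil c r @^-1` A))//.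
  by apply/idP/idP; rewrite !inE /preimage/= [dil _ _ _]E0.
pose F x := lebesgue_rV R n [set y | A (cons_rV (x, y))].
have mF : measurable_fun setT F.
  rewrite (_ : F = lebesgue_rV R n \o xsection (@cons_rV R n @^-1` A)).
    apply: measurable_fun_xsection.
    exact: (measurable_preT (@measurable_cons_rV R n)).
  by apply/funext => x; rewrite /F cons_rV_xsection.
have F0 x : (0 <= F x)%E by [].
have mAx x : measurable [set y | A (cons_rV (x, y))].
  rewrite cons_rV_xsection; apply: measurable_xsection.
  exact: (measurable_preT (@measurable_cons_rV R n)).
rewrite !lebesgue_rVS -/F (@ge0_integral_dil1 (c 0 ord0) r)//.
rewrite exprS EFinM -muleA; congr *%E.
rewrite -ge0_integralZl_EFin//.
- apply: eq_integral => x _; rewrite /F.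
  rewrite (IH (\row_j c 0 (lift ord0 j)))//; congr (_ * lebesgue_rV R n _)%E.
  apply/funext => y /=; congr A; apply/rowP => j; rewrite /dil !mxE ?/=.
  by case: unliftP => [k ->|->]; rewrite ?mxE.
- under eq_fun do rewrite cons_rV_xsection.
  apply: measurable_fun_xsection.
  by apply: (measurable_preT (@measurable_cons_rV R n)); apply: (measurable_preT (measurable_dil c r)).
- by rewrite exprn_ge0// ltW.
Qed.

Lemma lebesgue_cube n (z : 'rV[R]_n) (r : R) : 0 < r ->
  lebesgue_rV R n (cube z r) = ((2 * r) ^+ n)%:E.
Proof.
move=> r0; elim: n z => [|n IH] z.
  by rewrite /= expr0 diracE mem_set// => -[].
transitivity ((@lebesgue_measure R \x lebesgue_rV R n)%E (@cons_rV R n @^-1` (cube z r))) => //.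
rewrite (_ : _ @^-1` _ = `]z 0 ord0 - r, z 0 ord0 + r[%classic `*` cube (\row_j z 0 (lift ord0 j)) r).
  rewrite product_measure1E//; last exact: measurable_box.
  rewrite IH; transitivity (lebesgue_measure [set` `](z 0 ord0 - r), (z 0 ord0 + r)[%R] * (((2*r)^+n)%R)%:E)%E => //.
  rewrite lebesgue_measure_itv/= lte_fin ifT; last by lra.
  by rewrite -EFinB -EFinM exprS; congr EFin; congr (_ * _); ring.
apply/seteqP; split => -[x y] /=.
  move=> h; split; first by have := h ord0; rewrite !mxE/= unlift_none in_itv.
  by move=> j; have := h (lift ord0 j); rewrite !mxE/= liftK.
rewrite in_itv/= => -[h1 h2] i; rewrite !mxE/=.
by case: unliftP => [k ->|->]//; have := h2 k; rewrite !mxE.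
Qed.

Lemma bounded_cube n (A : set 'rV[R]_n) : bounded_set A ->
  exists2 r, 0 < r & A `<=` cube 0 r.
Proof.
move=> [M [Mr hM]]; exists (`|M| + 2); first by rewrite ltr_wpDl.
move=> x Ax i; have Mx : `|x| <= `|M| + 1 by apply: hM => //; rewrite ltr_pwDr// ler_norm.
have : `|x 0 i| <= `|x| by rewrite [leRHS]mx_normrE; exact: (le_bigmax _ (fun p => `|x p.1 p.2|) (0, i)).
by rewrite !mxE ler_norml; lra.
Qed.

Lemma lebesgue_bounded n (A : set 'rV[R]_n) : measurable A -> bounded_set A ->
  (lebesgue_rV R n A < +oo)%E.
Proof.
move=> mA /bounded_cube[r r0 Ar].
apply: (@le_lt_trans _ _ (lebesgue_rV R n (cube 0 r))).
  by apply: le_measure => //; rewrite inE//; exact: measurable_box.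
by rewrite lebesgue_cube// ltry.
Qed.

Section integral_dil.
Variables (n : nat) (c : 'rV[R]_n) (r : R).
Hypothesis r0 : 0 < r.
Local Notation leb := (lebesgue_rV R n).

Lemma ge0_integral_dil D (f : 'rV[R]_n -> \bar R) : measurable D ->
  measurable_fun D f -> (forall x, D x -> 0 <= f x)%E ->
  (\int[leb]_(x in D) f x =
   (r ^+ n)%:E * \int[leb]_(x in dil c r @^-1` D) f (dil c r x))%E.
Proof.
move=> mD mf f0; have rn0 : 0 <= r ^+ n by rewrite exprn_ge0// ltW.
rewrite (eq_measure_integral (mscale (NngNum rn0) (pushforward_measure
    leb (measurable_dil c r)))).
  rewrite ge0_integral_mscale//=; congr *%E.
  rewrite ge0_integral_pushforward//; first exact: measurable_dil.
  by move=> x; rewrite inE; exact: f0.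
by move=> A mA _; exact: lebesgue_dil.
Qed.

Lemma integrable_dil D (f : 'rV[R]_n -> R) : measurable D ->
  leb.-integrable D (EFin \o f) ->
  leb.-integrable (dil c r @^-1` D) (EFin \o (f \o dil c r)).
Proof.
move=> mD /integrableP[mf fi]; apply/integrableP; split.
  apply/measurable_EFinP; move/measurable_EFinP : mf => mf.
  apply: (measurable_comp mD) => //; first by move=> _ [x Dx <-].
  by apply: measurable_funTS; exact: measurable_dil.
move: fi; rewrite ge0_integral_dil//; last by apply: measurableT_comp.
by apply: contraTT; rewrite -!leNgt !leye_eq => /eqP ->; rewrite gt0_muley// lte_fin exprn_gt0.
Qed.

Lemma Rintegral_dil D (f : 'rV[R]_n -> R) : measurable D ->
  leb.-integrable D (EFin \o f) ->
  \int[leb]_(x in D) f x = r ^+ n * \int[leb]_(x in dil c r @^-1` D) f (dil c r x).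
Proof.
move=> mD fi; have /integrableP[mf _] := fi.
have fi' := integrable_dil mD fi.
rewrite /Rintegral -[r ^+ n in RHS]/(fine (r ^+ n)%:E) -fineM//; last first.
  by apply: integrable_fin_num => //; apply: (measurable_preT (measurable_dil c r)).
rewrite integralE [in RHS]integralE.
rewrite muleBr//; last first.
  apply: fin_num_adde_defl; rewrite fin_numN; apply: integrable_neg_fin_num => //.
  exact: (measurable_preT (measurable_dil c r)).
rewrite (@ge0_integral_dil D (fun x => (f x)%:E)^\+%E)//; last exact: measurable_funepos.
rewrite (@ge0_integral_dil D (fun x => (f x)%:E)^\-%E)//; last exact: measurable_funeneg.
by congr (fine (_ * _ - _ * _)); apply: eq_integral => x _; rewrite !(funeposE, funenegE).
Qed.

End integral_dil.

End dilation.

(** * Smooth functions and radial bumps *)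

Section directional.
Context {R : realType} {n : nat}.
Implicit Types (f g : 'rV[R]_n -> R) (x v : 'rV[R]_n).

(** The difference quotient is constant. This covers coordinates, affine paths and functions that
    are constant along a line. *)
Lemma is_derive_lineZ (V W : normedModType R) (f : V -> W) (a v : V) (d : W) :
  (forall h : R, f (h *: v + a) - f a = h *: d) -> is_derive a v f d.
Proof.
move=> fE; have cv : h^-1 *: (f (h *: v + a) - f a) @[h --> 0^'] --> d.
  apply: cvg_near_cst; near=> h.
  rewrite fE scalerA mulVf ?scale1r//.
  by near: h; exact: nbhs_dnbhs_neq.
by apply: DeriveDef; [apply/cvg_ex; exists d|exact: cvg_lim cv].
Unshelve. all: by end_near. Qed.

Lemma is_derive_line (V : normedModType R) (f : V -> R) (a v : V) (d : R) :
  (forall h : R, f (h *: v + a) - f a = h * d) -> is_derive a v f d.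
Proof. exact: is_derive_lineZ. Qed.

Lemma is_derive_coord i x v : is_derive x v (fun y : 'rV[R]_n => y 0 i) (v 0 i).
Proof. by apply: is_derive_line => h; rewrite !mxE; ring. Qed.

Lemma differentiableM' f g x : differentiable f x -> differentiable g x ->
  differentiable (fun y => f y * g y) x.
Proof. exact: differentiableM. Qed.

Lemma differentiableD' f g x : differentiable f x -> differentiable g x ->
  differentiable (fun y => f y + g y) x.
Proof. exact: differentiableD. Qed.

Lemma derivative_comp (V : normedModType R) (h : R -> R) (f : V -> R) (x v : V) dh :
  differentiable f x -> is_derive (f x) 1 h dh ->
  differentiable (h \o f) x /\ 'D_v (h \o f) x = dh * 'D_v f x.
Proof.
move=> df [dh1 dh2]; have dh' : differentiable h (f x) by exact/derivable1_diffP.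
have dhf : differentiable (h \o f) x by exact: differentiable_comp.
split=> //; rewrite deriveE// diff_comp//= deriv1E// derive1E dh2 -deriveE//.
by rewrite [LHS]mulrC.
Qed.

End directional.

Section smooth.
Context {R : realType} {n : nat}.
Implicit Types (f g : 'rV[R]_n -> R) (x v : 'rV[R]_n).

(** Differentiability to finite order. [smooth] quantifies over words of partial derivatives and
    offers no induction; closure under products and compositions is proved by induction on this
    order. *)
Fixpoint smoothN m f : Prop := (forall x, differentiable f x) /\
  if m is p.+1 then forall i, smoothN p (partial i f) else True.

Lemma smoothN_diff m f x : smoothN m f -> differentiable f x.
Proof. by case: m => [|m] [+ _]; exact. Qed.

Lemma smoothN_le m p f : (m <= p)%N -> smoothN p f -> smoothN m f.
Proof.
elim: m p f => [|m IH] p f; first by move=> _ sf; split=> // x; exact: smoothN_diff sf.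
case: p => [//|p mp [df pf]]; split; first exact: df.
by move=> i; apply: (IH p); [exact: mp|exact: pf].
Qed.

(** In [foldr partial f s] the last letter of [s] acts first, and this is the derivative that
    [smoothN] peels off; hence the words are split at their right end. *)
Lemma smoothNP f : smooth f <-> forall m, smoothN m f.
Proof.
split.
  move=> sf m; elim: m f sf => [|m IH] f sf; split=> //.
  - exact: (sf [::]).
  - exact: (sf [::]).
  - by move=> i; apply: IH => s x; have := sf (rcons s i) x; rewrite foldr_rcons.
move=> sf s; elim/last_ind: s f sf => [|s i IH] f sf x; first exact: smoothN_diff (sf 0%N).
by rewrite foldr_rcons; apply: IH => m; have [_] := sf m.+1; exact.
Qed.

Lemma smooth_partial f i : smooth f -> smooth (partial i f).
Proof. by move=> sf s x; have := sf (rcons s i) x; rewrite foldr_rcons. Qed.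

Lemma smooth_diff f x : smooth f -> differentiable f x.
Proof. by move=> sf; exact: (sf [::]). Qed.

Lemma smooth_continuous f : smooth f -> continuous f.
Proof. by move=> sf x; exact/differentiable_continuous/smooth_diff. Qed.

Lemma partial_cst c i : partial i (fun=> c) = (fun=> 0) :> ('rV[R]_n -> R).
Proof. by apply/funext => x; rewrite /partial derive_cst. Qed.

Lemma partialD f g i : (forall x, differentiable f x) -> (forall x, differentiable g x) ->
  partial i (fun x => f x + g x) = (fun x => partial i f x + partial i g x).
Proof.
by move=> df dg; apply/funext => x; rewrite /partial deriveD//; exact: diff_derivable.
Qed.

Lemma partialM f g i : (forall x, differentiable f x) -> (forall x, differentiable g x) ->
  partial i (fun x => f x * g x) = (fun x => f x * partial i g x + g x * partial i f x).
Proof.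
by move=> df dg; apply/funext => x; rewrite /partial deriveM//; exact: diff_derivable.
Qed.

Lemma smoothN_cst m c : smoothN m (fun=> c).
Proof.
elim: m c => [|m IH] c; split=> //; try by move=> x; exact: differentiable_cst.
by move=> i; rewrite partial_cst.
Qed.

Lemma smoothND m f g : smoothN m f -> smoothN m g -> smoothN m (fun x => f x + g x).
Proof.
elim: m f g => [|m IH] f g sf sg; split=> //.
- by move=> x; apply: differentiableD'; [apply: smoothN_diff sf|apply: smoothN_diff sg].
- by move=> x; apply: differentiableD'; [apply: smoothN_diff sf|apply: smoothN_diff sg].
- by move: sf sg => [df sf] [dg sg] i; rewrite partialD//; apply: IH; [exact: sf|exact: sg].
Qed.

Lemma smoothNM m f g : smoothN m f -> smoothN m g -> smoothN m (fun x => f x * g x).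
Proof.
elim: m f g => [|m IH] f g sf sg; split=> //.
- by move=> x; apply: differentiableM'; [apply: smoothN_diff sf|apply: smoothN_diff sg].
- by move=> x; apply: differentiableM'; [apply: smoothN_diff sf|apply: smoothN_diff sg].
- have [df pf] := sf; have [dg pg] := sg; move=> i; rewrite partialM//.
  apply: smoothND; apply: IH; [|exact: pg| |exact: pf].
    exact: (@smoothN_le _ m.+1).
  exact: (@smoothN_le _ m.+1).
Qed.

Lemma smoothN_coord m i : smoothN m (fun x : 'rV[R]_n => x 0 i).
Proof.
case: m => [|m]; split=> //; try by move=> x; exact: differentiable_coord.
move=> j; rewrite (_ : partial j _ = fun=> (delta_mx 0 j : 'rV[R]_n) 0 i).
  exact: smoothN_cst.
by apply/funext => x; rewrite /partial; have [_ ->] := is_derive_coord i x (delta_mx 0 j).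
Qed.

Lemma smooth_cst c : smooth (fun _ : 'rV[R]_n => c).
Proof. by apply/smoothNP => m; exact: smoothN_cst. Qed.

Lemma smooth_coord i : smooth (fun x : 'rV[R]_n => x 0 i).
Proof. by apply/smoothNP => m; exact: smoothN_coord. Qed.

Lemma smoothD f g : smooth f -> smooth g -> smooth (fun x => f x + g x).
Proof. by move=> /smoothNP sf /smoothNP sg; apply/smoothNP => m; exact: smoothND. Qed.

Lemma smoothM f g : smooth f -> smooth g -> smooth (fun x => f x * g x).
Proof. by move=> /smoothNP sf /smoothNP sg; apply/smoothNP => m; exact: smoothNM. Qed.

Lemma smoothZ c f : smooth f -> smooth (fun x => c * f x).
Proof. by apply: smoothM; exact: smooth_cst. Qed.

Lemma smooth_opp f : smooth f -> smooth (fun x => - f x).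
Proof. by under eq_fun do rewrite -mulN1r; exact: smoothZ. Qed.

Lemma smoothB f g : smooth f -> smooth g -> smooth (fun x => f x - g x).
Proof. by move=> sf sg; apply: smoothD => //; exact: smooth_opp. Qed.

Lemma smooth_sum (I : Type) (r : seq I) (P : pred I) (F : I -> 'rV[R]_n -> R) :
  (forall i, P i -> smooth (F i)) -> smooth (fun x => \sum_(i <- r | P i) F i x).
Proof.
move=> sF; elim: r => [|i r IH].
  rewrite (_ : (fun _ => _) = fun=> 0); first exact: smooth_cst.
  by apply/funext => x; rewrite big_nil.
have [Pi|Pi] := boolP (P i); last first.
  by under eq_fun do rewrite big_cons (negbTE Pi).
under eq_fun do rewrite big_cons Pi.
by apply: smoothD; [exact: sF|exact: IH].
Qed.

Lemma smooth_prod (I : Type) (r : seq I) (P : pred I) (F : I -> 'rV[R]_n -> R) :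
  (forall i, P i -> smooth (F i)) -> smooth (fun x => \prod_(i <- r | P i) F i x).
Proof.
move=> sF; elim: r => [|i r IH].
  rewrite (_ : (fun _ => _) = fun=> 1); first exact: smooth_cst.
  by apply/funext => x; rewrite big_nil.
have [Pi|Pi] := boolP (P i); last first.
  by under eq_fun do rewrite big_cons (negbTE Pi).
under eq_fun do rewrite big_cons Pi.
by apply: smoothM; [exact: sF|exact: IH].
Qed.

Lemma smoothX f k : smooth f -> smooth (fun x => f x ^+ k).
Proof.
move=> sf; elim: k => [|k IH].
  by under eq_fun do rewrite expr0; exact: smooth_cst.
by under eq_fun do rewrite exprS; exact: smoothM.
Qed.

Lemma derive_partial f x v : differentiable f x ->
  'D_v f x = \sum_i v 0 i * partial i f x.
Proof.
move=> df; rewrite deriveE// [X in 'd f x X]row_sum_delta linear_sum.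
by apply: eq_bigr => i _; rewrite linearZ /partial deriveE.
Qed.

Lemma smooth_derive f v : smooth f -> smooth (fun x => 'D_v f x).
Proof.
move=> sf; rewrite (_ : (fun _ => _) = fun x => \sum_i v 0 i * partial i f x).
  by apply: smooth_sum => i _; apply: smoothZ; exact: smooth_partial.
by apply/funext => x; rewrite derive_partial//; exact: smooth_diff.
Qed.

End smooth.

(** * A flat function and its derivatives *)

Section flat.
Context {R : realType}.
Implicit Types (t : R) (j : nat).

(* [flat 0] is the standard flat function; the family is closed under derivation. *)
Definition flat j t : R := if 0 < t then t^-1 ^+ j * expR (- t^-1) else 0.

Lemma flat_ge0 j t : 0 <= flat j t.
Proof.
rewrite /flat; case: ifPn => // t0.
by rewrite mulr_ge0 ?expR_ge0// exprn_ge0// invr_ge0 ltW.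
Qed.

Lemma flat_le0 j t : t <= 0 -> flat j t = 0.
Proof. by rewrite /flat leNgt => /negbTE ->. Qed.

Lemma exprn_expRN k (u : R) : 0 <= u -> u ^+ k * expR (- u) <= k`!%:R.
Proof.
move=> u0; rewrite expRN ler_pdivrMr ?expR_gt0//.
case: k => [|k].
  rewrite expr0 fact0 mul1r; apply: le_trans (expR_ge1Dx u); lra.
rewrite mulrC -ler_pdivrMr ?ltr0n ?fact_gt0//.
by apply: le_trans (expR_ge1Dxn k u0); rewrite lerDr.
Qed.

Lemma flat_le j t : flat j t <= j`!%:R.
Proof.
rewrite /flat; case: ifPn => [t0|_]; last by [].
by apply: exprn_expRN; rewrite invr_ge0 ltW.
Qed.

(** The bound [u ^+ k * expR (- u) <= k!] for [u = t^-1] and [k = j + 2]. The quadratic decay is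
    what gives [flat j] the derivative 0 at the origin. *)
Lemma flat_le_sqr j t : flat j t <= (j.+2)`!%:R * t ^+ 2.
Proof.
rewrite /flat; case: ifPn => [t0|_]; last by rewrite mulr_ge0 ?sqr_ge0.
rewrite -ler_pdivrMr ?exprn_gt0//.
rewrite (_ : _ / _ = t^-1 ^+ j.+2 * expR (- t^-1)); last first.
  by rewrite -(addn2 j) exprD -(exprVn t 2); ring.
by apply: exprn_expRN; rewrite invr_ge0 ltW.
Qed.

Lemma is_derive_flat j t :
  is_derive t 1 (flat j) (flat j.+2 t - j%:R * flat j.+1 t).
Proof.
have [t0|t0|->] := ltgtP t 0.
- rewrite !flat_le0 ?(ltW t0)// mulr0 subrr.
  apply: (@near_eq_is_derive _ _ _ (cst 0)).
  by near=> s; rewrite flat_le0// ltW//; near: s; exact: lt_nbhsl.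
- have t0' : t != 0 by rewrite gt_eqF.
  apply: (@near_eq_is_derive R R R (fun s : R => s^-1 ^+ j * expR (- s^-1)) (flat j) t 1).
    near=> s; rewrite /flat ifT//; near: s; exact: lt_nbhsr.
  have dV : is_derive t 1 (fun s : R => s^-1) (- t ^- 2).
    by apply: is_derive_eq; first exact: (@is_deriveV _ id); rewrite /GRing.scale/= mulr1.
  have dP (u : R) : is_derive u 1 (fun u => u ^+ j * expR (- u))
      (u ^+ j * - expR (- u) + expR (- u) * (j%:R * u ^+ j.-1)).
    have dX : is_derive u 1 (fun u : R => u ^+ j) (j%:R * u ^+ j.-1).
      by apply: DeriveDef; [exact: exprn_derivable|rewrite exp_derive /GRing.scale/= mulr1].
    have dE : is_derive u 1 (fun u : R => expR (- u)) (- expR (- u)).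
      by apply: is_derive_eq; rewrite ?mulrN1.
    exact: (is_deriveM dX dE).
  have := @is_derive1_comp R (fun u => u ^+ j * expR (- u)) (fun s : R => s^-1) t _ _ (dP _) dV.
  rewrite [X in is_derive _ _ _ X -> _](_ : _ = flat j.+2 t - j%:R * flat j.+1 t); first exact.
  rewrite /flat t0; case: j {dP} => [|j]; rewrite /= ?expr0 !exprS -?exprVn; by field.
- have fl0 : flat j 0 = 0 :> R by rewrite flat_le0.
  rewrite (flat_le0 j.+2)// (flat_le0 j.+1)// mulr0 subrr.
  have cv : h^-1 *: (flat j (h *: 1 + 0) - flat j 0) @[h --> 0^'] --> (0 : R).
    apply/cvgrPdist_le => e e0; near=> h.
    rewrite fl0 subr0 addr0 sub0r normrN {2}/GRing.scale/= mulr1 normrM.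
    have h0 : h != 0 by near: h; exact: nbhs_dnbhs_neq.
    rewrite normfV ler_pdivrMl ?normr_gt0// (ger0_norm (flat_ge0 _ _)).
    apply: le_trans (flat_le_sqr _ _) _; rewrite -real_normK ?num_real// expr2 mulrCA ler_wpM2l//.
    rewrite -ler_pdivlMl ?ltr0n ?fact_gt0//.
    by near: h; apply: dnbhs0_le; rewrite mulr_gt0// invr_gt0 ltr0n fact_gt0.
  by apply: DeriveDef; [apply/cvg_ex; exists 0|exact: cvg_lim cv].
Unshelve. all: by end_near. Qed.

(** For [t > 0] the value is [expR (- (k.+1%:R * t)^-1)], which tends to 1. The scaled functions are
    smooth approximations, with values in [[0, 1]], of the indicator of an open half-line. *)
Lemma flat_scale_cvg t :
  flat 0 (k.+1%:R * t) @[k --> \oo] --> (if 0 < t then 1 else 0 : R).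
Proof.
case: ifPn => [t0|]; last first.
  rewrite -leNgt => t0; apply: cvg_near_cst; near=> k.
  by rewrite flat_le0// mulr_ge0_le0.
rewrite (_ : (fun _ => _) = (fun s => expR (- (s * t^-1))) \o harmonic); last first.
  by apply/funext => k; rewrite /flat mulr_gt0 ?ltr0n// expr0 mul1r invfM.
rewrite (_ : 1 = expR (- (0 * t^-1))); last by rewrite mul0r oppr0 expR0.
apply: cvg_comp; first exact: cvg_harmonic.
apply: (@continuous_comp _ _ _ (fun s : R => - (s * t^-1)) expR); last exact: continuous_expR.
by apply: continuousN; exact: mulrr_continuous.
Unshelve. all: by end_near. Qed.

End flat.

Section smooth_comp.
Context {R : realType} {n : nat}.
Implicit Types (f g : 'rV[R]_n -> R).

Lemma derive_flat f j x v : differentiable f x ->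
  'D_v (fun y => flat j (f y)) x =
    (flat j.+2 (f x) - j%:R * flat j.+1 (f x)) * 'D_v f x.
Proof. by move=> df; have [] := derivative_comp v df (is_derive_flat j (f x)). Qed.

(** Induction on the order with [j] general, because a derivative moves the index to [j + 1] and
    [j + 2]. *)
Lemma smooth_flat f j : smooth f -> smooth (fun x => flat j (f x)).
Proof.
move=> /smoothNP sf; apply/smoothNP => m; elim: m j => [|m IH] j; split=> //.
1,2: by move=> x; have [] := derivative_comp 0 (smoothN_diff x (sf 0%N)) (is_derive_flat j (f x)).
move=> i; rewrite (_ : partial i _ = fun x => (flat j.+2 (f x) + - j%:R * flat j.+1 (f x)) * partial i f x).
  apply: smoothNM; last by have [_] := sf m.+1; exact.
  by apply: smoothND => //; apply: smoothNM => //; exact: smoothN_cst.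
apply/funext => x; rewrite {1}/partial derive_flat; last exact: smoothN_diff (sf 0%N).
by rewrite mulNr.
Qed.

Lemma differentiable_row m (A : 'rV[R]_n -> 'rV[R]_m) x :
  (forall j, differentiable (fun y => A y 0 j) x) -> differentiable A x.
Proof.
move=> dA; rewrite (_ : A = \sum_(j < m) (fun y => A y 0 j *: (delta_mx 0 j : 'rV[R]_m))).
  by apply: differentiable_sum => j; exact: differentiableZl.
by apply/funext => y; rewrite fct_sumE [LHS]row_sum_delta.
Qed.

Lemma derive_comp_row m (A : 'rV[R]_n -> 'rV[R]_m) (h : 'rV[R]_m -> R) x v :
  (forall j, differentiable (fun y => A y 0 j) x) -> differentiable h (A x) ->
  differentiable (h \o A) x /\
  'D_v (h \o A) x = \sum_j 'D_v (fun y => A y 0 j) x * partial j h (A x).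
Proof.
move=> dAj dh; have dA := differentiable_row dAj.
have dhA : differentiable (h \o A) x by exact: differentiable_comp.
split=> //; rewrite deriveE// diff_comp//= -!deriveE// derive_partial//.
by apply: eq_bigr => j _; rewrite derive_mx ?mxE//; exact: diff_derivable.
Qed.

Lemma smoothN_sum p (J : Type) (s : seq J) (P : pred J) (F : J -> 'rV[R]_n -> R) :
  (forall i, P i -> smoothN p (F i)) -> smoothN p (fun x => \sum_(i <- s | P i) F i x).
Proof.
move=> sF; elim: s => [|i s IH].
  rewrite (_ : (fun _ => _) = fun=> 0); first exact: smoothN_cst.
  by apply/funext => x; rewrite big_nil.
have [Pi|Pi] := boolP (P i); last first.
  by under eq_fun do rewrite big_cons (negbTE Pi).
under eq_fun do rewrite big_cons Pi.
by apply: smoothND; [exact: sF|exact: IH].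
Qed.

Lemma smoothN_comp m p (A : 'rV[R]_n -> 'rV[R]_m) (h : 'rV[R]_m -> R) :
  (forall j, smooth (fun y => A y 0 j)) -> smoothN p h -> smoothN p (h \o A).
Proof.
move=> sA; elim: p h => [|p IH] h sh.
  split=> // x; have [] // := @derive_comp_row m A h x 0 _ _.
    by move=> j; exact: smooth_diff.
  exact: smoothN_diff sh.
split.
  move=> x; have [] // := @derive_comp_row m A h x 0 _ _.
    by move=> j; exact: smooth_diff.
  exact: smoothN_diff sh.
move=> i; rewrite (_ : partial i _ = fun x =>
    \sum_j partial i (fun y => A y 0 j) x * (partial j h \o A) x); last first.
  apply/funext => x; rewrite {1}/partial.
  have [] // := @derive_comp_row m A h x (delta_mx 0 i) _ _.
    by move=> j; exact: smooth_diff.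
  exact: smoothN_diff sh.
apply: smoothN_sum => j _; apply: smoothNM; last by apply: IH; have [_] := sh; exact.
by move: p {IH sh}; apply/smoothNP; exact: smooth_partial.
Qed.

Lemma smooth_comp m (A : 'rV[R]_n -> 'rV[R]_m) (h : 'rV[R]_m -> R) :
  (forall j, smooth (fun y => A y 0 j)) -> smooth h -> smooth (h \o A).
Proof.
by move=> sA /smoothNP sh; apply/smoothNP => p; exact: smoothN_comp.
Qed.

End smooth_comp.

(** * The Euclidean inner product and radial bumps *)

Section rbump.
Context {R : realType} {n : nat}.
Implicit Types (c x y v : 'rV[R]_n) (r : R).

Lemma dotvC x y : dotv x y = dotv y x.
Proof. by apply: eq_bigr => i _; rewrite mulrC. Qed.

Lemma dotvDl x y v : dotv (x + y) v = dotv x v + dotv y v.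
Proof. by rewrite /dotv -big_split/=; apply: eq_bigr => i _; rewrite mxE mulrDl. Qed.

Lemma dotvZl (a : R) x y : dotv (a *: x) y = a * dotv x y.
Proof. by rewrite /dotv big_distrr/=; apply: eq_bigr => i _; rewrite mxE mulrA. Qed.

Lemma dotvNl x y : dotv (- x) y = - dotv x y.
Proof. by rewrite -scaleN1r dotvZl mulN1r. Qed.

Lemma dotvBl x y v : dotv (x - y) v = dotv x v - dotv y v.
Proof. by rewrite dotvDl dotvNl. Qed.

Lemma dotvDr v x y : dotv v (x + y) = dotv v x + dotv v y.
Proof. by rewrite dotvC dotvDl !(dotvC v). Qed.

Lemma dotvZr (a : R) x y : dotv y (a *: x) = a * dotv y x.
Proof. by rewrite dotvC dotvZl (dotvC y). Qed.

Lemma dotvBr v x y : dotv v (x - y) = dotv v x - dotv v y.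
Proof. by rewrite dotvC dotvBl !(dotvC v). Qed.

Lemma dotv0l x : dotv 0 x = 0.
Proof. by rewrite /dotv big1// => i _; rewrite mxE mul0r. Qed.

Lemma dotv_ge0 x : 0 <= dotv x x.
Proof. by apply: sumr_ge0 => i _; rewrite -expr2 sqr_ge0. Qed.

Lemma enorm_ge0 x : 0 <= enorm x. Proof. exact: sqrtr_ge0. Qed.

Lemma enorm_sqr x : enorm x ^+ 2 = dotv x x.
Proof. by rewrite sqr_sqrtr// dotv_ge0. Qed.

Lemma enorm_lt x r : 0 <= r -> (enorm x < r) = (dotv x x < r ^+ 2).
Proof. by move=> r0; rewrite -enorm_sqr ltr_pXn2r// nnegrE// enorm_ge0. Qed.

Lemma enorm_le x r : 0 <= r -> (enorm x <= r) = (dotv x x <= r ^+ 2).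
Proof. by move=> r0; rewrite -enorm_sqr ler_pXn2r// nnegrE// enorm_ge0. Qed.

Lemma coord_enorm x i : `|x 0 i| <= enorm x.
Proof.
rewrite -(@ler_pXn2r _ 2)// ?nnegrE ?enorm_ge0// real_normK ?num_real// enorm_sqr.
rewrite /dotv (bigD1 i)//= -expr2 lerDl.
by apply: sumr_ge0 => j _; rewrite -expr2 sqr_ge0.
Qed.

Lemma enorm_coord x r : 0 <= r -> (forall i, `|x 0 i| <= r) -> enorm x <= n%:R * r.
Proof.
move=> r0 xr; rewrite enorm_le ?mulr_ge0//.
apply: (@le_trans _ _ (\sum_(i < n) r ^+ 2)).
  apply: ler_sum => i _; rewrite -expr2 -(real_normK (num_real _)).
  by rewrite ler_pXn2r// nnegrE.
rewrite sumr_const card_ord -[leLHS]mulr_natl exprMn ler_wpM2r ?sqr_ge0//.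
by rewrite -natrX ler_nat; case: (n) => // k; rewrite expnS leq_pmulr// expn_gt0.
Qed.

Lemma enormN x : enorm (- x) = enorm x.
Proof. by rewrite /enorm dotvNl dotvC dotvNl opprK. Qed.

Lemma enormZ (a : R) x : enorm (a *: x) = `|a| * enorm x.
Proof. by rewrite /enorm dotvZl dotvZr mulrA -expr2 sqrtrM ?sqr_ge0// sqrtr_sqr. Qed.

Lemma dotv_CS x y : dotv x y ^+ 2 <= dotv x x * dotv y y.
Proof.
have h (t : R) : 0 <= dotv x x * t ^+ 2 - 2 * dotv x y * t + dotv y y.
  have := dotv_ge0 (t *: x - y); rewrite !(dotvBl, dotvBr, dotvZl, dotvZr) (dotvC y x).
  by rewrite (_ : _ - _ = dotv x x * t ^+ 2 - 2 * dotv x y * t + dotv y y)//; ring.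
have [x0|x0] := eqVneq (dotv x x) 0.
  rewrite x0 mul0r; have := h 0; rewrite x0 => y0.
  have [->|xy0] := eqVneq (dotv x y) 0; first by rewrite expr0n.
  (* With [dotv x x = 0] the polynomial is affine in [t]; this [t] is the point where it takes the
     value -1. *)
  have := h ((dotv y y + 1) / (2 * dotv x y)); rewrite x0 mul0r sub0r.
  rewrite (_ : 2 * _ * _ = dotv y y + 1); last by field.
  by lra.
have xgt0 : 0 < dotv x x by rewrite lt_def x0 dotv_ge0.
have := h (dotv x y / dotv x x).
rewrite (_ : _ + _ = (dotv x x * dotv y y - dotv x y ^+ 2) / dotv x x); last by field.
by rewrite pmulr_lge0 ?invr_gt0// subr_ge0.
Qed.

Lemma dotv_enorm x y : `|dotv x y| <= enorm x * enorm y.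
Proof.
rewrite -(@ler_pXn2r _ 2)// ?nnegrE ?mulr_ge0 ?enorm_ge0//.
by rewrite real_normK ?num_real// exprMn !enorm_sqr dotv_CS.
Qed.

Lemma enormD x y : enorm (x + y) <= enorm x + enorm y.
Proof.
rewrite enorm_le ?addr_ge0 ?enorm_ge0// sqrrD !enorm_sqr !dotvDl !dotvDr (dotvC y x).
have := le_trans (ler_norm _) (dotv_enorm x y); lra.
Qed.

(** A function of the squared distance, hence smooth at the centre as well. Being radially
    decreasing, it has a derivative of known sign in every direction pointing away from [c], which
    is what the facet estimate rests on. *)
Definition rbump c r x : R := flat 0 (1 - r ^- 2 * dotv (x - c) (x - c)).

Lemma smooth_dotv_sub c : smooth (fun x => dotv (x - c) (x - c)).
Proof.
apply: smooth_sum => i _.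
have s1 : smooth (fun x : 'rV[R]_n => (x - c) 0 i).
  under eq_fun do rewrite !mxE.
  by apply: smoothD; [exact: smooth_coord|exact: smooth_cst].
exact: smoothM.
Qed.

Lemma smooth_bump c r : smooth (rbump c r).
Proof.
apply: smooth_flat; apply: smoothB; first exact: smooth_cst.
by apply: smoothZ; exact: smooth_dotv_sub.
Qed.

Lemma derive_bump c r x v : 'D_v (rbump c r) x =
  - (flat 2 (1 - r ^- 2 * dotv (x - c) (x - c)) * (2 * r ^- 2 * dotv (x - c) v)).
Proof.
have sd := smooth_dotv_sub c.
rewrite derive_flat; last first.
  apply: smooth_diff; apply: smoothB; first exact: smooth_cst.
  by apply: smoothZ; exact: smooth_dotv_sub.
rewrite mul0r subr0 -[RHS]mulrN; congr (_ * _).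
rewrite deriveB; [|exact: derivable_cst|apply: diff_derivable; apply: smooth_diff; exact: smoothZ].
rewrite derive_cst sub0r; congr (- _).
rewrite (@deriveMl _ _ (fun x => dotv (x - c) (x - c)) (r ^- 2)); last first.
  by apply: diff_derivable; exact: smooth_diff.
rewrite [RHS](_ : _ = r ^- 2 * (2 * dotv (x - c) v)); last by ring.
congr (_ * _); rewrite /dotv (_ : (fun _ => _) = \sum_(i < n) (fun x : 'rV[R]_n => (x - c) 0 i * (x - c) 0 i)); last first.
  by apply/funext => y; rewrite fct_sumE.
have dc i : is_derive x v (fun x : 'rV[R]_n => (x - c) 0 i) (v 0 i).
  by apply: is_derive_line => h; rewrite !mxE; ring.
rewrite derive_sum; last by move=> i; apply: derivableM; have [] := dc i.
rewrite big_distrr/=; apply: eq_bigr => i _.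
rewrite deriveM; [|by have [] := dc i|by have [] := dc i].
by have [_ ->] := dc i; rewrite /GRing.scale/=; ring.
Qed.

Lemma bump_ge0 c r x : 0 <= rbump c r x. Proof. exact: flat_ge0. Qed.

Lemma bump_le1 c r x : rbump c r x <= 1.
Proof. by have := flat_le 0 (1 - r ^- 2 * dotv (x - c) (x - c)); rewrite fact0. Qed.

Lemma bump_out c r x : 0 < r -> r <= enorm (x - c) -> rbump c r x = 0.
Proof.
move=> r0 h; apply: flat_le0; rewrite subr_le0 mulrC ler_pdivlMr ?exprn_gt0// mul1r.
by rewrite -enorm_sqr ler_pXn2r ?nnegrE ?enorm_ge0// ltW.
Qed.

(** At distance at most [3 / 4 * r] the argument of [flat 0] is at least [1 - 9 / 16 = 7 / 16]; this
    is the origin of [16 / 7]. *)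
Lemma bump_lower c r x : 0 < r -> enorm (x - c) <= 3 / 4 * r ->
  expR (- (16 / 7)) <= rbump c r x.
Proof.
move=> r0 h; have : dotv (x - c) (x - c) * r ^- 2 <= 9 / 16.
  rewrite ler_pdivrMr ?exprn_gt0//; move: h; rewrite enorm_le; last by rewrite mulr_ge0// ltW.
  by rewrite exprMn; lra.
rewrite mulrC /rbump; set s := r ^- 2 * _ => s1.
rewrite /flat ifT; last by lra.
rewrite expr0 mul1r ler_expR lerN2 -[leRHS]invrK lef_pV2 ?posrE ?invr_gt0//; lra.
Qed.

(** The factor 4 is the bound 2 of [flat 2] times the 2 from differentiating the squared distance;
    [enorm (x - c) < r] absorbs one of the two powers of [r^-1]. Outside the ball the derivative is
    zero. *)
Lemma derive_bump_bound c r x v : 0 < r ->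
  `|'D_v (rbump c r) x| <= 4 / r * enorm v.
Proof.
move=> r0; rewrite derive_bump normrN normrM.
have [xr|xr] := leP r (enorm (x - c)).
  rewrite flat_le0; first by rewrite normr0 mul0r mulr_ge0 ?enorm_ge0// divr_ge0// ltW.
  rewrite subr_le0 mulrC ler_pdivlMr ?exprn_gt0// mul1r.
  by rewrite -enorm_sqr ler_pXn2r ?nnegrE ?enorm_ge0// ltW.
have f2 : flat 2 (1 - r ^- 2 * dotv (x - c) (x - c)) <= 2 by exact: flat_le.
rewrite ger0_norm ?flat_ge0//.
apply: (@le_trans _ _ (2 * `|2 * r ^- 2 * dotv (x - c) v|)); first by rewrite ler_wpM2r.
rewrite normrM (@ger0_norm _ (2 * r ^- 2)); last by rewrite mulr_ge0// invr_ge0 exprn_ge0// ltW.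
rewrite (_ : 4 / r * enorm v = 2 * (2 * r ^- 2 * (r * enorm v))); last by field; rewrite gt_eqF.
rewrite ler_wpM2l// ler_wpM2l//; first by rewrite mulr_ge0// invr_ge0 exprn_ge0// ltW.
by apply: le_trans (dotv_enorm _ _) _; rewrite ler_wpM2r ?enorm_ge0// ltW.
Qed.

(** [flat 2] is at least the exponential since its argument is at most 1, and the remaining factor
    is at least [2 * r ^- 2 * (r / 4) = (2 * r)^-1]. *)
Lemma derive_bump_lower c r x v : 0 < r -> enorm (x - c) <= 3 / 4 * r ->
  r / 4 <= dotv (x - c) v ->
  expR (- (16 / 7)) / (2 * r) <= - 'D_v (rbump c r) x.
Proof.
move=> r0 h xv; rewrite derive_bump opprK.
have : dotv (x - c) (x - c) * r ^- 2 <= 9 / 16.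
  rewrite ler_pdivrMr ?exprn_gt0//; move: h; rewrite enorm_le; last by rewrite mulr_ge0// ltW.
  by rewrite exprMn; lra.
have : 0 <= dotv (x - c) (x - c) * r ^- 2.
  by rewrite mulr_ge0 ?dotv_ge0// invr_ge0 exprn_ge0// ltW.
rewrite mulrC; set s := r ^- 2 * _ => s0 s1.
have e0 : 0 < expR (- (16 / 7)) :> R by exact: expR_gt0.
have f2 : expR (- (16 / 7)) <= flat 2 (1 - s).
  rewrite /flat ifT; last by lra.
  rewrite -[leLHS]mul1r; apply: ler_pM; [by []|exact: ltW| |].
    rewrite exprn_ege1// invf_ge1; lra.
  rewrite ler_expR lerN2 -[leRHS]invrK lef_pV2 ?posrE ?invr_gt0//; lra.
have : (2 * r)^-1 <= 2 * r ^- 2 * dotv (x - c) v.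
  rewrite (_ : (2 * r)^-1 = 2 * r ^- 2 * (r / 4)); last by field; rewrite gt_eqF.
  by rewrite ler_wpM2l// mulr_ge0// invr_ge0 exprn_ge0// ltW.
move=> g; apply: ler_pM; [exact: ltW| |exact: f2|exact: g].
by rewrite invr_ge0 mulr_ge0// ltW.
Qed.

End rbump.

(** * Integrals of derivatives over half-spaces *)

Section integr.
Context {R : realType} {n : nat}.
Local Notation leb := (lebesgue_rV R n).
Implicit Types (S A B : set 'rV[R]_n) (f g h : 'rV[R]_n -> R).

Definition integr S f : Prop := leb.-integrable S (EFin \o f).

Lemma integr_measurable S f : integr S f -> measurable_fun S f.
Proof. by move=> /integrableP[/measurable_EFinP]. Qed.

Lemma integrD S f g : measurable S -> integr S f -> integr S g ->
  integr S (fun x => f x + g x).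
Proof. by move=> mS fi gi; exact: (integrableD mS fi gi). Qed.

Lemma integrZ S c f : measurable S -> integr S f -> integr S (fun x => c * f x).
Proof. by move=> mS fi; exact: (integrableZl mS c fi). Qed.

Lemma integrN S f : measurable S -> integr S f -> integr S (fun x => - f x).
Proof. by move=> mS fi; under eq_fun do rewrite -mulN1r; exact: integrZ. Qed.

Lemma integrB S f g : measurable S -> integr S f -> integr S g ->
  integr S (fun x => f x - g x).
Proof. by move=> mS fi gi; apply: integrD => //; exact: integrN. Qed.

Lemma integr0 S : measurable S -> integr S (fun=> 0).
Proof. by move=> mS; exact: integrable0. Qed.

Lemma integr_sum S (J : Type) (s : seq J) (P : pred J) (F : J -> 'rV[R]_n -> R) :
  measurable S -> (forall i, P i -> integr S (F i)) ->
  integr S (fun x => \sum_(i <- s | P i) F i x).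
Proof.
move=> mS Fi; rewrite /integr (_ : EFin \o _ = fun x => (\sum_(i <- s | P i) (F i x)%:E)%E).
  exact: integrable_sum.
by apply/funext => x /=; rewrite sumEFin.
Qed.

Lemma Rintegral_sum S (J : Type) (s : seq J) (P : pred J) (F : J -> 'rV[R]_n -> R) :
  measurable S -> (forall i, P i -> integr S (F i)) ->
  \int[leb]_(x in S) (\sum_(i <- s | P i) F i x) = \sum_(i <- s | P i) \int[leb]_(x in S) F i x.
Proof.
move=> mS Fi; elim: s => [|i s IH].
  rewrite big_nil; under eq_Rintegral do rewrite big_nil.
  by rewrite Rintegral_cst// mul0r.
rewrite big_cons; have [Pi|Pi] := boolP (P i); last first.
  by under eq_Rintegral do rewrite big_cons (negbTE Pi).
under eq_Rintegral do rewrite big_cons Pi.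
by rewrite RintegralD ?IH//; [exact: Fi|exact: integr_sum].
Qed.

Lemma RintegralN S f : measurable S -> integr S f ->
  \int[leb]_(x in S) (- f x) = - \int[leb]_(x in S) f x.
Proof.
by move=> mS fi; under eq_Rintegral do rewrite -mulN1r; rewrite RintegralZl// mulN1r.
Qed.

Lemma integrS A B f : measurable B -> measurable A -> A `<=` B -> integr B f -> integr A f.
Proof. exact: integrableS. Qed.

Lemma integr_restrict S f : measurable S -> integr S f <-> integr setT (f \_ S).
Proof.
by move=> mS; rewrite /integr -restrict_EFin; exact: integrable_mkcond.
Qed.

Lemma integr_bounded S f M : measurable S -> bounded_set S -> measurable_fun S f ->
  (forall x, S x -> `|f x| <= M) -> integr S f.
Proof.
move=> mS bS mf fM; apply: measurable_bounded_integrable => //.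
  exact: lebesgue_bounded.
by exists M; split; rewrite ?num_real// => N MN x Sx; apply: le_trans (ltW MN); exact: fM.
Qed.

Lemma le_integr S f g : measurable S -> measurable_fun S f ->
  (forall x, S x -> `|f x| <= g x) -> integr S g -> integr S f.
Proof.
move=> mS mf fg; apply: le_integrable => //; first exact/measurable_EFinP.
by move=> x Sx; rewrite lee_fin (le_trans (fg _ Sx))// ler_norm.
Qed.

Lemma Rintegral_subset A S f : A `<=` S -> (forall x, S x -> ~ A x -> f x = 0) ->
  \int[leb]_(x in S) f x = \int[leb]_(x in A) f x.
Proof.
move=> AS f0; rewrite Rintegral_mkcond [RHS]Rintegral_mkcond; apply: eq_Rintegral => x _.
rewrite !patchE; case: ifPn => xS; case: ifPn => // xA.
  by apply: f0; [rewrite inE in xS|move=> Ax; move: xA; rewrite notin_setE].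
by move: xS; rewrite notin_setE; case; apply: AS; rewrite inE in xA.
Qed.

Lemma integr_subset A S f : measurable A -> measurable S -> A `<=` S ->
  (forall x, S x -> ~ A x -> f x = 0) -> integr A f -> integr S f.
Proof.
move=> mA mS AS f0 /(integr_restrict _ mA) fi; apply/(integr_restrict _ mS).
rewrite (_ : f \_ S = f \_ A)//; apply/funext => x.
rewrite !patchE; case: ifPn => xS; case: ifPn => // xA.
  by apply: f0; [rewrite inE in xS|move=> Ax; move: xA; rewrite notin_setE].
by move: xS; rewrite notin_setE; case; apply: AS; rewrite inE in xA.
Qed.

Lemma bounded_set_cube (c : 'rV[R]_n) s : bounded_set (cube c s).
Proof.
exists (`|c| + `|s|); split; rewrite ?num_real// => s' ss' x xs.
apply: le_trans (ltW ss'); rewrite [leLHS]/Num.Def.normr/= mx_normrE; apply: bigmax_le.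
  by rewrite addr_ge0.
move=> [i j] _ /=; rewrite ord1; have := xs j; rewrite !mxE.
have : `|c 0 j| <= `|c|.
  by rewrite [leRHS]mx_normrE; exact: (le_bigmax _ (fun p => `|c p.1 p.2|) (0, j)).
move: (ler_norm s); rewrite !ler_norml; lra.
Qed.

Lemma measurable_shift f (w : 'rV[R]_n) : measurable_fun setT f ->
  measurable_fun setT (fun x : 'rV[R]_n => f (x + w)).
Proof.
move=> mf; rewrite (_ : (fun _ => _) = f \o dil w 1); last first.
  by apply/funext => x /=; rewrite /dil scale1r addrC.
by apply: measurableT_comp => //; exact: measurable_dil.
Qed.

Lemma Rintegral_shift f (w : 'rV[R]_n) S : measurable S -> integr S f ->
  \int[leb]_(x in [set x : 'rV[R]_n | S (x + w)]) f (x + w) = \int[leb]_(x in S) f x.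
Proof.
move=> mS fi; rewrite [RHS](Rintegral_dil w ltr01 mS fi) expr1n mul1r.
rewrite (_ : mkset _ = dil w 1 @^-1` S); last first.
  by apply/seteqP; split=> x /=; rewrite /dil scale1r addrC.
by apply: eq_Rintegral => x _; rewrite /dil scale1r addrC.
Qed.

Lemma integr_shift f (w : 'rV[R]_n) S : measurable S -> integr S f ->
  integr [set x : 'rV[R]_n | S (x + w)] (fun x => f (x + w)).
Proof.
move=> mS fi; have := integrable_dil w ltr01 mS fi.
rewrite /integr (_ : mkset _ = dil w 1 @^-1` S); last first.
  by apply/seteqP; split=> x /=; rewrite /dil scale1r addrC.
rewrite (_ : f \o dil w 1 = fun x => f (x + w))//.
by apply/funext => x /=; rewrite /dil scale1r addrC.
Qed.

(** Difference quotients along the sequence of steps [1 / (k + 1)], the form required by dominated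
    convergence. *)
Lemma cvg_succ_quotient f (x v : 'rV[R]_n) : derivable f x v ->
  k.+1%:R * (f (x + k.+1%:R^-1 *: v) - f x) @[k --> \oo] --> 'D_v f x.
Proof.
move=> /cvg_ex[/= l fl].
have -> : 'D_v f x = l by exact: cvg_lim fl.
have hd : (@harmonic R) k @[k --> \oo] --> (0 : R)^'.
  move=> A /= [e e0 eA]; have := @cvg_harmonic R.
  move=> /cvgrPdist_lt/(_ _ e0) [N _ NA]; exists N => // k Nk; apply: eA.
    by have := NA _ Nk; rewrite /ball_/= sub0r normrN.
  by rewrite /harmonic invr_neq0// pnatr_eq0.
have := cvg_comp _ _ hd fl; apply: cvg_trans; apply: near_eq_cvg; near=> k.
by rewrite /= /harmonic invrK (addrC x).
Unshelve. all: by end_near. Qed.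

(** By translation invariance all difference quotients have integral zero, and the Lipschitz bound
    in the single direction [v] dominates them. Continuity of [f] is not assumed, so [f] may be a
    smooth function cut off at a half-space. *)
Lemma int_diffquot f g (v : 'rV[R]_n) (M N r : R) : 0 < r -> measurable_fun setT f ->
  (forall x, `|f x| <= N) -> (forall x, ~ cube 0 r x -> f x = 0) ->
  (forall (x : 'rV[R]_n) k, `|f (x + k.+1%:R^-1 *: v) - f x| <= M * k.+1%:R^-1) ->
  (forall x : 'rV[R]_n, k.+1%:R * (f (x + k.+1%:R^-1 *: v) - f x) @[k --> \oo] --> g x) ->
  integr setT g /\ \int[leb]_x g x = 0.
Proof.
move=> r0 mf fN f0 fM fg.
have mcube s : measurable (cube (0 : 'rV[R]_n) s) by exact: measurable_box.
have fi : integr setT f.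
  apply: (@integr_subset (cube 0 r)) => //; first by move=> x _; exact: f0.
  by apply: (@integr_bounded _ _ N) => //; [exact: bounded_set_cube|exact: measurable_funTS].
pose F k (x : 'rV[R]_n) := k.+1%:R * (f (x + k.+1%:R^-1 *: v) - f x).
have mt k : measurable_fun setT (fun x : 'rV[R]_n => f (x + k.+1%:R^-1 *: v)).
  exact: measurable_shift.
have fik k : integr setT (fun x => f (x + k.+1%:R^-1 *: v)).
  exact: (@integr_shift f (k.+1%:R^-1 *: v) setT).
have F0 k : \int[leb]_x F k x = 0.
  rewrite RintegralZl//; last exact: integrB.
  have := Rintegral_shift (k.+1%:R^-1 *: v) measurableT fi.
  rewrite (_ : mkset _ = setT); last by apply/seteqP; split.
  move=> E; rewrite RintegralB//; first by rewrite [X in X - _]E subrr mulr0.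
  exact: fik.
have Fi k : integr setT (F k) by apply: integrZ => //; exact: integrB.
have mF k : measurable_fun setT (F k) by exact: integr_measurable.
(* Translates of the support by at most [v] stay in the cube of this half-width. *)
pose r' := r + `|v|.
pose G (x : 'rV[R]_n) : R := `|M| * \1_(cube (0 : 'rV[R]_n) r') x.
have FG x k : `|F k x| <= G x.
  rewrite /G indicE; have [xr|xr] := boolP (x \in cube 0 r').
    rewrite mulr1 /F normrM ger0_norm// -ler_pdivlMl ?ltr0n//.
    by apply: le_trans (fM x k) _; rewrite mulrC ler_wpM2l// ler_norm.
  have out w : `|w| <= `|v| -> f (x + w) = 0.
    move=> wv; apply: f0 => h; move: xr; rewrite notin_setE; apply=> i.
    have := h i; rewrite !mxE /r'.
    have : `|w 0 i| <= `|w|.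
      by rewrite [leRHS]mx_normrE; exact: (le_bigmax _ (fun p => `|w p.1 p.2|) (0, i)).
    by move: wv; rewrite ler_norml; lra.
  rewrite mulr0 /F out ?sub0r; last first.
    rewrite normrZ normfV ger0_norm// ler_piMl//.
    by rewrite invf_le1 ?ltr0n// ler1n.
  by have := out 0; rewrite addr0 normr0 => -> //; rewrite oppr0 mulr0 normr0.
have mg : measurable_fun setT g.
  by apply: (measurable_fun_cvg mF) => x _; exact: fg.
have Gi : integr setT G.
  apply: integrZ => //; apply: (@integr_subset (cube 0 r')) => //.
    by move=> x _ h; rewrite indicE memNset.
  apply: (@integr_bounded _ _ 1) => //; first exact: bounded_set_cube.
  by move=> x _; rewrite indicE; case: (_ \in _); rewrite ?normr1 ?normr0.
have [] := @dominated_convergence _ _ _ leb setT measurableT (fun k => EFin \o F k) (EFin \o g) (EFin \o G).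
- by move=> k; exact/measurable_EFinP.
- exact/measurable_EFinP.
- apply: aeW => x _; apply: cvg_EFin; first exact: nearW.
  exact: fg.
- exact: Gi.
- by apply: aeW => x k _; rewrite /= lee_fin.
move=> gi _ cv; split=> //.
rewrite /Rintegral; move/cvg_lim : cv => /= <-//.
rewrite (_ : (fun _ => _) = fun=> 0%E); first by rewrite lim_cst.
apply/funext => k /=; rewrite -[LHS]fineK; first by congr EFin; exact: F0.
by apply: integrable_fin_num => //; exact: Fi.
Qed.

Definition halfspace (c nu : 'rV[R]_n) : set 'rV[R]_n := [set x | 0 <= dotv (x - c) nu].

Lemma continuous_dotv_sub (c nu : 'rV[R]_n) : continuous (fun x : 'rV[R]_n => dotv (x - c) nu).
Proof.
apply: smooth_continuous; apply: smooth_sum => i _; apply: smoothM; last exact: smooth_cst.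
under eq_fun do rewrite !mxE.
by apply: smoothD; [exact: smooth_coord|exact: smooth_cst].
Qed.

Lemma measurable_halfspace c nu : measurable (halfspace c nu).
Proof.
rewrite (_ : halfspace c nu = (fun x => dotv (x - c) nu) @^-1` `[0, +oo[); last first.
  by apply/seteqP; split => x; rewrite /halfspace/= in_itv/= andbT.
apply: measurable_preT; last exact: measurable_itv.
by apply: continuous_measurable_rV; exact: continuous_dotv_sub.
Qed.

Section cptsmooth.
Variable f : 'rV[R]_n -> R.
Hypothesis sf : smooth f.
Variable K : set 'rV[R]_n.
Hypotheses (cK : compact K) (fK : forall x, ~ K x -> f x = 0).

Lemma cpt_derive_out (v x : 'rV[R]_n) : ~ K x -> 'D_v f x = 0.
Proof.
move=> nKx; rewrite (@near_eq_derive _ _ _ f (cst 0) x v) ?derive_cst//.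
have oK : open (~` K) by apply: closed_openC; apply: compact_closed => //; exact: norm_hausdorff.
by apply: filterS (open_nbhs_nbhs (conj oK nKx)) => y nKy; exact: fK.
Qed.

Lemma cpt_bounded (g : 'rV[R]_n -> R) : continuous g -> (forall x, ~ K x -> g x = 0) ->
  exists2 M, 0 <= M & forall x, `|g x| <= M.
Proof.
move=> cg gK; have /compact_bounded[M [Mr hM]] : compact (g @` K).
  by apply: continuous_compact => //; exact: continuous_subspaceT.
exists (`|M| + 1) => [|x]; first by rewrite addr_ge0.
have [Kx|/gK->] := pselect (K x); last by rewrite normr0 addr_ge0.
by apply: hM; [rewrite ltr_pwDr// ler_norm|exists x].
Qed.

Lemma cpt_cube : exists2 r, 0 < r & K `<=` cube 0 r.
Proof. by apply: bounded_cube; exact: compact_bounded. Qed.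

Lemma cpt_integr (g : 'rV[R]_n -> R) : continuous g -> (forall x, ~ K x -> g x = 0) ->
  integr setT g.
Proof.
move=> cg gK; have [M M0 gM] := cpt_bounded cg gK; have [r r0 Kr] := cpt_cube.
apply: (@integr_subset (cube 0 r)) => //; first exact: measurable_box.
  by move=> x _ h; apply: gK => /Kr.
apply: (@integr_bounded _ _ M) => //; [exact: measurable_box|exact: bounded_set_cube|].
by apply: measurable_funTS; exact: continuous_measurable_rV.
Qed.

(** The mean value theorem along the line through [x]. Increments with [t >= 0] suffice, since all
    the quotients use positive steps. *)
Lemma cpt_lip (v : 'rV[R]_n) : exists2 M, 0 <= M &
  forall (x : 'rV[R]_n) (t : R), 0 <= t -> `|f (x + t *: v) - f x| <= M * t.
Proof.
have [M M0 dM] := cpt_bounded (smooth_continuous (smooth_derive v sf)) (@cpt_derive_out v).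
exists M => // x t; rewrite le_eqVlt => /predU1P[<-|t0].
  by rewrite scale0r addr0 subrr normr0 mulr0.
pose l (s : R) : 'rV[R]_n := x + s *: v.
have dl (s : R) : is_derive s (1 : R) l v.
  by apply: is_derive_lineZ => h; rewrite /l opprD addrACA subrr add0r -scalerBl addrK [_ *: 1]mulr1.
have dfl (s : R) : is_derive s (1 : R) (f \o l) ('D_v f (l s)).
  have dls : differentiable l s by apply/derivable1_diffP; have [] := dl s.
  have dfls : differentiable f (l s) by exact: smooth_diff.
  apply: DeriveDef.
    by apply/derivable1_diffP; exact: differentiable_comp.
  have dc : differentiable (f \o l) s by exact: differentiable_comp.
  rewrite deriveE// diff_comp//= -!deriveE//.
  by have [_ ->] := dl s.
have [|u _] := @MVT _ (f \o l) (fun s => 'D_v f (l s)) 0 t t0 (fun s _ => dfl s).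
  apply: continuous_subspaceT => s; apply: differentiable_continuous.
  by apply/derivable1_diffP; have [] := dfl s.
rewrite /l /= scale0r addr0 subr0 => ->; rewrite normrM (gtr0_norm t0).
by apply: ler_wpM2r; [exact: ltW|exact: dM].
Qed.

Lemma int_derive_setT (v : 'rV[R]_n) : \int[leb]_x 'D_v f x = 0.
Proof.
have [N N0 fN] := cpt_bounded (smooth_continuous sf) fK.
have [M M0 fM] := cpt_lip v; have [r r0 Kr] := cpt_cube.
have [] // := @int_diffquot f (fun x => 'D_v f x) v M N r r0.
- by apply: continuous_measurable_rV; exact: smooth_continuous.
- by move=> x h; apply: fK => /Kr.
- by move=> x k; apply: fM; rewrite invr_ge0.
- by move=> x; apply: cvg_succ_quotient; apply: diff_derivable; exact: smooth_diff.
Qed.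

(** A translation along a tangent direction maps the half-space to itself, so [f] cut off at the
    boundary is still Lipschitz in that direction. *)
Lemma int_derive_tangent (c nu v : 'rV[R]_n) : dotv v nu = 0 ->
  \int[leb]_(x in halfspace c nu) 'D_v f x = 0.
Proof.
move=> vnu; have [N N0 fN] := cpt_bounded (smooth_continuous sf) fK.
have [M M0 fM] := cpt_lip v; have [r r0 Kr] := cpt_cube.
rewrite Rintegral_mkcond.
have sE x t : dotv (x + t *: v - c) nu = dotv (x - c) nu.
  by rewrite addrAC dotvDl dotvZl vnu mulr0 addr0.
have Hv x t : (x + t *: v \in halfspace c nu) = (x \in halfspace c nu).
  by apply/idP/idP; rewrite !inE /halfspace/= sE.
have [] // := @int_diffquot (fun x => if x \in halfspace c nu then f x else 0)
  (fun x => if x \in halfspace c nu then 'D_v f x else 0) v M N r r0.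
- apply/(measurable_restrictT _ _).1; first exact: measurable_halfspace.
  by apply: measurable_funTS; apply: continuous_measurable_rV; exact: smooth_continuous.
- by move=> x; case: ifPn => //; rewrite normr0.
- by move=> x h; case: ifPn => // _; apply: fK => /Kr.
- move=> x k; rewrite Hv; case: ifPn => [_|_]; last by rewrite subrr normr0 mulr_ge0// invr_ge0.
  by apply: fM; rewrite invr_ge0.
- move=> x; have [xH|xH] := boolP (x \in halfspace c nu).
    under eq_fun do rewrite Hv xH.
    by apply: (@cvg_succ_quotient f x v); apply: diff_derivable; exact: smooth_diff.
  under eq_fun do rewrite Hv (negbTE xH) subrr mulr0.
  exact: cvg_cst.
Qed.

(* Extended by zero, a function vanishing on the boundary hyperplane is still
   Lipschitz, so that no boundary term appears. *)
Lemma int_derive_normal (c nu : 'rV[R]_n) : dotv nu nu = 1 ->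
  (forall x, dotv (x - c) nu = 0 -> f x = 0) ->
  \int[leb]_(x in halfspace c nu) 'D_nu f x = 0.
Proof.
move=> nu1 f0; have [N N0 fN] := cpt_bounded (smooth_continuous sf) fK.
have [M M0 fM] := cpt_lip nu; have [r r0 Kr] := cpt_cube.
rewrite Rintegral_mkcond.
have sE x t : dotv (x + t *: nu - c) nu = dotv (x - c) nu + t.
  by rewrite addrAC dotvDl dotvZl nu1 mulr1.
have inH x : (x \in halfspace c nu) = (0 <= dotv (x - c) nu) by apply/idP/idP; rewrite !inE.
have [] // := @int_diffquot (fun x => if x \in halfspace c nu then f x else 0)
  (fun x => if x \in halfspace c nu then 'D_nu f x else 0) nu M N r r0.
- apply/(measurable_restrictT _ _).1; first exact: measurable_halfspace.
  by apply: measurable_funTS; apply: continuous_measurable_rV; exact: smooth_continuous.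
- by move=> x; case: ifPn => //; rewrite normr0.
- by move=> x h; case: ifPn => // _; apply: fK => /Kr.
- move=> x k; have k0 : 0 <= k.+1%:R^-1 :> R by rewrite invr_ge0.
  move: (k.+1%:R^-1) k0 => t k0.
  rewrite !inH sE; case: ifPn => [h1|h1]; case: ifPn => h2.
  + exact: fM.
  (* Here the segment enters the half-space, crossing the hyperplane at [x + (t - s) *: nu], where
     [f] vanishes; what remains is an increment of length [s <= t]. *)
  + set s := dotv (x - c) nu + t in h1.
    have y0 : f (x + (t - s) *: nu) = 0 by apply: f0; rewrite sE /s; lra.
    have := fM (x + (t - s) *: nu) s h1.
    rewrite y0 -addrA -scalerDl subrK subr0 => /le_trans; apply.
    by rewrite ler_wpM2l// /s; move: h2; rewrite -ltNge; lra.
  + by exfalso; move: h1; rewrite -ltNge; lra.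
  + by rewrite subrr normr0 mulr_ge0.
- move=> x; rewrite inH; have [h|h] := leP 0 (dotv (x - c) nu).
    under eq_fun do rewrite inH sE addr_ge0 ?invr_ge0//.
    by apply: (@cvg_succ_quotient f x nu); apply: diff_derivable; exact: smooth_diff.
  apply: cvg_near_cst.
  have := @cvg_harmonic R; move/cvgrPdist_lt => /(_ (- dotv (x - c) nu)).
  rewrite oppr_gt0 => /(_ h); apply: filterS => k; rewrite /harmonic /= sub0r normrN.
  rewrite ger0_norm ?invr_ge0// => hk.
  by rewrite inH sE ifN ?subrr ?mulr0// -ltNge -ltrBrDl sub0r.
Qed.

End cptsmooth.
End integr.

(** * Square-integrable functions *)

Lemma sqrD_le (R : realDomainType) (x y : R) : (x + y) ^+ 2 <= 2 * x ^+ 2 + 2 * y ^+ 2.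
Proof. by have := sqr_ge0 (x - y); rewrite sqrrB sqrrD; lra. Qed.

(** The constant is far from optimal, but the sums to which this is applied have a number of terms
    fixed by the dimension and the degree. *)
Lemma sqr_sum_le (R : realDomainType) (J : Type) (s : seq J) (P : pred J) (F : J -> R) :
  (\sum_(i <- s | P i) F i) ^+ 2 <= 2 ^+ size s * \sum_(i <- s | P i) F i ^+ 2.
Proof.
elim: s => [|i s IH]; first by rewrite !big_nil expr0n mulr0.
have s0 : 0 <= \sum_(i <- s | P i) F i ^+ 2 by apply: sumr_ge0 => j _; exact: sqr_ge0.
have p1 : 1 <= 2 ^+ size s :> R by rewrite exprn_ege1// ler1n.
rewrite !big_cons [size _]/=; case: ifP => _.
  apply: le_trans (sqrD_le _ _) _; rewrite mulrDr lerD//.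
    by rewrite (exprS 2) ler_wpM2r ?sqr_ge0// ler_peMr.
  by rewrite (exprS 2) -mulrA ler_wpM2l.
apply: le_trans IH _; rewrite (exprS 2) ler_wpM2r//.
by rewrite ler_peMl ?(le_trans ler01)// ler1n.
Qed.

Section L2.
Context {R : realType} {n : nat}.
Local Notation leb := (lebesgue_rV R n).
Implicit Types (S A B : set 'rV[R]_n) (f g h : 'rV[R]_n -> R).

Lemma L2_measurable S f : L2 S f -> measurable_fun S f. Proof. by case. Qed.

Lemma L2_integrM S f g : measurable S -> L2 S f -> L2 S g ->
  integr S (fun x => f x * g x).
Proof.
move=> mS [mf f2] [mg g2].
apply: (@le_integr _ _ _ _ (fun x => f x ^+ 2 + g x ^+ 2)) => //.
- exact: measurable_funM.
- move=> x _; rewrite normrM -(real_normK (num_real (f x))) -(real_normK (num_real (g x))).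
  have := sqr_ge0 (`|f x| - `|g x|); rewrite sqrrB.
  have := sqr_ge0 `|f x|; have := sqr_ge0 `|g x|; lra.
- exact: integrD.
Qed.

Lemma L2_intro S f : measurable_fun S f -> integr S (fun x => f x ^+ 2) -> L2 S f.
Proof. by []. Qed.

Lemma L2_sqr S f : L2 S f -> integr S (fun x => f x ^+ 2). Proof. by case. Qed.

Lemma L2D S f g : measurable S -> L2 S f -> L2 S g -> L2 S (fun x => f x + g x).
Proof.
move=> mS lf lg; have [mf f2] := lf; have [mg g2] := lg.
apply: L2_intro; first exact: measurable_funD.
rewrite (_ : (fun _ => _) = fun x => f x ^+ 2 + (2 * (f x * g x) + g x ^+ 2)).
  by apply: integrD => //; apply: integrD => //; apply: integrZ => //; exact: L2_integrM.
by apply/funext => x; ring.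
Qed.

Lemma L2Z S c f : measurable S -> L2 S f -> L2 S (fun x => c * f x).
Proof.
move=> mS [mf f2]; apply: L2_intro; first exact: measurable_funM.
under eq_fun do rewrite exprMn.
exact: integrZ.
Qed.

Lemma L2N S f : measurable S -> L2 S f -> L2 S (fun x => - f x).
Proof. by move=> mS lf; under eq_fun do rewrite -mulN1r; exact: L2Z. Qed.

Lemma L2B S f g : measurable S -> L2 S f -> L2 S g -> L2 S (fun x => f x - g x).
Proof. by move=> mS lf lg; apply: L2D => //; exact: L2N. Qed.

Lemma L2_0 S : measurable S -> L2 S (fun=> 0).
Proof.
move=> mS; apply: L2_intro => //; under eq_fun do rewrite expr0n.
exact: integr0.
Qed.

Lemma L2_sum S (J : Type) (s : seq J) (P : pred J) (F : J -> 'rV[R]_n -> R) :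
  measurable S -> (forall i, P i -> L2 S (F i)) -> L2 S (fun x => \sum_(i <- s | P i) F i x).
Proof.
move=> mS LF; elim: s => [|i s IH].
  by under eq_fun do rewrite big_nil; exact: L2_0.
have [Pi|Pi] := boolP (P i); last by under eq_fun do rewrite big_cons (negbTE Pi).
under eq_fun do rewrite big_cons Pi.
by apply: L2D => //; exact: LF.
Qed.

Lemma L2S A B f : measurable B -> measurable A -> A `<=` B -> L2 B f -> L2 A f.
Proof.
move=> mB mA AB [mf f2]; apply: L2_intro; first exact: measurable_funS mf.
exact: integrS f2.
Qed.

Lemma L2_bounded S f M : measurable S -> bounded_set S -> measurable_fun S f ->
  (forall x, S x -> `|f x| <= M) -> L2 S f.
Proof.
move=> mS bS mf fM; apply: L2_intro => //.
apply: (@integr_bounded _ _ _ _ (M ^+ 2)) => //; first exact: measurable_funX.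
move=> x Sx; rewrite normrX ler_pXn2r ?nnegrE// ?fM//.
by apply: le_trans (fM _ Sx).
Qed.

Lemma sqnormL2_ge0 S f : 0 <= sqnormL2 S f.
Proof. by apply: Rintegral_ge0 => x _; exact: sqr_ge0. Qed.

Lemma sqnormL2S A B f : measurable B -> measurable A -> A `<=` B -> L2 B f ->
  sqnormL2 A f <= sqnormL2 B f.
Proof.
move=> mB mA AB [mf f2]; rewrite /sqnormL2 /Rintegral fine_le//.
- by apply: integrable_fin_num => //; exact: integrS f2.
- exact: integrable_fin_num.
- apply: ge0_subset_integral => //; last by move=> x _; rewrite lee_fin sqr_ge0.
  by apply/measurable_EFinP; exact: measurable_funX.
Qed.

Lemma sqnormL2D S f g : measurable S -> L2 S f -> L2 S g ->
  sqnormL2 S (fun x => f x + g x) <= 2 * sqnormL2 S f + 2 * sqnormL2 S g.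
Proof.
move=> mS lf lg; rewrite /sqnormL2 -!RintegralZl//; try exact: L2_sqr.
have f2 := integrZ 2 mS (L2_sqr lf); have g2 := integrZ 2 mS (L2_sqr lg).
rewrite -RintegralD//; apply: le_Rintegral => //.
- by apply: L2_sqr; exact: L2D.
- exact: integrD.
- by move=> x _; exact: sqrD_le.
Qed.

Lemma sqnormL2Z S c f : measurable S -> L2 S f ->
  sqnormL2 S (fun x => c * f x) = c ^+ 2 * sqnormL2 S f.
Proof.
move=> mS lf; rewrite /sqnormL2; under eq_Rintegral do rewrite exprMn.
by rewrite RintegralZl//; exact: L2_sqr.
Qed.

Lemma sqnormL2N S f : sqnormL2 S (fun x => - f x) = sqnormL2 S f.
Proof. by rewrite /sqnormL2; under eq_Rintegral do rewrite sqrrN. Qed.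

Lemma L2_CS S f g : measurable S -> L2 S f -> L2 S g ->
  (\int[leb]_(x in S) (f x * g x)) ^+ 2 <= sqnormL2 S f * sqnormL2 S g.
Proof.
move=> mS lf lg.
set a := sqnormL2 S f; set b := \int[leb]_(x in S) _; set c := sqnormL2 S g.
have f2 := L2_sqr lf; have g2 := L2_sqr lg; have fg := L2_integrM mS lf lg.
have h (t : R) : 0 <= a * t ^+ 2 - 2 * b * t + c.
  have := sqnormL2_ge0 S (fun x => t * f x - g x).
  rewrite /sqnormL2 (_ : (fun _ => _) =
    fun x => t ^+ 2 * f x ^+ 2 + ((- (2 * t)) * (f x * g x) + g x ^+ 2)); last first.
    by apply/funext => x; ring.
  rewrite RintegralD//; [|exact: integrZ|by apply: integrD => //; exact: integrZ].
  rewrite RintegralD//; last exact: integrZ.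
  by rewrite !RintegralZl// -/(sqnormL2 S f) -/(sqnormL2 S g) -/a -/b -/c; lra.
have [a0|a0] := eqVneq a 0.
  have [->|b0] := eqVneq b 0; first by rewrite expr0n a0 mul0r.
  have := h ((c + 1) / (2 * b)); rewrite a0 mul0r sub0r.
  rewrite (_ : 2 * _ * _ = c + 1); last by field.
  by lra.
have agt0 : 0 < a by rewrite lt_def a0 sqnormL2_ge0.
have := h (b / a).
rewrite (_ : _ + _ = (a * c - b ^+ 2) / a); last by field.
by rewrite pmulr_lge0 ?invr_gt0// subr_ge0.
Qed.

Lemma sqnormL2_bounded S g M V : measurable S -> bounded_set S -> measurable_fun S g ->
  (forall x, S x -> `|g x| <= M) -> (leb S <= V%:E)%E -> sqnormL2 S g <= M ^+ 2 * V.
Proof.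
move=> mS bS mg gM SV; rewrite /sqnormL2.
apply: (@le_trans _ _ (\int[leb]_(x in S) M ^+ 2)).
  apply: le_Rintegral => //.
  - by apply: L2_sqr; exact: (@L2_bounded _ _ M).
  - by apply: (@integr_bounded _ _ _ _ `|M ^+ 2|).
  - move=> x Sx; rewrite -(real_normK (num_real (g x))) ler_pXn2r ?nnegrE ?gM//.
    by apply: le_trans (gM _ Sx).
rewrite Rintegral_cst// ler_wpM2l ?sqr_ge0// -lee_fin fineK//.
by rewrite ge0_fin_numE// lebesgue_bounded.
Qed.

Lemma L2_CS_bounded S f g M V : measurable S -> bounded_set S -> L2 S f -> measurable_fun S g ->
  (forall x, S x -> `|g x| <= M) -> (leb S <= V%:E)%E ->
  (\int[leb]_(x in S) (f x * g x)) ^+ 2 <= M ^+ 2 * V * sqnormL2 S f.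
Proof.
move=> mS bS lf mg gM SV.
apply: le_trans (L2_CS mS lf (L2_bounded mS bS mg gM)) _.
by rewrite mulrC ler_wpM2r ?sqnormL2_ge0//; exact: sqnormL2_bounded.
Qed.

Lemma sqnormL2_disjoint (J : finType) (P : pred J) (F : J -> set 'rV[R]_n) S f :
  measurable S -> (forall j, P j -> measurable (F j)) -> (forall j, P j -> F j `<=` S) ->
  (forall i j, P i -> P j -> i != j -> F i `&` F j = set0) -> L2 S f ->
  \sum_(j | P j) sqnormL2 (F j) f <= sqnormL2 S f.
Proof.
move=> mS mF FS tF lf.
suff : forall s, uniq s -> measurable S -> (forall j, j \in s -> P j) ->
    \sum_(j <- s) sqnormL2 (F j) f <= sqnormL2 (\big[setU/set0]_(j <- s) F j) f.
  move=> h; have := h (enum P) (enum_uniq _) mS.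
  rewrite big_enum/= => /(_ _)/le_trans; apply; first by move=> j; rewrite mem_enum.
  apply: sqnormL2S => //.
    by rewrite big_enum/=; apply: bigsetU_measurable => j; exact: mF.
  rewrite big_enum/=; elim/big_ind : _ => // A B AS BS; rewrite subUset; split=> //.
elim=> [|i s IH]; first by rewrite !big_nil sqnormL2_ge0.
move=> /= /andP[iNs us] _ sP; rewrite !big_cons.
have Pi : P i by apply: sP; rewrite mem_head.
have sP' j : j \in s -> P j by move=> js; apply: sP; rewrite in_cons js orbT.
set U := \big[setU/set0]_(j <- s) F j.
have mU : measurable U.
  by rewrite /U big_seq; apply: bigsetU_measurable => j /sP'; exact: mF.
have US : U `<=` S.
  by rewrite /U big_seq; elim/big_ind : _ => // [A B AS BS|j /sP' /FS//]; rewrite subUset; split.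
rewrite /sqnormL2 Rintegral_setU//.
- by rewrite lerD2l; exact: IH.
- exact: mF.
- apply: (@integrS _ _ _ S) => //; first by apply: measurableU => //; exact: mF.
    by rewrite subUset; split => //; exact: FS.
  exact: L2_sqr.
- apply/disj_setPS => x [Fx]; rewrite /U big_seq => Ux.
  have : exists2 j, j \in s & F j x.
    elim: (s) (Ux) => [|j t IHt]; first by rewrite -big_seq big_nil.
    rewrite -big_seq big_cons => -[Fjx|]; first by exists j; rewrite ?mem_head.
    by rewrite big_seq => /IHt[k kt Fk]; exists k => //; rewrite in_cons kt orbT.
  move=> [j js Fjx]; have := tF i j Pi (sP' _ js).
  rewrite (_ : i != j); last by apply: contraNneq iNs => ->.
  by move=> /(_ isT) E; rewrite -E.
Qed.

(** Vanishing almost everywhere, stated through the norm: identities up to null sets are then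
    combined by the rules for [L2] alone. *)
Definition nullL2 S f : Prop := L2 S f /\ sqnormL2 S f = 0.

Lemma nullL2D S f g : measurable S -> nullL2 S f -> nullL2 S g ->
  nullL2 S (fun x => f x + g x).
Proof.
move=> mS [lf f0] [lg g0]; split; first exact: L2D.
apply/eqP; rewrite eq_le sqnormL2_ge0 andbT.
by apply: le_trans (sqnormL2D mS lf lg) _; rewrite f0 g0 !mulr0 addr0.
Qed.

Lemma nullL2Z S c f : measurable S -> nullL2 S f -> nullL2 S (fun x => c * f x).
Proof.
by move=> mS [lf f0]; split; [exact: L2Z|rewrite sqnormL2Z// f0 mulr0].
Qed.

Lemma nullL2N S f : measurable S -> nullL2 S f -> nullL2 S (fun x => - f x).
Proof. by move=> mS nf; under eq_fun do rewrite -mulN1r; exact: nullL2Z. Qed.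

Lemma nullL2_0 S : measurable S -> nullL2 S (fun=> 0).
Proof.
move=> mS; split; first exact: L2_0.
by rewrite /sqnormL2 Rintegral_cst// expr0n mul0r.
Qed.

Lemma nullL2_sum S (J : Type) (s : seq J) (P : pred J) (F : J -> 'rV[R]_n -> R) :
  measurable S -> (forall i, P i -> nullL2 S (F i)) ->
  nullL2 S (fun x => \sum_(i <- s | P i) F i x).
Proof.
move=> mS LF; elim: s => [|i s IH].
  by under eq_fun do rewrite big_nil; exact: nullL2_0.
have [Pi|Pi] := boolP (P i); last by under eq_fun do rewrite big_cons (negbTE Pi).
under eq_fun do rewrite big_cons Pi.
by apply: nullL2D => //; exact: LF.
Qed.

Lemma nullL2S A B f : measurable B -> measurable A -> A `<=` B -> nullL2 B f -> nullL2 A f.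
Proof.
move=> mB mA AB [lf f0]; split; first exact: L2S lf.
by apply/eqP; rewrite eq_le sqnormL2_ge0 andbT -f0 sqnormL2S.
Qed.

Lemma nullL2_int S f g : measurable S -> nullL2 S f -> L2 S g ->
  \int[leb]_(x in S) (f x * g x) = 0.
Proof.
move=> mS [lf f0] lg; apply/eqP; rewrite -sqrf_eq0 eq_le sqr_ge0 andbT.
by apply: le_trans (L2_CS mS lf lg) _; rewrite f0 mul0r.
Qed.

Lemma sqnormL2_vecE m S (F : 'rV[R]_n -> 'rV[R]_m) : measurable S -> L2_vec S F ->
  sqnormL2_vec S F = \sum_j sqnormL2 S (fun x => F x 0 j).
Proof.
move=> mS lF; rewrite /sqnormL2_vec /dotv.
rewrite (@Rintegral_sum _ _ S _ _ _ (fun j x => F x 0 j * F x 0 j))//; last by move=> j _; exact: L2_integrM.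
Qed.

End L2.

(** * Weak derivatives *)

Section boxes.
Context {R : realType} {n : nat}.
Local Notation leb := (lebesgue_rV R n).
Implicit Types (a b x : 'rV[R]_n) (U S : set 'rV[R]_n).

Definition closed_box a b : set 'rV[R]_n := [set x | forall i, x 0 i \in `[a 0 i, b 0 i]%R].

Lemma compact_closed_box a b : compact (closed_box a b).
Proof.
exact: (@rV_compact R n (fun i => [set` `[a 0 i, b 0 i]]) (fun i => @segment_compact R (a 0 i) (b 0 i))).
Qed.

Lemma box_closed_box a b : box a b `<=` closed_box a b.
Proof. by move=> x h i; have /andP[? ?] := h i; rewrite in_itv/= !ltW. Qed.

Definition boxes : set (set 'rV[R]_n) := [set A | exists a b, A = box a b].

Lemma box_setI a b a' b' : box a b `&` box a' b' =
  box (\row_i Num.max (a 0 i) (a' 0 i)) (\row_i Num.min (b 0 i) (b' 0 i)).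
Proof.
apply/seteqP; split => x /=.
  move=> [h h'] i; rewrite !mxE gt_max lt_min.
  by have /andP[-> ->] := h i; have /andP[-> ->] := h' i.
by move=> h; split => i; have := h i; rewrite !mxE gt_max lt_min => /andP[/andP[? ?] /andP[? ?]]; apply/andP.
Qed.

Lemma setI_closed_boxes : setI_closed boxes.
Proof. by move=> _ _ [a [b ->]] [a' [b' ->]]; rewrite box_setI; eexists; eexists. Qed.

Lemma measurable_boxes : (@measurable _ 'rV[R]_n) = <<s boxes >>.
Proof.
apply/seteqP; split; last first.
  apply: smallest_sub; first exact: sigma_algebra_measurable.
  by move=> _ [a [b ->]]; exact: measurable_box.
apply: smallest_sub; first exact: smallest_sigma_algebra.
move=> A; rewrite -bigcup_seq/= => -[i _ [Y mY <-]]; rewrite setTI.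
pose c : g_sigma_algebraType boxes -> measurableTypeR R := @coord_rV R n i.
suff mc : measurable_fun setT c.
  by have := mc measurableT Y mY; rewrite setTI.
apply: (measurability _ (RGenOpens.measurableE R)).
move=> _ [_ [x [y ->] <-]]; rewrite setTI.
rewrite (_ : c @^-1` _ = \bigcup_(N : nat)
    box (\row_j (if j == i then x else - N%:R)) (\row_j (if j == i then y else N%:R)) :> set 'rV[R]_n).
  by apply: bigcupT_measurable => N; apply: sub_sigma_algebra; eexists; eexists.
apply/seteqP; split => z; rewrite /c /coord_rV/= ?in_itv/=.
  move=> zi; have [N hN] : exists N : nat, forall j, `|z 0 j| < N%:R.
    exists (Num.truncn `|z|).+1 => j; apply: le_lt_trans (truncnS_gt _).
    by rewrite [leRHS]mx_normrE; exact: (le_bigmax _ (fun p => `|z p.1 p.2|) (0, j)).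
  exists N => // j; rewrite !mxE; case: eqP => [->//|_].
  by have := hN j; rewrite ltr_norml.
by move=> [N _ /(_ i)]; rewrite !mxE eqxx.
Qed.

(** Boxes are stable under intersection and generate the measurable sets, so Dynkin's theorem
    applies. Stability under complements needs the integral over the whole space to vanish, which is
    obtained beforehand from an exhaustion by cubes. *)
Lemma null_of_boxes (h : 'rV[R]_n -> R) : integr setT h ->
  (forall A, boxes A -> \int[leb]_(x in A) h x = 0) ->
  forall A, measurable A -> \int[leb]_(x in A) h x = 0.
Proof.
move=> hi hbox; have hT : \int[leb]_x h x = 0.
  pose F k := cube (0 : 'rV[R]_n) k.+1%:R.
  have [] := @dominated_convergence _ _ _ leb setT measurableT
    (fun k => EFin \o (h \_ (F k))) (EFin \o h) (fun x => `|(h x)%:E|%E).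
  - move=> k; apply/measurable_EFinP; apply/(measurable_restrictT _ _).1; first exact: measurable_box.
    by apply: measurable_funTS; exact: integr_measurable.
  - by apply/measurable_EFinP; exact: integr_measurable.
  - apply: aeW => x _; apply: cvg_near_cst.
    exists (Num.truncn `|x|) => // k /= Nk; rewrite patchE mem_set// => j.
    rewrite !mxE sub0r add0r -ltr_norml; apply: (@le_lt_trans _ _ `|x|).
      by rewrite [leRHS]mx_normrE; exact: (le_bigmax _ (fun p => `|x p.1 p.2|) (0, j)).
    by apply: lt_le_trans (truncnS_gt _) _; rewrite ler_nat ltnS.
  - exact: integrable_abse.
  - by apply: aeW => x k _; rewrite /= lee_fin patchE; case: ifPn => // _; rewrite normr0.
  move=> _ _ cv; rewrite /Rintegral; move/cvg_lim : cv => /= <-//.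
  rewrite (_ : (fun _ => _) = fun=> 0%E); first by rewrite lim_cst.
  apply/funext => k /=; have hF := (integr_restrict h (measurable_box _ _)).1 (integrS measurableT (measurable_box _ _) (@subsetT _ (F k)) hi).
  rewrite -[LHS]fineK; last exact: (integrable_fin_num measurableT hF).
  by congr EFin; rewrite -[LHS]/(\int[leb]_x (h \_ (F k)) x) -Rintegral_mkcond hbox//; eexists; eexists.
have key := dynkin_induction (P := fun A => \int[leb]_(x in A) h x = 0) measurable_boxes setI_closed_boxes hT hbox.
move=> A; rewrite measurable_boxes => sA; apply: key sA => [B mB B0|F mF tF F0].
  have := @Rintegral_setU _ _ _ leb B (~` B) h mB (measurableC mB).
  rewrite setUCr hT B0 add0r => <-//.
  by apply/disj_setPS => x [].
rewrite /Rintegral integral_bigcup//; last by apply: integrS hi => //; exact: bigcupT_measurable.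
rewrite eseries0// => k _ _; have := F0 k; rewrite /Rintegral => E.
rewrite -[LHS]fineK ?E//; apply: integrable_fin_num => //.
by apply: integrS hi.
Qed.

(** For every [k] the support stays in the closed box; as [k] grows the values, in [[0, 1]], tend to
    the indicator of the open box. *)
Definition box_bump a b k x : R :=
  \prod_i (flat 0 (k.+1%:R * (x 0 i - a 0 i)) * flat 0 (k.+1%:R * (b 0 i - x 0 i))).

Lemma test_function_box_bump a b k U : closed_box a b `<=` U -> test_function U (box_bump a b k).
Proof.
move=> abU; split.
  apply: smooth_prod => i _; apply: smoothM; apply: smooth_flat; apply: smoothZ;
    by apply: smoothB; try exact: smooth_coord; exact: smooth_cst.
exists (closed_box a b); split => //; first exact: compact_closed_box.
move=> x /existsNP[i]; rewrite in_itv/= => /negP; rewrite negb_and -!ltNge => /orP xi.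
rewrite /box_bump (bigD1 i)//=; apply/eqP; rewrite !mulf_eq0; apply/orP; left; apply/orP.
by case: xi => xi; [left|right]; rewrite flat_le0// mulr_ge0_le0//; lra.
Qed.

Lemma box_bump_ge0 a b k x : 0 <= box_bump a b k x.
Proof. by apply: prodr_ge0 => i _; rewrite mulr_ge0// flat_ge0. Qed.

Lemma box_bump_le1 a b k x : box_bump a b k x <= 1.
Proof.
have f1 t : flat 0 t <= 1 :> R by have := flat_le 0 t; rewrite fact0.
by apply: prodr_ile1 => i _; rewrite mulr_ge0 ?flat_ge0//= mulr_ile1 ?flat_ge0.
Qed.

Lemma box_bump_cvg a b x : box_bump a b k x @[k --> \oo] --> (\1_(box a b) x : R).
Proof.
rewrite (_ : \1_(box a b) x = \prod_i ((if 0 < x 0 i - a 0 i then 1 else 0) *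
    (if 0 < b 0 i - x 0 i then 1 else 0)) :> R).
  apply: cvg_big => [|i _]; first exact: mul_continuous.
  by apply: cvgM; exact: flat_scale_cvg.
rewrite indicE; have [xab|xab] := boolP (x \in box a b).
  rewrite big1// => i _; rewrite inE in xab; have /andP[h1 h2] := xab i.
  by rewrite !subr_gt0 h1 h2 mulr1.
move: xab; rewrite notin_setE => /existsNP[i /negP]; rewrite negb_and => h.
rewrite (bigD1 i)//= !subr_gt0; case/orP : h => /negbTE ->; by rewrite ?mul0r ?mulr0 ?mul0r.
Qed.

End boxes.

(** * The fundamental lemma of the calculus of variations *)

Section fundamental_lemma.
Context {R : realType} {n : nat}.
Local Notation leb := (lebesgue_rV R n).
Variables (U : set 'rV[R]_n) (h : 'rV[R]_n -> R).
Hypotheses (oU : open U) (bU : bounded_set U) (lh : L2 U h).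
Hypothesis h0 : forall phi, test_function U phi -> \int[leb]_(x in U) (h x * phi x) = 0.

Let mU : measurable U. Proof. exact: open_measurable_rV. Qed.

Let hi : integr U h.
Proof.
rewrite (_ : h = fun x => h x * 1); last by apply/funext => x; rewrite mulr1.
apply: L2_integrM => //; apply: (@L2_bounded _ _ _ _ 1) => //.
by move=> x _; rewrite normr1.
Qed.

Let int_box a b : closed_box a b `<=` U -> \int[leb]_(x in box a b) h x = 0.
Proof.
move=> abU; have bU' : box a b `<=` U by apply: subset_trans abU; exact: box_closed_box.
have mb := measurable_box a b.
have E : \int[leb]_(x in box a b) h x = \int[leb]_(x in U) (h x * \1_(box a b) x).
  rewrite [RHS](@Rintegral_subset _ _ (box a b))//; last first.
    by move=> x _ xb; rewrite indicE memNset// mulr0.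
  by apply: eq_Rintegral => x xb; rewrite indicE xb mulr1.
rewrite E.
have mhk k : measurable_fun U (fun x => h x * box_bump a b k x).
  apply: measurable_funM; first exact: L2_measurable.
  apply: measurable_funTS; apply: continuous_measurable_rV; apply: smooth_continuous.
  by have [] := test_function_box_bump k abU.
have [] := @dominated_convergence _ _ _ leb U mU
    (fun k x => (h x * box_bump a b k x)%:E) (fun x => (h x * \1_(box a b) x)%:E) (fun x => `|(h x)%:E|%E).
- by move=> k; apply/measurable_EFinP.
- apply/measurable_EFinP; apply: measurable_funM; first exact: L2_measurable.
  exact: measurable_indic.
- apply: aeW => x _; apply: cvg_EFin; first exact: nearW.
  by apply: cvgM; [exact: cvg_cst|exact: box_bump_cvg].
- exact: integrable_abse.
- apply: aeW => x k _; rewrite /= lee_fin normrM ler_piMr//.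
  by rewrite ger0_norm ?box_bump_ge0// box_bump_le1.
move=> _ _ cv; rewrite /Rintegral; move/cvg_lim : cv => /= <-//.
rewrite (_ : (fun _ => _) = fun=> 0%E); first by rewrite lim_cst.
apply/funext => k /=; rewrite -[LHS]fineK.
  by congr EFin; apply: h0; exact: test_function_box_bump.
apply: integrable_fin_num => //; apply: (le_integr mU (mhk k)) (integrable_abse hi).
by move=> x _; rewrite /= normrM ler_piMr// ger0_norm ?box_bump_ge0// box_bump_le1.
Qed.

(** The integral of [h] vanishes over all smaller boxes, hence over all measurable subsets, hence
    [h] is zero almost everywhere. It is the closed box that must lie in [U], as it supports the
    bumps. *)
Let null_box a b : closed_box a b `<=` U -> ae_eq leb (box a b) (EFin \o h) (cst 0%E).
Proof.
move=> abU; have bU' : box a b `<=` U by apply: subset_trans abU; exact: box_closed_box.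
have mb := measurable_box a b.
have hib : integr (box a b) h by apply: integrS hi.
apply: integral_ae_eq => // A Aab mA; rewrite integral0.
have hr := (integr_restrict h mb).1 hib.
have := null_of_boxes hr _ mA.
rewrite (_ : \int[leb]_(x in A) _ = \int[leb]_(x in A) h x); last first.
  apply: eq_Rintegral => x /set_mem xA; rewrite patchE mem_set//; exact: Aab.
move=> H; rewrite -[LHS]fineK; last by apply: integrable_fin_num => //; apply: integrS hib.
congr EFin; apply: H => _ [a' [b' ->]].
rewrite -Rintegral_mkcondr box_setI; apply: int_box => x hx; apply: abU => i.
by have := hx i; rewrite !in_itv/= !mxE ge_max le_min => /andP[/andP[_ ->] /andP[_ ->]].
Qed.

Lemma fundamental_lemma : nullL2 U h.
Proof.
split=> //; have H : ae_eq leb U (fun x => (h x ^+ 2)%:E) (cst 0%E).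
  pose rb (p : 'rV[rat]_n * 'rV[rat]_n) : set 'rV[R]_n :=
    if `[< closed_box (map_mx ratr p.1) (map_mx ratr p.2) `<=` U >]
    then box (map_mx ratr p.1) (map_mx ratr p.2) else set0.
  (* Through [unpickle] the countable family of rational boxes becomes a sequence, the form in which
     [ae_foralln] joins countably many null sets. *)
  pose F (k : nat) := if unpickle k is Some p then rb p else set0.
  have HF : \forall x \ae leb, forall k, F k x -> (h x)%:E = 0%E.
    apply: ae_foralln => k; rewrite /F; case: unpickle => [p|]; last exact: aeW.
    by rewrite /rb; case: ifPn => [/asboolP/null_box//|_]; exact: aeW.
  apply: filterS HF => x hF Ux.
  have [p xp] : exists p, rb p x.
    move: oU; rewrite openE => /(_ _ Ux)/nbhs_box[e e0 eU].
    have /choice[q1 hq1] : forall i, exists q : rat, ratr q \in `]x 0 i - e, x 0 i[.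
      by move=> i; apply: rat_in_itvoo; lra.
    have /choice[q2 hq2] : forall i, exists q : rat, ratr q \in `]x 0 i, x 0 i + e[.
      by move=> i; apply: rat_in_itvoo; lra.
    exists (\row_i q1 i, \row_i q2 i); rewrite /rb; case: ifPn => [_ i/=|/asboolPn].
      by rewrite !mxE; move: (hq1 i) (hq2 i); rewrite !in_itv/=; lra.
    case=> y hy; apply: eU => i; have := hy i.
    by rewrite /= !mxE; move: (hq1 i) (hq2 i); rewrite !in_itv/=; lra.
  have := hF (pickle p); rewrite /F pickleK => /(_ xp)[->].
  by rewrite expr0n.
rewrite /sqnormL2 /Rintegral (ae_eq_integral (cst 0%E))//.
- by rewrite integral0.
- apply/measurable_EFinP; apply: measurable_funX; exact: L2_measurable.
Qed.

End fundamental_lemma.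

(** * Test functions; uniqueness and locality of weak derivatives *)

Section weak.
Context {R : realType} {n : nat}.
Local Notation leb := (lebesgue_rV R n).
Implicit Types (U S Omega : set 'rV[R]_n) (f g phi : 'rV[R]_n -> R).

Lemma test_functionS U Omega phi : U `<=` Omega -> test_function U phi -> test_function Omega phi.
Proof. by move=> UO [sp [K [cK KU Kp]]]; split=> //; exists K; split=> //; exact: subset_trans UO. Qed.

Lemma test_function_partial U phi i : test_function U phi -> test_function U (partial i phi).
Proof.
move=> [sp [K [cK KU Kp]]]; split; first exact: smooth_partial.
by exists K; split=> // x nKx; exact: (cpt_derive_out cK Kp).
Qed.

Lemma test_functionM U phi g : smooth g -> test_function U phi ->
  test_function U (fun x => g x * phi x).
Proof.
move=> sg [sp [K [cK KU Kp]]]; split; first exact: smoothM.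
by exists K; split=> // x nKx; rewrite Kp// mulr0.
Qed.

Lemma test_function0 U : test_function U (fun=> 0).
Proof. by split; [exact: smooth_cst|exists set0; split=> //; exact: compact0]. Qed.

Lemma test_function_out U phi x : test_function U phi -> ~ U x -> phi x = 0.
Proof. by move=> [_ [K [_ KU Kp]]] nUx; apply: Kp => /KU. Qed.

Lemma test_function_L2 U S phi : measurable S -> test_function U phi -> L2 S phi.
Proof.
move=> mS [sp [K [cK KU Kp]]]; split.
  by apply: measurable_funTS; apply: continuous_measurable_rV; exact: smooth_continuous.
apply: (@integrS _ _ _ setT) => //; apply: (cpt_integr cK).
  by apply: smooth_continuous; exact: smoothX.
by move=> x nK; rewrite Kp// expr0n.
Qed.

Lemma test_function_int_partial U phi i : measurable U -> test_function U phi ->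
  \int[leb]_(x in U) partial i phi x = 0.
Proof.
move=> mU tphi; have [sp [K [cK KU Kp]]] := tphi.
rewrite -(@Rintegral_subset _ _ U setT)//; first exact: int_derive_setT cK Kp _.
by move=> x _; exact: test_function_out (test_function_partial i tphi).
Qed.

Lemma test_function_parts U phi g i : measurable U -> smooth g -> test_function U phi ->
  \int[leb]_(x in U) (g x * partial i phi x) = - \int[leb]_(x in U) (partial i g x * phi x).
Proof.
move=> mU sg tphi; have [sp [K [cK KU Kp]]] := tphi.
have := test_function_int_partial i mU (test_functionM sg tphi).
have int1 g' psi : smooth g' -> test_function U psi -> integr U (fun x => g' x * psi x).
  move=> sg' tpsi; have [sp' [K' [cK' KU' Kp']]] := test_functionM sg' tpsi.
  by apply: (@integrS _ _ _ setT) => //; apply: (cpt_integr cK') => //; exact: smooth_continuous.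
rewrite partialM; [|by move=> x; exact: smooth_diff..].
rewrite RintegralD//.
- under [X in _ + X = _]eq_Rintegral do rewrite mulrC.
  by move/eqP; rewrite addr_eq0 => /eqP.
- by apply: int1 => //; exact: test_function_partial.
- under eq_fun do rewrite mulrC.
  by apply: int1 => //; exact: smooth_partial.
Qed.

Lemma test_function_weak_partial Omega phi i : measurable Omega -> test_function Omega phi ->
  is_weak_partial Omega i phi (partial i phi).
Proof.
move=> mO tphi; split.
  by apply: test_function_L2 => //; exact: test_function_partial tphi.
by move=> psi tpsi; apply: test_function_parts => //; case: tphi.
Qed.

Lemma weak_partial_unique Omega f g g' i : open Omega -> bounded_set Omega ->
  is_weak_partial Omega i f g -> is_weak_partial Omega i f g' ->
  nullL2 Omega (fun x => g x - g' x).
Proof.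
move=> oO bO [lg hg] [lg' hg']; have mO := open_measurable_rV oO.
apply: fundamental_lemma => //; first exact: L2B.
move=> phi tphi; have lphi := test_function_L2 mO tphi.
under eq_Rintegral do rewrite mulrBl.
rewrite RintegralB//; [|exact: L2_integrM..].
by apply/eqP; rewrite subr_eq0 -eqr_opp -hg// -hg'.
Qed.

Lemma wpartialP Omega f i : (exists g, is_weak_partial Omega i f g) ->
  is_weak_partial Omega i f (wpartial Omega i f).
Proof. by move=> [g hg]; exact: (xgetPex (fun=> 0) (ex_intro _ g hg)). Qed.

Lemma H1_wpartial Omega f i : H1 Omega f -> is_weak_partial Omega i f (wpartial Omega i f).
Proof. by move=> [_ h]; apply: wpartialP; exact: h. Qed.

Lemma H1_wpartial_L2 Omega f i : H1 Omega f -> L2 Omega (wpartial Omega i f).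
Proof. by move=> /(@H1_wpartial _ _ i)[]. Qed.

Lemma weak_partialB Omega f g df dg i : measurable Omega -> L2 Omega f -> L2 Omega g ->
  is_weak_partial Omega i f df -> is_weak_partial Omega i g dg ->
  is_weak_partial Omega i (fun x => f x - g x) (fun x => df x - dg x).
Proof.
move=> mO lf lg [ldf hf] [ldg hg]; split; first exact: L2B.
move=> phi tphi; have lphi := test_function_L2 mO tphi.
have ldphi := test_function_L2 mO (test_function_partial i tphi).
under eq_Rintegral do rewrite mulrBl.
under [in RHS]eq_Rintegral do rewrite mulrBl.
rewrite !RintegralB//; try exact: L2_integrM.
by rewrite hf// hg// opprB opprK addrC.
Qed.

(** [wpartial] picks an arbitrary representative, so even linearity holds only up to a null
    function. *)
Lemma wpartialB Omega f g i : open Omega -> bounded_set Omega -> H1 Omega f -> H1 Omega g ->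
  nullL2 Omega (fun x => wpartial Omega i (fun y => f y - g y) x -
    (wpartial Omega i f x - wpartial Omega i g x)).
Proof.
move=> oO bO hf hg; have mO := open_measurable_rV oO.
have wd := weak_partialB mO hf.1 hg.1 (H1_wpartial i hf) (H1_wpartial i hg).
by apply: (weak_partial_unique oO bO _ wd); apply: wpartialP; eexists; exact: wd.
Qed.

Lemma wpartial_test Omega phi i : open Omega -> bounded_set Omega -> test_function Omega phi ->
  nullL2 Omega (fun x => wpartial Omega i phi x - partial i phi x).
Proof.
move=> oO bO tphi; have mO := open_measurable_rV oO.
have wd := test_function_weak_partial i mO tphi.
by apply: (weak_partial_unique oO bO _ wd); apply: wpartialP; eexists; exact: wd.
Qed.

Lemma test_function_H10 Omega phi : open Omega -> bounded_set Omega -> test_function Omega phi ->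
  H10 Omega phi.
Proof.
move=> oO bO tphi; have mO := open_measurable_rV oO; split.
  split=> [|i]; first exact: test_function_L2 tphi.
  by exists (partial i phi); exact: test_function_weak_partial.
move=> eps eps0; exists phi => //.
rewrite big1 => [|i _]; last by have [] := wpartial_test i oO bO tphi.
rewrite addr0 /sqnormL2 (_ : (fun x => _) = fun=> 0); first by rewrite Rintegral_cst// mul0r.
by apply/funext => x /=; rewrite subrr expr0n.
Qed.

(** Test functions on [U] are test functions on [Omega], so the restricted weak derivative is one on
    [U]; there it is compared with the classical derivative by the fundamental lemma. This links the
    weak derivatives of the norm to the elementwise ones of the estimator. *)
Lemma wpartial_local Omega U f q i : open Omega -> bounded_set Omega -> open U ->
  U `<=` Omega -> H1 Omega f -> smooth q -> L2 U (partial i q) -> (forall x, U x -> f x = q x) ->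
  nullL2 U (fun x => wpartial Omega i f x - partial i q x).
Proof.
move=> oO bO oU UO hf sq lq fq; have mO := open_measurable_rV oO; have mU := open_measurable_rV oU.
have [lg hg] := H1_wpartial i hf; have lgU := L2S mO mU UO lg.
apply: fundamental_lemma => //.
- by case: bO => M [Mr hM]; exists M; split=> // N MN x Ux; apply: hM => //; exact: UO.
- exact: L2B.
move=> phi tphi; have tphi' := test_functionS UO tphi.
under eq_Rintegral do rewrite mulrBl.
have lphi := test_function_L2 mU tphi.
rewrite RintegralB//; [|exact: L2_integrM..].
have := hg _ tphi'.
rewrite (@Rintegral_subset _ _ U Omega (fun x => wpartial _ _ _ _ * _))//; last first.
  by move=> x _ nU; rewrite (test_function_out tphi nU) mulr0.
rewrite (@Rintegral_subset _ _ U Omega)//; last first.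
  by move=> x _ nU; rewrite (test_function_out (test_function_partial i tphi) nU) mulr0.
under eq_Rintegral => x /set_mem Ux do rewrite fq//.
by rewrite test_function_parts// => /eqP; rewrite eqr_opp => /eqP ->; rewrite subrr.
Qed.

End weak.

(** * Polynomials *)

Section lagrange.
Context {R : realType}.

(** The nodes are confined to [[0, delta]], so that a small [delta] keeps all interpolation points
    near one end of a segment. *)
Lemma lagrange_nodes m (delta : R) : 0 < delta ->
  exists (t : 'I_m.+1 -> R) (l : 'I_m.+1 -> {poly R}),
    (forall j, 0 <= t j <= delta) /\
    forall p : {poly R}, (size p <= m.+1)%N -> p = \sum_j p.[t j] *: l j.
Proof.
move=> d0; pose t (j : nat) : R := delta * j%:R / m.+1%:R.
have t_inj : injective t.
  move=> j k; rewrite /t => /mulIf; rewrite invr_neq0 ?pnatr_eq0// => /(_ isT).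
  by move=> /mulfI; rewrite gt_eqF// => /(_ isT)/eqP; rewrite eqr_nat => /eqP.
exists (fun j => t j), (fun j => tnth (qpoly.lagrange m.+1 t) j : {poly R}); split.
  move=> j; rewrite /t mulr_ge0 ?mulr_ge0 ?(ltW d0)//= ler_pdivrMr ?ltr0n//.
  by rewrite ler_wpM2l ?(ltW d0)// ler_nat ltnW.
move=> p sp; rewrite {1}(@qpoly.lagrange_gen _ m.+1 t _ t_inj p sp)//.
by apply: eq_bigr => j _; rewrite mul_polyC.
Qed.

End lagrange.

Section ispoly.
Context {R : realType} {n : nat}.
Local Notation leb := (lebesgue_rV R n).
Implicit Types (f g q : 'rV[R]_n -> R) (x y z : 'rV[R]_n).

(** Polynomials described by their restrictions to lines. This form is stable under affine
    substitutions and derivatives, and it reduces every estimate to interpolation in one variable,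
    without coefficients. *)
Definition ispoly m f : Prop := smooth f /\
  forall x y, exists2 p : {poly R}, (size p <= m.+1)%N & forall t, f (x + t *: y) = p.[t].

Lemma ispolyW m m' f : (m <= m')%N -> ispoly m f -> ispoly m' f.
Proof.
move=> mm [sf hf]; split=> // x y; have [p sp hp] := hf x y.
by exists p => //; exact: leq_trans sp _.
Qed.

Lemma ispoly_cst m c : ispoly m (fun=> c).
Proof.
split; first exact: smooth_cst.
by move=> x y; exists c%:P => [|t]; rewrite ?hornerC// (leq_trans (size_polyC_leq1 _)).
Qed.

Lemma ispoly_coord i : ispoly 1 (fun x => x 0 i).
Proof.
split; first exact: smooth_coord.
move=> x y; exists ((x 0 i)%:P + y 0 i *: 'X) => [|t].
  rewrite (leq_trans (size_polyD _ _))// geq_max (leq_trans (size_polyC_leq1 _))//=.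
  by rewrite (leq_trans (size_scale_leq _ _))// size_polyX.
by rewrite !hornerE !mxE mulrC.
Qed.

Lemma ispolyD m f g : ispoly m f -> ispoly m g -> ispoly m (fun x => f x + g x).
Proof.
move=> [sf hf] [sg hg]; split; first exact: smoothD.
move=> x y; have [p sp hp] := hf x y; have [q sq hq] := hg x y.
exists (p + q) => [|t]; last by rewrite hornerD hp hq.
by rewrite (leq_trans (size_polyD _ _))// geq_max sp.
Qed.

Lemma ispolyM m m' f g : ispoly m f -> ispoly m' g -> ispoly (m + m') (fun x => f x * g x).
Proof.
move=> [sf hf] [sg hg]; split; first exact: smoothM.
move=> x y; have [p sp hp] := hf x y; have [q sq hq] := hg x y.
exists (p * q) => [|t]; last by rewrite hornerM hp hq.
by rewrite (leq_trans (size_polyMleq _ _))//; move: sp sq; lia.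
Qed.

Lemma ispolyZ m c f : ispoly m f -> ispoly m (fun x => c * f x).
Proof. by move=> hf; exact: (@ispolyM 0 m _ _ (ispoly_cst 0 c)). Qed.

Lemma ispolyN m f : ispoly m f -> ispoly m (fun x => - f x).
Proof. by move=> hf; under eq_fun do rewrite -mulN1r; exact: ispolyZ. Qed.

Lemma ispolyB m f g : ispoly m f -> ispoly m g -> ispoly m (fun x => f x - g x).
Proof. by move=> hf hg; apply: ispolyD => //; exact: ispolyN. Qed.

Lemma ispoly_sum m (J : Type) (s : seq J) (P : pred J) (F : J -> 'rV[R]_n -> R) :
  (forall i, P i -> ispoly m (F i)) -> ispoly m (fun x => \sum_(i <- s | P i) F i x).
Proof.
move=> sF; elim: s => [|i s IH].
  by under eq_fun do rewrite big_nil; exact: ispoly_cst.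
have [Pi|Pi] := boolP (P i); last by under eq_fun do rewrite big_cons (negbTE Pi).
by under eq_fun do rewrite big_cons Pi; apply: ispolyD => //; exact: sF.
Qed.

Lemma ispolyX m f k : ispoly m f -> ispoly (k * m) (fun x => f x ^+ k).
Proof.
move=> hf; elim: k => [|k IH].
  by under eq_fun do rewrite expr0; exact: ispoly_cst.
by under eq_fun do rewrite exprS; rewrite mulSn; exact: ispolyM.
Qed.

Lemma ispoly_monomial (a : 'I_n -> nat) (s : seq 'I_n) :
  ispoly (\sum_(i <- s) a i) (fun x => \prod_(i <- s) x 0 i ^+ a i).
Proof.
elim: s => [|i s IH].
  by rewrite big_nil; under eq_fun do rewrite big_nil; exact: ispoly_cst.
rewrite big_cons (_ : (fun _ => _) = fun x => x 0 i ^+ a i * \prod_(j <- s) x 0 j ^+ a j); last first.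
  by apply/funext => x; rewrite big_cons.
by apply: ispolyM => //; have := ispolyX (a i) (ispoly_coord i); rewrite muln1.
Qed.

(** The given [f] is arbitrary outside [S]; [q] is a smooth function on the whole space from which
    derivatives and traces are read off. *)
Lemma polynomial_onP k S f : polynomial_on k S f ->
  exists2 q, ispoly k q & forall x, S x -> f x = q x.
Proof.
move=> [c hc]; eexists; last by move=> x Sx; exact: hc.
apply: ispoly_sum => a ak; apply: ispolyZ; apply: ispolyW ak _.
exact: (ispoly_monomial (fun i => a i)).
Qed.

Lemma ispoly_comp m f (A : 'rV[R]_n -> 'rV[R]_n) :
  (forall j, smooth (fun x => A x 0 j)) ->
  (forall x y, exists y', forall t, A (x + t *: y) = A x + t *: y') ->
  ispoly m f -> ispoly m (f \o A).
Proof.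
move=> sA hA [sf hf]; split; first exact: smooth_comp.
move=> x y; have [y' hy] := hA x y; have [p sp hp] := hf (A x) y'.
by exists p => // t; rewrite /= hy.
Qed.

Lemma ispoly_shift m f w : ispoly m f -> ispoly m (fun x => f (x + w)).
Proof.
apply: (@ispoly_comp m f (fun x => x + w)).
  by move=> j; under eq_fun do rewrite mxE; apply: smoothD; [exact: smooth_coord|exact: smooth_cst].
by move=> x y; exists y => t; rewrite addrAC.
Qed.

Lemma derive_line_poly f x v (p : {poly R}) : (forall t, f (x + t *: v) = p.[t]) ->
  'D_v f x = p^`().[0].
Proof.
move=> hp; have [dp <-] := is_derive_poly p 0.
rewrite /derive; congr (lim _).
have -> : (fun h : R => h^-1 *: (f (h *: v + x) - f x)) =
    (fun h : R => h^-1 *: (p.[h *: 1 + 0] - p.[0])); last by [].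
by apply/funext => h; rewrite addr0 [h *: 1]mulr1 -hp -(hp 0) scale0r addr0 (addrC x).
Qed.

(** Differentiating the interpolation formula at 0 makes a derivative a fixed combination of values.
    Both the stability of [ispoly] under derivation and the inverse estimate follow from it. *)
Lemma ispoly_derive_nodes m : exists (t w : 'I_m.+1 -> R), (forall j, 0 <= t j <= 1) /\
  forall f x v, ispoly m f -> 'D_v f x = \sum_j w j * f (x + t j *: v).
Proof.
have [t [l [t01 tl]]] := lagrange_nodes m (@ltr01 R).
exists t, (fun j => (l j)^`().[0]); split=> // f x v [_ hf].
have [p sp hp] := hf x v; rewrite (derive_line_poly hp) {1}(tl p sp).
rewrite raddf_sum/= horner_sum; apply: eq_bigr => j _.
by rewrite derivZ hornerZ hp mulrC.
Qed.

Lemma ispoly_derive m f v : ispoly m f -> ispoly m (fun x => 'D_v f x).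
Proof.
move=> hf; have [t [w [_ tw]]] := ispoly_derive_nodes m.
rewrite (_ : (fun _ => _) = fun x => \sum_j w j * f (x + t j *: v)).
  by apply: ispoly_sum => j _; apply: ispolyZ; exact: ispoly_shift.
by apply/funext => x; exact: tw.
Qed.

Lemma ispoly_partial m f i : ispoly m f -> ispoly m (partial i f).
Proof. exact: ispoly_derive. Qed.

Lemma continuous_bounded f (S : set 'rV[R]_n) : continuous f -> bounded_set S ->
  exists2 M, 0 <= M & forall x, S x -> `|f x| <= M.
Proof.
move=> cf /bounded_cube[r r0 Sr].
have /compact_bounded[M [Mr hM]] : compact (f @` closed_box (- const_mx r) (const_mx r)).
  by apply: continuous_compact; [exact: continuous_subspaceT|exact: compact_closed_box].
exists (`|M| + 1) => [|x Sx]; first by rewrite addr_ge0.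
apply: hM; first by rewrite ltr_pwDr// ler_norm.
exists x => // i; have := Sr _ Sx i; rewrite in_itv/= !mxE => /andP[? ?].
by apply/andP; split; lra.
Qed.

Lemma continuous_L2 f (S : set 'rV[R]_n) : measurable S -> bounded_set S -> continuous f -> L2 S f.
Proof.
move=> mS bS cf; have [M M0 fM] := continuous_bounded cf bS.
by apply: (@L2_bounded _ _ _ _ M) => //; apply: measurable_funTS; exact: continuous_measurable_rV.
Qed.

Lemma ispoly_L2 m f (S : set 'rV[R]_n) : measurable S -> bounded_set S -> ispoly m f -> L2 S f.
Proof. by move=> mS bS [sf _]; apply: continuous_L2 => //; exact: smooth_continuous. Qed.

(* The squared size of a polynomial on the scale [r] around [z]. *)
Definition meansq q z r : R := r ^- n * sqnormL2 (cube z r) q.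

Lemma meansq_ge0 q z r : 0 <= r -> 0 <= meansq q z r.
Proof. by move=> r0; rewrite mulr_ge0 ?sqnormL2_ge0// invr_ge0 exprn_ge0. Qed.

(* Lagrange interpolation on the segment from [y] to [x], with nodes near [y],
   averaged over [y] in a small cube. *)
Lemma ispoly_value_bound m (L : R) : 0 <= L -> exists2 C, 0 < C &
  forall z r q x, 0 < r -> ispoly m q -> enorm (x - z) <= L * r ->
    q x ^+ 2 <= C * meansq q z r.
Proof.
(* Chosen so that [delta * (L + 1) = 1 / 2]: the interpolation points [y + t j *: (x - y)], for [y]
   in the half-sized cube, then stay in the cube of half-width [r], even though [x] is at distance
   [L * r]. *)
move=> L0; pose delta := (2 * (L + 1))^-1; have d0 : 0 < delta by rewrite invr_gt0; lra.
have dL : delta * (L + 1) = 2^-1 by rewrite /delta; field; lra.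
have [t [l [tb tl]]] := lagrange_nodes m d0.
pose C := 2 ^+ size (index_enum 'I_m.+1) * (\sum_j (l j).[1] ^+ 2) * 2 ^+ n.
have C0 : 0 <= C by rewrite mulr_ge0// mulr_ge0// sumr_ge0// => j _; exact: sqr_ge0.
exists (C + 1); first by rewrite ltr_wpDl.
move=> z r q x r0 hq xz; have [sq lq] := hq.
have r2 : 0 < r / 2 by rewrite divr_gt0.
set Q := cube z r; set Y := cube z (r / 2).
have mQ : measurable Q by exact: measurable_box. have mY : measurable Y by exact: measurable_box.
have bQ : bounded_set Q by exact: bounded_set_cube. have bY : bounded_set Y by exact: bounded_set_cube.
have lQ : L2 Q q by exact: ispoly_L2 hq.
(* The interpolation point as a function of [y] is a dilation of ratio [1 - t j], so its average
   over [y] is computed by a change of variables. *)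
pose G j y := q (dil (t j *: x) (1 - t j) y).
have t1 j : 2^-1 <= 1 - t j.
  have /andP[t0 td] := tb j; have : delta <= 2^-1 by rewrite -dL ler_peMr ?(ltW d0)//; lra.
  by lra.
have hG j : ispoly m (G j).
  apply: (@ispoly_comp m q (dil (t j *: x) (1 - t j))) => // [k|u v].
    rewrite /dil; under eq_fun do rewrite !mxE.
    by apply: smoothD; [exact: smooth_cst|apply: smoothZ; exact: smooth_coord].
  exists ((1 - t j) *: v) => s; rewrite /dil scalerDr addrA; congr (_ + _).
  by rewrite !scalerA mulrC.
have pt y : q x ^+ 2 <= 2 ^+ size (index_enum 'I_m.+1) * \sum_j ((l j).[1] * G j y) ^+ 2.
  have [p sp hp] := lq y (x - y).
  have -> : q x = \sum_j (l j).[1] * G j y.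
    have := hp 1; rewrite scale1r addrC subrK => ->.
    rewrite {1}(tl p sp) horner_sum; apply: eq_bigr => j _.
    rewrite hornerZ mulrC -hp; congr (_ * q _).
    by apply/rowP => k; rewrite /dil !mxE; ring.
  exact: sqr_sum_le.
have YQ j : Y `<=` dil (t j *: x) (1 - t j) @^-1` Q.
  move=> y hy i; have := hy i; have := coord_enorm (x - z) i; rewrite /dil !mxE.
  have /andP[t0 td] := tb j => hx hyi.
  have xL : `|x 0 i - z 0 i| <= L * r by exact: le_trans hx xz.
  have yr : `|y 0 i - z 0 i| <= r / 2 by rewrite ler_norml; move: hyi; lra.
  have : `|t j * (x 0 i - z 0 i)| <= delta * (L * r).
    by rewrite normrM ger0_norm// ler_pM.
  have : `|(1 - t j) * (y 0 i - z 0 i)| < r / 2.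
    have ty : `|y 0 i - z 0 i| < r / 2 by rewrite ltr_norml; move: hyi; lra.
    rewrite normrM ger0_norm; last by have := t1 j; lra.
    by apply: le_lt_trans ty; rewrite ler_piMl//; lra.
  have -> : delta * (L * r) = (2^-1 - delta) * r by rewrite -dL; ring.
  have : 0 < delta * r by rewrite mulr_gt0.
  rewrite !ltr_norml !ler_norml; lra.
have intG j : sqnormL2 Y (G j) <= 2 ^+ n * sqnormL2 Q q.
  have s0 : 0 < 1 - t j by have := t1 j; lra.
  have mP : measurable (dil (t j *: x) (1 - t j) @^-1` Q).
    exact: (measurable_preT (measurable_dil _ _)).
  have E := Rintegral_dil (t j *: x) s0 mQ (L2_sqr lQ).
  have LP : L2 (dil (t j *: x) (1 - t j) @^-1` Q) (G j).
    split; last exact: (integrable_dil (t j *: x) s0 mQ (L2_sqr lQ)).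
    apply: measurable_funTS; apply: continuous_measurable_rV; apply: smooth_continuous.
    by have [] := hG j.
  apply: le_trans (sqnormL2S mP mY (YQ j) LP) _.
  (* As [1 - t j] is at least one half, the change of variables costs at most the factor
     [2 ^+ n]. *)
  rewrite {2}/sqnormL2 E mulrA ler_peMl ?sqnormL2_ge0// -exprMn exprn_ege1//.
  by have := t1 j; lra.
have : q x ^+ 2 * r ^+ n <= C * sqnormL2 Q q.
  have Yr : fine (leb Y) = r ^+ n by rewrite lebesgue_cube//= mulrC divfK.
  rewrite -Yr -Rintegral_cst//.
  have iG j : integr Y (fun y => ((l j).[1] * G j y) ^+ 2).
    by apply: L2_sqr; apply: L2Z => //; exact: ispoly_L2 (hG j).
  apply: (@le_trans _ _ (\int[leb]_(y in Y) (2 ^+ size (index_enum 'I_m.+1) * \sum_j ((l j).[1] * G j y) ^+ 2))).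
    apply: le_Rintegral => //.
    - by apply: (@integr_bounded _ _ _ _ `|q x ^+ 2|).
    - by apply: integrZ => //; exact: integr_sum.
  rewrite RintegralZl//; last exact: integr_sum.
  rewrite Rintegral_sum// /C -!mulrA ler_wpM2l// big_distrl/=; apply: ler_sum => j _.
  rewrite -[leLHS]/(sqnormL2 Y (fun y => (l j).[1] * G j y)) sqnormL2Z//; last exact: ispoly_L2 (hG j).
  by rewrite ler_wpM2l ?sqr_ge0.
rewrite /meansq -ler_pdivlMr ?exprn_gt0// => /le_trans; apply.
rewrite -mulrA (mulrC (sqnormL2 Q q)); apply: ler_wpM2r; last by rewrite lerDl.
by rewrite mulr_ge0 ?sqnormL2_ge0// invr_ge0 exprn_ge0// ltW.
Qed.

(** An inverse estimate: [r] times a partial derivative is a combination of values on a segment of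
    length [r] starting at [x], and this segment stays within [(L + 1) * r] of [z]. *)
Lemma ispoly_bound m (L : R) : 0 <= L -> exists2 C, 0 < C &
  forall z r q x, 0 < r -> ispoly m q -> enorm (x - z) <= L * r ->
    q x ^+ 2 <= C * meansq q z r /\
    forall i, partial i q x ^+ 2 <= C * (r ^- 2 * meansq q z r).
Proof.
move=> L0; have [C1 C10 h1] := @ispoly_value_bound m (L + 1) ltac:(lra).
have [t [w [tb tw]]] := ispoly_derive_nodes m.
pose W := 2 ^+ size (index_enum 'I_m.+1) * \sum_j w j ^+ 2.
have W0 : 0 <= W by rewrite mulr_ge0// sumr_ge0// => j _; exact: sqr_ge0.
exists (C1 * (W + 1)); first by rewrite mulr_gt0// ltr_wpDl.
move=> z r q x r0 hq xz; have m0 := meansq_ge0 q z (ltW r0); split.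
  apply: le_trans (h1 z r q x r0 hq _) _.
    by apply: le_trans xz _; rewrite ler_wpM2r ?(ltW r0)//; lra.
  by rewrite -mulrA ler_wpM2l ?(ltW C10)// ler_peMl//; lra.
move=> i; have : (r * partial i q x) ^+ 2 <= C1 * W * meansq q z r.
  have -> : r * partial i q x = 'D_(r *: delta_mx 0 i) q x.
    rewrite [RHS]deriveE; last by apply: smooth_diff; case: hq.
    by rewrite linearZ /= -deriveE//; apply: smooth_diff; case: hq.
  rewrite (tw q x _ hq); apply: le_trans (sqr_sum_le _ _ _) _.
  rewrite /W (mulrC C1) -!mulrA ler_wpM2l// big_distrl/=; apply: ler_sum => j _.
  rewrite exprMn ler_wpM2l ?sqr_ge0//; apply: h1 => //.
  rewrite addrAC; apply: le_trans (enormD _ _) _; rewrite mulrDl lerD// mul1r.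
  rewrite !enormZ mulrA (ger0_norm (ltW r0)).
  have e1 : enorm (delta_mx 0 i : 'rV[R]_n) <= 1.
    rewrite enorm_le// /dotv (bigD1 i)//= !mxE !eqxx mulr1 big1 ?addr0 ?expr1n//.
    by move=> k ki; rewrite !mxE (negbTE ki) mulr0.
  have /andP[t0 t1] := tb j; rewrite (ger0_norm t0) -[leRHS]mulr1 ler_pM ?mulr_ge0 ?enorm_ge0 ?(ltW r0)//.
  by rewrite ler_piMl// ltW.
rewrite exprMn mulrC -ler_pdivlMr ?exprn_gt0// => /le_trans; apply.
rewrite -[leLHS]mulrA (mulrC (meansq q z r)); apply: ler_wpM2r.
  by rewrite mulr_ge0// invr_ge0 exprn_ge0// ltW.
by rewrite ler_wpM2l ?(ltW C10)//; lra.
Qed.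

End ispoly.

(** * Simplices and facets *)

Section hulls.
Context {R : realType} {n : nat}.
Variable T : mesh R n.
Local Notation simplex := {set 'I_(nverts T)}.
Implicit Types (s K e : simplex) (x y z : 'rV[R]_n.+1).

Lemma hullS s s' : s \subset s' -> @hull _ _ T s `<=` hull s'.
Proof.
move=> ss' x [c [c0 c1 ->]].
have sI (V : nmodType) (F : 'I_(nverts T) -> V) :
    \sum_(a in s') (if a \in s then F a else 0) = \sum_(a in s) F a.
  rewrite -big_mkcondr/=; apply: eq_bigl => a.
  by apply/andP/idP => [[]//|as_]; split=> //; exact: (fintype.subsetP ss').
exists (fun a => if a \in s then c a else 0); split.
- by move=> a; case: ifP.
- by rewrite sI.
- by rewrite -[LHS]sI; apply: eq_bigr => a _; case: ifP => // _; rewrite scale0r.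
Qed.

Lemma hull_coef_le1 s (c : 'I_(nverts T) -> R) : (forall a, 0 <= c a) ->
  \sum_(a in s) c a = 1 -> forall a, a \in s -> c a <= 1.
Proof.
by move=> c0 c1 a as_; rewrite -c1 (bigD1 a)//= lerDl sumr_ge0.
Qed.

Lemma hull_enorm s x : @hull _ _ T s x -> enorm x <= \sum_(a in s) enorm (vertex a).
Proof.
move=> [c [c0 c1 ->]].
have h : forall (r : seq 'I_(nverts T)),
    enorm (\sum_(a <- r | a \in s) c a *: vertex a) <= \sum_(a <- r | a \in s) enorm (vertex a).
  elim=> [|a r IH]; first by rewrite !big_nil /enorm dotv0l sqrtr0.
  rewrite !big_cons; case: ifPn => // as_.
  apply: le_trans (enormD _ _) _; rewrite lerD// enormZ ger0_norm//.
  by rewrite ler_piMl ?enorm_ge0// (hull_coef_le1 c0 c1).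
exact: h.
Qed.

Lemma hull_vertex s a : a \in s -> @hull _ _ T s (vertex a).
Proof.
move=> as_; exists (fun b => (b == a)%:R); split => //.
- by rewrite (bigD1 a)//= eqxx big1 ?addr0// => b /andP[_ /negbTE ->].
- rewrite (bigD1 a)//= eqxx scale1r big1 ?addr0// => b /andP[_ /negbTE ->].
  by rewrite scale0r.
Qed.

(** [diam] is a supremum in the reals, which is 0 by default; it bounds distances only once the set
    of distances is known to be nonempty and bounded. *)
Lemma has_sup_diam s a : a \in s ->
  has_sup [set enorm (x - y) | x in @hull _ _ T s & y in @hull _ _ T s].
Proof.
move=> as_; split.
  by exists (enorm (@vertex _ _ T a - vertex a)), (vertex a); [exact: hull_vertex|exists (vertex a); first exact: hull_vertex].
exists (\sum_(a in s) enorm (@vertex _ _ T a) + \sum_(a in s) enorm (@vertex _ _ T a)).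
move=> _ [x hx [y hy <-]]; apply: le_trans (enormD _ _) _; rewrite enormN.
by rewrite lerD// hull_enorm.
Qed.

Lemma hull_diam s x y : @hull _ _ T s x -> @hull _ _ T s y -> enorm (x - y) <= diam (@hull _ _ T s).
Proof.
move=> hx hy; have [a as_] : exists a, a \in s.
  apply/existsP; apply: contraT => /existsPn h; have [c [_ c1 _]] := hx.
  by move: c1; rewrite big1 => [/eqP|a /(negP (h a))//]; rewrite eq_sym oner_eq0.
by apply: sup_upper_bound; [exact: has_sup_diam as_|exists x => //; exists y].
Qed.

Lemma diam_hull_ge0 s : 0 <= diam (@hull _ _ T s).
Proof.
have [[x hx]|h] := pselect (exists x, @hull _ _ T s x).
  by apply: le_trans (hull_diam hx hx); exact: enorm_ge0.
rewrite /diam sup_out// => -[[_ [x hx _]] _]; apply: h; by exists x.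
Qed.

Lemma diam_hullS s s' a : a \in s -> s \subset s' ->
  diam (@hull _ _ T s) <= diam (@hull _ _ T s').
Proof.
move=> as_ ss'; apply: ge_sup; first by have [] := has_sup_diam as_.
by move=> _ [x hx [y hy <-]]; apply: hull_diam; exact: hullS ss' _ _.
Qed.

(** A positive [inball_diam] is a genuine supremum, since [sup] is 0 otherwise. It need not be
    attained, and a ball of more than half the supremal diameter is enough. *)
Lemma inball_witness (A : set 'rV[R]_n.+1) : 0 < inball_diam A ->
  exists r z, [/\ 0 < r, inball_diam A < 4 * r & forall x, enorm (x - z) <= r -> A x].
Proof.
move=> d0; have hs : has_sup [set 2 * r | r in [set r | 0 <= r /\
    exists c, forall x : 'rV[R]_n.+1, enorm (x - c) <= r -> A x]].
  by apply: contrapT => h; move: d0; rewrite /inball_diam (sup_out h) ltxx.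
have d2 : 0 < inball_diam A / 2 by rewrite divr_gt0.
have [_ [r [r0 [z hz]] <-] hr] := sup_adherent d2 hs.
by exists r, z; split=> //; move: hr; rewrite -/(inball_diam A); lra.
Qed.

(** * Barycentric coordinates *)

Section barycentric.
Variable K : simplex.
Hypotheses (cK : #|K| = n.+2) (aK : @affinely_independent _ _ T K).

(** The matrix with rows [(1, vertex)] is square because [#|K| = n.+2], and affine independence
    makes its rows free. The entries of its inverse are the coefficients of the barycentric
    coordinates. *)
Lemma barycentric : exists (al : 'I_(nverts T) -> R) (be : 'I_(nverts T) -> 'rV[R]_n.+1),
  let lam a x := al a + dotv x (be a) in
  [/\ forall x, \sum_(a in K) lam a x = 1,
      forall x, \sum_(a in K) lam a x *: vertex a = x &
      forall c x, \sum_(a in K) c a = 1 -> \sum_(a in K) c a *: vertex a = x ->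
        forall a, a \in K -> c a = lam a x].
Proof.
have [k0 k0K] : exists k0, k0 \in K by apply/existsP; rewrite -[[exists _, _]]negbK; apply/existsPn => h; move: cK; rewrite (eq_card0 (A := K))// => a; exact/negbTE/h.
pose rk := enum_rank_in k0K.
pose A : 'M[R]_(#|K|, 1 + n.+1) := row_mx (const_mx 1) (\matrix_(j < #|K|, i < n.+1) vertex (enum_val j) 0 i).
have AE (u : 'rV[R]_#|K|) : u *m A = row_mx (const_mx (\sum_j u 0 j)) (\sum_j u 0 j *: vertex (enum_val j)).
  rewrite mul_mx_row; congr row_mx.
    by apply/rowP => i; rewrite !mxE; apply: eq_bigr => j _; rewrite !mxE mulr1.
  by apply/rowP => i; rewrite !mxE summxE; apply: eq_bigr => j _; rewrite !mxE.
have sE (V : nmodType) (F : 'I_(nverts T) -> V) : \sum_(a in K) F a = \sum_(j < #|K|) F (enum_val j).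
  exact: big_enum_val.
have fA : row_free A.
  apply: inj_row_free => u; rewrite AE -row_mx0 => /eq_row_mx[h1 h2].
  have u0 : \sum_j u 0 j = 0 by have := congr1 (fun M : 'rV_1 => M 0 0) h1; rewrite !mxE.
  pose c a := u 0 (rk a).
  have ck j : c (enum_val j) = u 0 j by rewrite /c /rk enum_valK_in.
  have c0 : forall a, a \in K -> c a = 0.
    apply: aK; rewrite sE.
      by under eq_bigr do rewrite ck.
    by under eq_bigr do rewrite ck.
  by apply/rowP => j; rewrite mxE -ck c0//; exact: enum_valP.
have [B AB] := row_freeP fA.
have fullA : row_full A by rewrite /row_full; move: fA; rewrite /row_free => /eqP ->; rewrite cK.
have [B' BA'] := row_fullP fullA.
have BA : B *m A = 1%:M.
  by rewrite -[B]mul1mx -{1}BA' -[B' *m A *m B]mulmxA AB mulmx1.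
exists (fun a => B (lshift _ 0) (rk a)), (fun a => \row_i B (rshift 1 i) (rk a)).
move=> lam; have lamE x a : lam a x = (row_mx 1%:M x *m B) 0 (rk a).
  rewrite /lam [RHS]mxE [RHS]big_split_ord/= big_ord1; congr (_ + _).
    by rewrite row_mxEl mxE mul1r; congr (B _ _); apply/val_inj.
  by apply: eq_bigr => i _; rewrite row_mxEr mxE.
have lamk x j : lam (enum_val j) x = (row_mx 1%:M x *m B) 0 j by rewrite lamE /rk enum_valK_in.
have xE x : row_mx (const_mx (\sum_(j < #|K|) lam (enum_val j) x)) (\sum_(j < #|K|) lam (enum_val j) x *: vertex (enum_val j)) = row_mx (1%:M : 'M[R]_1) x.
  rewrite -[RHS]mulmx1 -BA mulmxA AE; congr row_mx.
    by congr const_mx; apply: eq_bigr => j _; rewrite lamk.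
  by apply: eq_bigr => j _; rewrite lamk.
split.
- move=> x; rewrite sE; have [h _] := eq_row_mx (xE x).
  by have := congr1 (fun M : 'rV_1 => M 0 0) h; rewrite !mxE.
- by move=> x; rewrite sE; have [_ ->] := eq_row_mx (xE x).
- move=> c x c1 cx a aK'; pose u : 'rV[R]_#|K| := \row_j c (enum_val j).
  have uA : u *m A = row_mx 1%:M x.
    rewrite AE; congr row_mx.
      apply/rowP => i; rewrite !ord1 !mxE eqxx -c1 sE.
      by apply: eq_bigr => j _; rewrite mxE.
    by rewrite -cx sE; apply: eq_bigr => j _; rewrite mxE.
  by rewrite lamE -uA -mulmxA AB mulmx1 mxE /rk enum_rankK_in.
Qed.

Definition is_barycentric (al : 'I_(nverts T) -> R) (be : 'I_(nverts T) -> 'rV[R]_n.+1) : Prop :=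
  [/\ forall x, \sum_(a in K) (al a + dotv x (be a)) = 1,
      forall x, \sum_(a in K) (al a + dotv x (be a)) *: vertex a = x &
      forall c x, \sum_(a in K) c a = 1 -> \sum_(a in K) c a *: vertex a = x ->
        forall a, a \in K -> c a = al a + dotv x (be a)].

Variables (al : 'I_(nverts T) -> R) (be : 'I_(nverts T) -> 'rV[R]_n.+1).
Hypothesis bary : is_barycentric al be.
Local Notation lam a x := (al a + dotv x (be a)).

Lemma hull_barycentric x : @hull _ _ T K x <-> forall a, a \in K -> 0 <= lam a x.
Proof.
have [b1 b2 b3] := bary; split.
  by move=> [c [c0 c1 xc]] a aK'; rewrite -(b3 c x c1 (esym xc) a aK').
move=> h; exists (fun a => if a \in K then lam a x else 0); split.
- by move=> a; case: ifPn => // /h.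
- by rewrite -[RHS](b1 x); apply: eq_bigr => a ->.
- by rewrite -[LHS]b2; apply: eq_bigr => a ->.
Qed.

Lemma barycentric_le1 x a : @hull _ _ T K x -> a \in K -> lam a x <= 1.
Proof.
move=> /hull_barycentric h aK'; have [b1 _ _] := bary.
by rewrite -(b1 x) (bigD1 a)//= lerDl sumr_ge0// => b /andP[/h].
Qed.

(** From the centre of an inscribed ball to its sphere, along the gradient, the coordinate grows by
    [r * enorm (be a)], while its values stay in [[0, 1]]. *)
Lemma barycentric_gradient z r a : 0 < r -> (forall x, enorm (x - z) <= r -> @hull _ _ T K x) ->
  a \in K -> enorm (be a) <= r^-1.
Proof.
move=> r0 hz aK'; have [->|b0] := eqVneq (enorm (be a)) 0; first by rewrite invr_ge0 ltW.
have bgt0 : 0 < enorm (be a) by rewrite lt_def b0 enorm_ge0.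
pose y := (r / enorm (be a)) *: be a.
have ey : enorm y = r by rewrite enormZ ger0_norm ?divfK// divr_ge0// ltW.
have h1 : @hull _ _ T K (z + y) by apply: hz; rewrite addrAC subrr add0r ey.
have h2 : @hull _ _ T K z by apply: hz; rewrite subrr /enorm dotv0l sqrtr0 ltW.
have := barycentric_le1 h1 aK'; have := (hull_barycentric z).1 h2 a aK'.
rewrite dotvDl /y dotvZl -enorm_sqr expr2 mulrA divfK// => l0 l1.
by rewrite -(ler_pM2l r0) divff ?gt_eqF//; lra.
Qed.

Lemma interior_barycentric x : (forall a, a \in K -> 0 < lam a x) -> (interior (@hull _ _ T K)) x.
Proof.
move=> h; rewrite /interior.
have : \forall y \near x, forall a, a \in K -> 0 < lam a y.
  apply: (@filter_forall _ _ (fun a y => a \in K -> 0 < lam a y) (nbhs x)) => a.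
  have [aK'|aK'] := boolP (a \in K); last by apply: filterE.
  have ca : {for x, continuous (fun y => lam a y)}.
    apply: (@smooth_continuous R n.+1 (fun y => lam a y)).
    apply: smoothD; first exact: smooth_cst.
    by apply: smooth_sum => i _; apply: smoothM; [exact: smooth_coord|exact: smooth_cst].
  have := ca; move/cvgr_gt => /(_ 0 (h _ aK')); by apply: filterS.
by apply: filterS => y hy; apply/hull_barycentric => a /hy/ltW.
Qed.

Lemma lam_line a x y t : lam a (x + t *: (y - x)) = (1 - t) * lam a x + t * lam a y.
Proof. by rewrite dotvDl dotvZl dotvBl; ring. Qed.

Definition barycenter s : 'rV[R]_n.+1 := \sum_(a in s) (#|s|%:R)^-1 *: @vertex _ _ T a.

Lemma lam_center e a : e \subset K -> e != finset.set0 -> a \in K ->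
  lam a (barycenter e) = (a \in e)%:R / #|e|%:R.
Proof.
move=> eK e0 aK'; have [_ _ b3] := bary.
have ce : #|e|%:R != 0 :> R by rewrite pnatr_eq0 cards_eq0.
have sI (V : nmodType) (F : 'I_(nverts T) -> V) :
    \sum_(b in K) (if b \in e then F b else 0) = \sum_(b in e) F b.
  rewrite -big_mkcondr/=; apply: eq_bigl => b.
  by apply/andP/idP => [[]//|be_]; split=> //; exact: (fintype.subsetP eK).
rewrite -(b3 (fun a => if a \in e then #|e|%:R^-1 else 0) (barycenter e) _ _ a aK').
- by case: ifP; rewrite ?mul1r ?mul0r.
- by rewrite sI sumr_const -[LHS]mulr_natr mulVf.
- by rewrite -[RHS]sI; apply: eq_bigr => b _; case: ifP => // _; rewrite scale0r.
Qed.

End barycentric.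
End hulls.

Section partitions.
Context {R : realType} {n : nat}.
Variable T : mesh R n.
Local Notation simplex := {set 'I_(nverts T)}.
Implicit Types (s K e : simplex) (x y z : 'rV[R]_n.+1).
Variable Omega : set 'rV[R]_n.+1.
Hypothesis pT : simplicial_partition T Omega.

Lemma element_barycentric K : K \in elements T -> exists al be, @is_barycentric R n T K al be.
Proof. by case: pT => h _ _ /h[c a]; have [al [be ?]] := barycentric c a; exists al, be. Qed.

Lemma element_card K : K \in elements T -> #|K| = n.+2.
Proof. by case: pT => h _ _ /h[]. Qed.

Lemma element_closure K : K \in elements T -> @hull _ _ T K `<=` closure Omega.
Proof. by case: pT => _ -> _ KT x hx; exists K. Qed.

(** The coordinate of a vertex [a] of [K] outside [K'] vanishes on the hull of [K :&: K'], which
    would contain a neighbourhood of a common interior point; but it increases on the way to [a]. *)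
Lemma interior_disjoint K K' : K \in elements T -> K' \in elements T -> K != K' ->
  interior (@hull _ _ T K) `&` interior (@hull _ _ T K') = set0.
Proof.
move=> KT KT' KK'; apply/seteqP; split=> // x [xK xK'] /=.
have [al [be bary]] := element_barycentric KT.
have [a aK aK'] : exists2 a, a \in K & a \notin K'.
  apply/subsetPn; apply: contra KK' => KK'; rewrite eqEcard KK'.
  by rewrite (element_card KT) (element_card KT') leqnn.
have lam0 y : @hull _ _ T (K :&: K') y -> al a + dotv y (be a) = 0.
  move=> [c [c0 c1 yc]]; have [_ _ b3] := bary.
  have sI (V : nmodType) (F : 'I_(nverts T) -> V) :
    \sum_(b in K) (if b \in K' then F b else 0) = \sum_(b in (K :&: K')%SET) F b.
    by rewrite -big_mkcondr/=; apply: eq_bigl => b; rewrite finset.in_setI.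
  rewrite -(b3 (fun a => if a \in K' then c a else 0) y _ _ a aK) ?(negbTE aK')//.
  - by rewrite sI.
  - by rewrite yc -[RHS]sI; apply: eq_bigr => b _; case: ifP => // _; rewrite scale0r.
have : \forall y \near x, @hull _ _ T (K :&: K') y.
  case: pT => _ _ hI; rewrite -hI//; apply: filterI; [exact: xK|exact: xK'].
move=> near0; have c : (fun t : R => x + t *: (vertex a - x)) @ (0 : R)^'+ --> x.
  rewrite -[X in _ --> X]addr0 -(scale0r (vertex a - x)); apply: cvgD; first exact: cvg_cst.
  apply: cvgZr_tmp; exact: cvg_at_right_filter.
have ht := c _ near0.
have [t [t0 h]] : exists t : R, 0 < t /\ @hull _ _ T (K :&: K') (x + t *: (vertex a - x)).
  near (0 : R)^'+ => t; exists t; split; near: t; [exact: nbhs_right_gt|exact: ht].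
have := lam0 _ h; rewrite (lam_line al be).
rewrite (lam0 x (nbhs_singleton near0)) mulr0 add0r.
have [_ _ b3] := bary; rewrite -(b3 (fun b => (b == a)%:R) (vertex a) _ _ a aK).
- by rewrite eqxx mulr1 => t00; rewrite t00 ltxx in t0.
- by rewrite (bigD1 a)//= eqxx big1 ?addr0// => b /andP[_ /negbTE ->].
- rewrite (bigD1 a)//= eqxx scale1r big1 ?addr0// => b /andP[_ /negbTE ->].
  by rewrite scale0r.
Unshelve. all: by end_near. Qed.

(** * Geometry near a facet *)

Section facet.
Variables (e : simplex) (nu : 'rV[R]_n.+1).
Hypotheses (ce : #|e| = n.+1) (nu1 : dotv nu nu = 1)
  (nue : forall a b, a \in e -> b \in e -> dotv nu (vertex a - vertex b) = 0).

Lemma facet_nonempty : exists a, a \in e.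
Proof. by apply/finset.set0Pn; rewrite -cards_eq0 ce. Qed.

Lemma facet_center : @hull _ _ T e (barycenter e).
Proof.
exists (fun=> (#|e|%:R)^-1); split=> [a||//]; first by rewrite invr_ge0.
by rewrite sumr_const -[LHS]mulr_natr mulVf// ce pnatr_eq0.
Qed.

Lemma facet_plane x y : @hull _ _ T e x -> @hull _ _ T e y -> dotv (x - y) nu = 0.
Proof.
have [a0 a0e] := facet_nonempty.
suff h z : @hull _ _ T e z -> dotv z nu = dotv (vertex a0) nu.
  by move=> hx hy; rewrite dotvBl !h// subrr.
move=> [c [_ c1 ->]].
have lin (r : seq 'I_(nverts T)) : dotv (\sum_(a <- r | a \in e) c a *: vertex a) nu =
    \sum_(a <- r | a \in e) c a * dotv (vertex a0) nu.
  elim: r => [|a r IH]; first by rewrite !big_nil dotv0l.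
  rewrite !big_cons; case: ifPn => // ae; rewrite dotvDl dotvZl IH; congr (_ * _ + _).
  by apply/eqP; rewrite -subr_eq0 -dotvBl dotvC nue.
by rewrite lin -big_distrl/= c1 mul1r.
Qed.

(** The coordinate of the opposite vertex [a1] and the signed distance to the plane of the facet are
    affine functions with the same zero set, hence proportional. *)
Lemma facet_side K al be a1 : K \in elements T -> e \subset K -> a1 \in K -> a1 \notin e ->
  @is_barycentric R n T K al be ->
  exists2 g, g != 0 & forall x, al a1 + dotv x (be a1) = g * dotv (x - barycenter e) nu.
Proof.
move=> KT eK a1K a1e bary; have [b1 b2 b3] := bary.
have [a0 a0e] := facet_nonempty.
have KE : K = (a1 |: e)%SET.
  apply/eqP; rewrite eq_sym eqEcard finset.subUset finset.sub1set a1K eK/=.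
  by rewrite cardsU1 a1e ce (element_card KT).
pose c := barycenter e; pose el a y := dotv y (be a).
have elc x a : al a + dotv x (be a) = al a + dotv c (be a) + el a (x - c).
  by rewrite /el dotvBl; ring.
have e0 : e != finset.set0 by apply/finset.set0Pn; exists a0.
have sel y : \sum_(a in K) el a y = 0.
  have := b1 (c + y); under eq_bigr do rewrite dotvDl addrA.
  by rewrite big_split/= b1 => /eqP; rewrite -subr_eq0 addrAC subrr add0r => /eqP.
have vel y : \sum_(a in K) el a y *: vertex a = y.
  have := b2 (c + y); under eq_bigr do rewrite dotvDl addrA scalerDl.
  by rewrite big_split/= b2 => /addrI.
pose B := dotv (vertex a1 - vertex a0) nu.
(* The linear parts of the coordinates sum to zero, so [vertex a0] may be subtracted from every
   vertex; then only the term of [a1] has a normal component. *)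
have key y : dotv y nu = el a1 y * B.
  have : y - \sum_(a in K) el a y *: vertex a0 = y.
    by rewrite -scaler_suml sel scale0r subr0.
  rewrite -{1}(vel y) -sumrB => yE.
  rewrite -{1}yE KE big_setU1//= -scalerBr dotvDl dotvZl -/B.
  rewrite (_ : dotv _ nu = 0) ?addr0//.
  have lin (r : seq 'I_(nverts T)) :
      dotv (\sum_(a <- r | a \in e) (el a y *: vertex a - el a y *: vertex a0)) nu = 0.
    elim: r => [|a r IH]; first by rewrite !big_nil dotv0l.
    rewrite !big_cons; case: ifPn => // ae.
    by rewrite dotvDl -scalerBr dotvZl IH addr0 dotvC nue// mulr0.
  exact: lin.
have B0 : B != 0.
  by apply/eqP => B0; have := key nu; rewrite B0 mulr0 nu1 => /eqP; rewrite oner_eq0.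
exists B^-1; first by rewrite invr_neq0.
move=> x; rewrite elc (lam_center bary)// (negbTE a1e) mul0r add0r.
by rewrite key mulrC mulfK.
Qed.

(** At the barycentre of the facet its own coordinates equal [1 / n.+1], and by the gradient bound
    they change by at most that much in the ball; only the coordinate of the opposite vertex can
    become negative. *)
Lemma facet_half_ball K al be a1 g z r : K \in elements T -> e \subset K -> a1 \in K -> a1 \notin e ->
  @is_barycentric R n T K al be ->
  (forall x, al a1 + dotv x (be a1) = g * dotv (x - barycenter e) nu) ->
  0 < r -> (forall x, enorm (x - z) <= r -> @hull _ _ T K x) ->
  forall x, enorm (x - barycenter e) <= r / n.+1%:R -> 0 <= g * dotv (x - barycenter e) nu ->
    @hull _ _ T K x.
Proof.
move=> KT eK a1K a1e bary hg r0 hz x xr gx; apply/(hull_barycentric bary) => a aK.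
have [->|aa1] := eqVneq a a1; first by rewrite hg.
have ae : a \in e.
  have KE : K = (a1 |: e)%SET.
    apply/eqP; rewrite eq_sym eqEcard finset.subUset finset.sub1set a1K eK/=.
    by rewrite cardsU1 a1e ce (element_card KT).
  by move: aK; rewrite KE in_setU1 (negbTE aa1).
have e0 : e != finset.set0 by apply/finset.set0Pn; exists a.
have -> : al a + dotv x (be a) = (al a + dotv (barycenter e) (be a)) + dotv (x - barycenter e) (be a).
  by rewrite dotvBl; ring.
rewrite (lam_center bary)// ae mul1r ce.
have : `|dotv (x - barycenter e) (be a)| <= r / n.+1%:R * r^-1.
  apply: le_trans (dotv_enorm _ _) _; rewrite ler_pM ?enorm_ge0//.
  exact: (barycentric_gradient bary r0 hz).
have -> : r / n.+1%:R / r = n.+1%:R^-1 by rewrite mulrAC divff ?gt_eqF// mul1r.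
by rewrite ler_norml => /andP[h _]; rewrite -lerBlDl sub0r.
Qed.

(** If the two neighbours lay on the same side, a point off the plane would belong to both, hence to
    the hull of [K1 :&: K2 = e], which is contained in the plane. The sign [sg] orients the normal
    towards [K1]. *)
Lemma facet_patch K1 K2 z1 r1 z2 r2 r : K1 \in elements T -> K2 \in elements T -> K1 != K2 ->
  e \subset K1 -> e \subset K2 ->
  0 < r1 -> (forall x, enorm (x - z1) <= r1 -> @hull _ _ T K1 x) ->
  0 < r2 -> (forall x, enorm (x - z2) <= r2 -> @hull _ _ T K2 x) ->
  0 < r -> r <= r1 / n.+1%:R -> r <= r2 / n.+1%:R ->
  exists sg : R, sg ^+ 2 = 1 /\
   forall x, enorm (x - barycenter e) <= r ->
    (0 <= sg * dotv (x - barycenter e) nu -> @hull _ _ T K1 x) /\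
    (sg * dotv (x - barycenter e) nu <= 0 -> @hull _ _ T K2 x).
Proof.
move=> KT1 KT2 K12 eK1 eK2 r10 h1 r20 h2 r0 rr1 rr2.
have pick K : K \in elements T -> e \subset K -> exists2 a, a \in K & a \notin e.
  move=> KT eK; apply/subsetPn; apply/negP => Ke.
  by have := subset_leq_card Ke; rewrite ce (element_card KT) ltnn.
have [a1 a1K a1e] := pick _ KT1 eK1; have [a2 a2K a2e] := pick _ KT2 eK2.
have [al1 [be1 bary1]] := element_barycentric KT1.
have [al2 [be2 bary2]] := element_barycentric KT2.
have [g1 g10 hg1] := facet_side KT1 eK1 a1K a1e bary1.
have [g2 g20 hg2] := facet_side KT2 eK2 a2K a2e bary2.
have hb1 := facet_half_ball KT1 eK1 a1K a1e bary1 hg1 r10 h1.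
have hb2 := facet_half_ball KT2 eK2 a2K a2e bary2 hg2 r20 h2.
have opp : g1 * g2 < 0.
  rewrite ltNge; apply/negP => g12.
  have K12e : K1 :&: K2 = e.
    apply/eqP; rewrite eq_sym eqEcard finset.subsetI eK1 eK2/= ce leqNgt; apply/negP => c12.
    have c1 := element_card KT1; have c2 := element_card KT2.
    have /eqP E1 : K1 :&: K2 == K1 by rewrite eqEcard finset.subsetIl c1.
    have /eqP E2 : K1 :&: K2 == K2 by rewrite eqEcard finset.subsetIr c2.
    by move: K12; rewrite -E1 E2 eqxx.
  (* The point at distance [r] from the plane on the side of [K1], and under the assumption
     [0 <= g1 * g2] also on the side of [K2]. *)
  pose x := barycenter e + (r * Num.sg g1) *: nu.
  have xc : x - barycenter e = (r * Num.sg g1) *: nu by rewrite /x addrAC subrr add0r.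
  have enu : enorm nu = 1 by rewrite /enorm nu1 sqrtr1.
  have ex : enorm (x - barycenter e) <= r.
    by rewrite xc enormZ enu mulr1 normrM (gtr0_norm r0) normr_sg g10 mulr1.
  have s1 : dotv (x - barycenter e) nu = r * Num.sg g1 by rewrite xc dotvZl nu1 mulr1.
  have hx1 : @hull _ _ T K1 x.
    apply: hb1; first exact: le_trans ex rr1.
    by rewrite s1 mulrCA mulr_ge0 ?(ltW r0)// mulrC -normrEsg.
  have hx2 : @hull _ _ T K2 x.
    apply: hb2; first exact: le_trans ex rr2.
    rewrite s1 mulrCA mulr_ge0 ?(ltW r0)//; move: g12.
    by rewrite {1}[g1]numEsg mulrC mulrA mulrC pmulr_rge0 ?normr_gt0.
  have hx : @hull _ _ T e x.
    by rewrite -K12e; case: pT => _ _ <-//.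
  have := facet_plane hx facet_center; rewrite s1 => /eqP.
  by rewrite mulf_eq0 gt_eqF//= sgr_eq0 (negbTE g10).
exists (Num.sg g1); split; first by rewrite sqr_sg g10.
move=> x xr; split => hs.
  apply: hb1; first exact: le_trans xr rr1.
  by rewrite [g1]numEsg -mulrA mulrCA mulr_ge0.
apply: hb2; first exact: le_trans xr rr2.
have sg2 : Num.sg g2 = - Num.sg g1.
  have : Num.sg g1 * Num.sg g2 = -1 by rewrite -sgrM ltr0_sg.
  have [g1p|g1n|g1z] := sgrP g1.
  - by rewrite g1p eqxx in g10.
  - by rewrite mul1r.
  - by rewrite mulN1r opprK => /oppr_inj.
rewrite (_ : g2 * _ = `|g2| * (- (Num.sg g1 * dotv (x - barycenter e) nu))).
  by rewrite mulr_ge0// oppr_ge0.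
by rewrite {1}[g2]numEsg sg2; ring.
Qed.

End facet.
End partitions.

(** * Open subsets of the closure of a Lipschitz domain *)

Section boundary.
Context {R : realType} {n : nat}.
Implicit Types (Omega U : set 'rV[R]_n.+1).

Lemma continuous_rowP (V : topologicalType) m (A : V -> 'rV[R]_m) x :
  (forall j, {for x, continuous (fun y => A y 0 j)}) -> {for x, continuous A}.
Proof.
move=> cA; apply/cvg_ballP => e e0.
have : \forall y \near x, forall j, ball (A x 0 j) e (A y 0 j).
  apply: (@filter_forall _ _ (fun j y => ball (A x 0 j) e (A y 0 j)) (nbhs x)) => j.
  by have /cvg_ballP/(_ _ e0) := cA j.
by apply: filterS => y h; split=> // i j; rewrite !ord1.
Qed.

Lemma continuous_affine_row m (A : 'rV[R]_n.+1 -> 'rV[R]_m) :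
  (forall j, smooth (fun y => A y 0 j)) -> continuous A.
Proof. by move=> sA x; apply: continuous_rowP => j; exact: smooth_continuous. Qed.

Lemma lipschitz_continuous_rV m (phi : 'rV[R]_m -> R) : lipschitz phi -> continuous phi.
Proof.
move=> [M0 [_ hM]]; pose M : R := `|M0| + 1.
suff h (x : 'rV[R]_m) : phi y @[y --> x] --> phi x by move=> x; exact: h.
have M0M : M0 < M by rewrite /M ltr_pwDr// ler_norm.
have hL y : `|phi x - phi y| <= M * `|x - y| by exact: (hM M M0M (x, y)).
have Mgt0 : 0 < M by rewrite /M ltr_wpDl.
apply/(@cvgrPdist_lt _ _ _ (nbhs x) (nbhs_filter x)) => e e0.
have : \forall y \near x, `|x - y| < e / M.
  by apply/nbhs_ballP; exists (e / M); [exact: divr_gt0|move=> y; rewrite mx_norm_ball].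
apply: filterS => y xy; apply: le_lt_trans (hL y) _.
by rewrite mulrC -ltr_pdivlMr.
Qed.

(* Near a boundary point the domain lies strictly on one side of a graph. *)
Lemma open_closure_subset Omega U : lipschitz_boundary Omega -> open U ->
  U `<=` closure Omega -> U `<=` Omega.
Proof.
move=> lO oU UO x Ux; apply: contrapT => nOx.
have [|Q [phi [QQ lphi nx]]] := lO x; first by split=> //; exact: UO.
have cphi := lipschitz_continuous_rV lphi.
pose z (y : 'rV[R]_n.+1) := (y - x) *m Q.
pose g y := phi (col' ord0 (z y)) - z y 0 ord0.
have sz j : smooth (fun y => z y 0 j).
  rewrite /z; under eq_fun do rewrite mxE.
  apply: smooth_sum => k _; apply: smoothM; last exact: smooth_cst.
  by under eq_fun do rewrite !mxE; apply: smoothB; [exact: smooth_coord|exact: smooth_cst].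
have cg : continuous g.
  move=> y; apply: (@continuousB _ _ _ (fun y => phi (col' ord0 (z y))) (fun y => z y 0 ord0) y).
    apply: (@continuous_comp _ _ _ (fun y => col' ord0 (z y)) phi); last exact: cphi.
    apply: continuous_rowP => j.
    rewrite (_ : (fun y => col' ord0 (z y) 0 j) = (fun y => z y 0 (lift ord0 j))); last first.
      by apply/funext => y'; rewrite mxE.
    exact: smooth_continuous.
  exact: smooth_continuous.
have zx : z x = 0 by rewrite /z subrr mul0mx.
have phi0 : 0 <= phi 0.
  rewrite leNgt; apply/negP => h; apply: nOx; apply/(nbhs_singleton nx) => /=.
  by rewrite -/(z x) zx mxE (_ : col' ord0 0 = 0)//; apply/rowP => j; rewrite !mxE.
(* In the chart, [- t *: w] moves down by [t]. Since [x] is not in [Omega], the graph passes at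
   height [phi 0 >= 0] there, so the moved point is strictly below it and a whole neighbourhood
   misses [Omega], although the point lies in [U] and so in the closure. *)
pose w : 'rV[R]_n.+1 := delta_mx 0 ord0 *m Q^T.
have zw t : z (x - t *: w) = - t *: delta_mx 0 ord0.
  rewrite /z addrAC subrr add0r -scaleNr -scalemxAl /w -mulmxA.
  by rewrite (mulmx1C QQ) mulmx1.
have cw : (fun t : R => x - t *: w) @ (0 : R)^'+ --> x.
  rewrite -[X in _ --> X]subr0 -(scale0r w); apply: cvgB; first exact: cvg_cst.
  by apply: cvgZr_tmp; exact: cvg_at_right_filter.
have ht1 : \forall t \near (0 : R)^'+, U (x - t *: w).
  by apply: cw; exact: open_nbhs_nbhs.
have ht2 : \forall t \near (0 : R)^'+, \forall y \near x - t *: w, Omega y <-> phi (col' ord0 (z y)) < z y 0 ord0.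
  exact: cw (nbhs_interior nx).
have [t [t0 Ut Ot]] : exists t : R, [/\ 0 < t, U (x - t *: w) &
    \forall y \near x - t *: w, Omega y <-> phi (col' ord0 (z y)) < z y 0 ord0].
  near (0 : R)^'+ => t; exists t; split; near: t; [exact: nbhs_right_gt|exact: ht1|exact: ht2].
have gt0 : 0 < g (x - t *: w).
  rewrite /g zw !mxE !eqxx mulr1 opprK (_ : col' ord0 _ = 0) ?ltr_wpDl//.
  by apply/rowP => j; rewrite !mxE /= mulr0.
have ng : \forall y \near x - t *: w, 0 < g y by have := cg (x - t *: w); move/cvgr_gt => /(_ 0 gt0).
have [y [Oy [h1 h2]]] := UO _ Ut _ (filterI Ot ng).
by move: h2; rewrite /g subr_gt0 => /(lt_trans (h1.1 Oy)); rewrite ltxx.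
Unshelve. all: by end_near. Qed.

End boundary.

(** * Traces on facets and bounds for facet integrals *)

Section traces.
Context {R : realType} {n : nat}.
Variable T : mesh R n.
Local Notation simplex := {set 'I_(nverts T)}.
Implicit Types (s K e : simplex) (x y z : 'rV[R]_n.+1).

(** The segment from [x] to the barycentre runs through the interior, apart from [x] itself. The
    filter must be proper for the limit in [trace_from] to be determined. *)
Lemma element_interior_near K al be x : #|K| = n.+2 -> @is_barycentric R n T K al be ->
  @hull _ _ T K x -> ProperFilter (within (interior (@hull _ _ T K)) (nbhs x)).
Proof.
move=> cK bary hx; split; last exact: within_filter.
suff hA A : within (interior (@hull _ _ T K)) (nbhs x) A -> A !=set0 by move=> /hA[].
move=> xA.
have K0 : K != finset.set0 by rewrite -cards_eq0 cK.
pose c := @barycenter R n T K.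
have hin t : 0 < t -> t <= 1 -> interior (@hull _ _ T K) (x + t *: (c - x)).
  move=> t0 t1; apply: (interior_barycentric bary) => a aK.
  rewrite (lam_line al be) (lam_center bary)// aK mul1r.
  have h1 := (hull_barycentric bary x).1 hx a aK.
  rewrite ltr_wpDl ?mulr_ge0//; first by rewrite subr_ge0.
  by rewrite mulr_gt0// invr_gt0 ltr0n cK.
have cw : (fun t : R => x + t *: (c - x)) @ (0 : R)^'+ --> x.
  rewrite -[X in _ --> X]addr0 -(scale0r (c - x)); apply: cvgD; first exact: cvg_cst.
  by apply: cvgZr_tmp; exact: cvg_at_right_filter.
have ht : \forall t \near (0 : R)^'+, interior (@hull _ _ T K) (x + t *: (c - x)) -> A (x + t *: (c - x)).
  exact: cw xA.
near (0 : R)^'+ => t; exists (x + t *: (c - x)).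
have : interior (@hull _ _ T K) (x + t *: (c - x)) -> A (x + t *: (c - x)) by near: t; exact: ht.
by apply; apply: hin; near: t; [exact: nbhs_right_gt|exact: nbhs_right_le].
Unshelve. all: by end_near. Qed.

Lemma trace_fromE m K al be x (F G : 'rV[R]_n.+1 -> 'rV[R]_m.+1) : #|K| = n.+2 ->
  @is_barycentric R n T K al be -> @hull _ _ T K x -> continuous G ->
  (forall y, interior (@hull _ _ T K) y -> F y = G y) -> @trace_from R n T _ K F x = G x.
Proof.
move=> cK bary hx cG FG; have PF := element_interior_near cK bary hx.
rewrite /trace_from; apply: cvg_lim; first exact: norm_hausdorff.
apply: (@cvg_trans _ (G y @[y --> within (interior (@hull _ _ T K)) (nbhs x)])).
  apply: near_eq_cvg; apply: (@filterE _ (nbhs x)) => y hy.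
  by rewrite FG.
by apply: cvg_trans (cG x); apply: cvg_app; exact: cvg_within.
Unshelve. all: by end_near. Qed.

(** The Gram determinant is bounded by the Leibniz formula, [n!] products of entries of size at most
    [diam ^+ 2], and the unit simplex lies in a cube of side 4. [F] may contain limits, so
    measurability comes from the smooth [G] that agrees with it on the facet. *)
Lemma facet_integral_le e (F G : 'rV[R]_n.+1 -> R) M :
  #|e| = n.+1 -> smooth G -> (forall x, @hull _ _ T e x -> F x = G x /\ 0 <= G x <= M) ->
  @facet_integral R n T e F <= Num.sqrt n`!%:R * 4 ^+ n * diam (@hull _ _ T e) ^+ n * M.
Proof.
move=> ce sG hFM; rewrite /facet_integral.
have FG x : @hull _ _ T e x -> F x = G x by move=> /hFM[].
have hM x : @hull _ _ T e x -> 0 <= G x <= M by move=> /hFM[].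
set a := fun i => nth 0 [seq vertex v | v <- enum e] i.
set A : 'M[R]_(n, n.+1) := \matrix_(i < n) (a i.+1 - a 0%N).
set D := [set t : 'rV[R]_n | (forall i, 0 <= t 0 i) /\ \sum_i t 0 i <= 1].
set h := diam (@hull _ _ T e).
have se : size (enum e) = n.+1 by rewrite -cardE.
have [v0 v0e] : exists v0, v0 \in e by apply/finset.set0Pn; rewrite -cards_eq0 ce.
have aE i : (i < n.+1)%N -> a i = vertex (nth v0 (enum e) i).
  by move=> ie; rewrite /a (nth_map v0)// se.
have ain i : (i < n.+1)%N -> nth v0 (enum e) i \in e.
  by move=> ie; rewrite -mem_enum mem_nth// se.
have hin t : D t -> @hull _ _ T e (a 0%N + t *m A).
  (* Convex coefficients of the parametrised point: the vertex of index 0 is the base point and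
     takes the remaining weight. *)
  move=> [t0 t1]; pose c' (i : 'I_n.+1) := if unlift ord0 i is Some j then t 0 j else 1 - \sum_j t 0 j.
  have idx (i : 'I_n.+1) : index (nth v0 (enum e) i) (enum e) = i.
    by rewrite index_uniq ?enum_uniq// se.
  have reidx (V : nmodType) (F' : 'I_(nverts T) -> V) :
      \sum_(v in e) F' v = \sum_(i < n.+1) F' (nth v0 (enum e) i).
    by rewrite -big_enum/= (big_nth v0) se big_mkord.
  pose c v := c' (inord (index v (enum e))).
  have cE (i : 'I_n.+1) : c (nth v0 (enum e) i) = c' i by rewrite /c idx inord_val.
  have c'0 : c' ord0 = 1 - \sum_j t 0 j by rewrite /c' unlift_none.
  have c'S j : c' (lift ord0 j) = t 0 j by rewrite /c' liftK.
  exists c; split.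
  - move=> v; rewrite /c /c'; case: unlift => [j|]; first exact: t0.
    by rewrite subr_ge0.
  - rewrite reidx; under eq_bigr do rewrite cE.
    rewrite big_ord_recl (eq_bigr _ (fun j _ => c'S j)) c'0.
    by rewrite subrK.
  - rewrite reidx; under eq_bigr do rewrite cE.
    rewrite big_ord_recl c'0; rewrite (eq_bigr (fun j : 'I_n => t 0 j *: vertex (nth v0 (enum e) (lift ord0 j)))) => [|j _]; last by rewrite c'S.
    rewrite -aE//= scalerBl scale1r.
    have -> : t *m A = \sum_(i < n) t 0 i *: vertex (nth v0 (enum e) (lift ord0 i)) - (\sum_j t 0 j) *: a 0%N.
      rewrite scaler_suml -sumrB; apply/rowP => k; rewrite mxE summxE.
      by apply: eq_bigr => i _; rewrite mxE !mxE -aE ?ltnS//= mulrBr.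
    by rewrite -addrA; congr (_ + _); rewrite addrC.
have -> : \int[lebesgue_rV R n]_(t in D) F (a 0%N + t *m A) =
    \int[lebesgue_rV R n]_(t in D) G (a 0%N + t *m A).
  by apply: eq_Rintegral => t; rewrite inE => /hin/FG.
have h0 : 0 <= h by exact: diam_hull_ge0.
have M0 : 0 <= M.
  by have /andP[g0 gM] := hM _ (hull_vertex v0e); exact: le_trans gM.
have detA : \det (A *m A^T) <= n`!%:R * (h ^+ n) ^+ 2.
  have ent i j : `|(A *m A^T) i j| <= h ^+ 2.
    have -> : (A *m A^T) i j = dotv (a i.+1 - a 0%N) (a j.+1 - a 0%N).
      by rewrite !mxE /dotv; apply: eq_bigr => k _; rewrite !mxE.
    apply: le_trans (dotv_enorm _ _) _; rewrite expr2.
    have d k : (k < n.+1)%N -> enorm (a k - a 0%N) <= h.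
      move=> kn; rewrite !aE//; apply: hull_diam; apply: hull_vertex; exact: ain.
    by apply: ler_pM; rewrite ?enorm_ge0// d// ltnS.
  apply: le_trans (ler_norm _) _; apply: le_trans (ler_norm_sum _ _ _) _.
  apply: (@le_trans _ _ (\sum_(s : {perm 'I_n}) (h ^+ 2) ^+ n)).
    apply: ler_sum => s _; rewrite normrM normrX normrN1 expr1n mul1r normr_prod.
    rewrite -[X in _ <= _ ^+ X]card_ord -prodr_const; apply: ler_prod => i _.
    by rewrite normr_ge0 ent.
  by rewrite sumr_const card_Sn exprAC -[leLHS]mulr_natl.
have sA : Num.sqrt (\det (A *m A^T)) <= Num.sqrt n`!%:R * h ^+ n.
  apply: le_trans (ler_wsqrtr detA) _; rewrite sqrtrM// sqrtr_sqr ger0_norm//.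
  by rewrite exprn_ge0.
have sc i : continuous (fun t : 'rV[R]_n => t 0 i) by apply: smooth_continuous; exact: smooth_coord.
have mD : measurable D.
  rewrite (_ : D = (\bigcap_(i in [set: 'I_n]) ((fun t : 'rV[R]_n => t 0 i) @^-1` `[0, +oo[)) `&`
      ((fun t : 'rV[R]_n => \sum_i t 0 i) @^-1` `]-oo, 1])).
    apply: measurableI.
      apply: fin_bigcap_measurable => [|i _]; first exact: finite_finset.
      by apply: measurable_preT; [apply: continuous_measurable_rV; exact: sc|exact: measurable_itv].
    apply: measurable_preT; last exact: measurable_itv.
    apply: continuous_measurable_rV; apply: smooth_continuous; apply: smooth_sum => i _.
    exact: smooth_coord.
  apply/seteqP; split=> t.
    by move=> [t0 t1]; split; [move=> i _ /=; rewrite in_itv/= t0|rewrite /= in_itv].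
  by move=> [t0]; rewrite /= in_itv/= => t1; split=> // i; have := t0 i Logic.I; rewrite /= in_itv/= andbT.
have Dc : D `<=` cube 0 2.
  move=> t [t0 t1] i; rewrite !mxE sub0r add0r.
  have : t 0 i <= \sum_i t 0 i by rewrite (bigD1 i)//= lerDl sumr_ge0.
  by have := t0 i; lra.
have bD : bounded_set D.
  have [N [Nr hN]] := bounded_set_cube (0 : 'rV[R]_n) (2 : R).
  by exists N; split=> // N' NN' t /Dc; exact: hN.
have sGA : smooth (fun t => G (a 0%N + t *m A)).
  apply: (@smooth_comp _ _ _ (fun t => a 0%N + t *m A) G) => // j.
  under eq_fun do rewrite mxE [X in _ + X]mxE.
  apply: smoothD; first exact: smooth_cst.
  by apply: smooth_sum => i _; apply: smoothM; [exact: smooth_coord|exact: smooth_cst].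
have intD : \int[lebesgue_rV R n]_(t in D) G (a 0%N + t *m A) <= M * 4 ^+ n.
  apply: (@le_trans _ _ (\int[lebesgue_rV R n]_(t in D) M)).
    apply: le_Rintegral => //.
    - apply: (@integr_bounded _ _ _ _ M) => //.
        by apply: measurable_funTS; apply: continuous_measurable_rV; exact: smooth_continuous.
      by move=> t /hin/hM/andP[g0 gM]; rewrite ger0_norm.
    - by apply: (@integr_bounded _ _ _ _ M) => // t _; rewrite ger0_norm.
    - by move=> t /hin/hM/andP[].
  rewrite Rintegral_cst// ler_wpM2l// -lee_fin fineK; last first.
    by rewrite ge0_fin_numE// lebesgue_bounded.
  rewrite (_ : 4 = 2 * 2 :> R); last by ring.
  by rewrite -(@lebesgue_cube R n 0 2)//; apply: le_measure; rewrite ?inE//; exact: measurable_box.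
have int0 : 0 <= \int[lebesgue_rV R n]_(t in D) G (a 0%N + t *m A).
  by apply: Rintegral_ge0 => t /hin/hM/andP[].
apply: (@le_trans _ _ (Num.sqrt n`!%:R * h ^+ n * (M * 4 ^+ n))).
  by apply: ler_pM => //; exact: sqrtr_ge0.
by rewrite le_eqVlt; apply/orP; left; apply/eqP; ring.
Qed.

End traces.

(** * The curl tensor *)

Section tensor.
Variable R : realType.

Lemma sum_delta2 p q (i0 : 'I_p) (j0 : 'I_q) (F : 'I_p -> 'I_q -> R) :
  \sum_i \sum_j ((i == i0) && (j == j0))%:R * F i j = F i0 j0.
Proof.
rewrite (bigD1 i0)//= (bigD1 j0)//= !eqxx mul1r !big1 ?addr0// => [i /negbTE ->|j /negbTE ->].
  by rewrite big1// => j _; rewrite mul0r.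
by rewrite andbF mul0r.
Qed.

(* The operators of both dimensions in one form; [E] is the Levi-Civita tensor if
   [d = Three]. *)
Definition is_curl_tensor d (E : 'I_(rot_dim d) -> 'I_(space_dim d) -> 'I_(space_dim d) -> R) : Prop :=
  [/\ forall j a b, `|E j a b| <= 1,
      forall j a b, E j a b = - E j b a,
      forall (D : derivation R (space_dim d)) v x j,
        curl D v x 0 j = \sum_a \sum_b E j a b * D a (fun y => v y 0 b) x,
      forall (D : derivation R (space_dim d)) w x b,
        curl_rot D w x 0 b = - \sum_j \sum_a E j a b * D a (fun y => w y 0 j) x &
      forall w nu b, cross_rot w nu 0 b = \sum_j \sum_a E j a b * (w 0 j * nu 0 a)].

Lemma curl_tensor d : exists E, @is_curl_tensor d E.
Proof.
have bB (b1 b2 : bool) : `|b1%:R - b2%:R| <= 1 :> R.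
  by case: b1; case: b2; rewrite ?subrr ?subr0 ?sub0r ?normrN ?normr0 ?normr1.
case: d.
- pose E (_ : 'I_1) (a b : 'I_2) : R := ((a == 0) && (b == 1))%:R - ((a == 1) && (b == 0))%:R.
  exists E; split=> [j a b|j a b|D v x j|D w x b|w nu b].
  + exact: bB.
  + by rewrite /E opprB; congr (_%:R - _%:R); rewrite andbC.
  + rewrite /curl mxE.
    under eq_bigr do under eq_bigr do rewrite mulrBl.
    by under eq_bigr do rewrite sumrB; rewrite sumrB !sum_delta2.
  + rewrite /= mxE big_ord_recl big_ord0 addr0 !big_ord_recl big_ord0 addr0 /E/=.
    rewrite (_ : lift ord0 ord0 = 1); last exact/val_inj.
    have [->|->] : b = 0 \/ b = 1 by case: b => -[|[|//]] ?; [left|right]; exact/val_inj.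
      by rewrite eqxx (_ : (0 == 1 :> 'I_2) = false)// subr0 mul0r add0r sub0r mulN1r opprK.
    by rewrite eqxx (_ : (1 == 0 :> 'I_2) = false)// subr0 mul1r subrr mul0r addr0.
  + rewrite /= mxE big_ord_recl big_ord0 addr0 !big_ord_recl big_ord0 addr0 /E/=.
    rewrite (_ : lift ord0 ord0 = 1); last exact/val_inj.
    have [->|->] : b = 0 \/ b = 1 by case: b => -[|[|//]] ?; [left|right]; exact/val_inj.
      by rewrite eqxx (_ : (0 == 1 :> 'I_2) = false)// subr0 mul0r add0r sub0r mulN1r.
    by rewrite eqxx (_ : (1 == 0 :> 'I_2) = false)// subr0 mul1r subrr mul0r addr0.
- pose E (j a b : 'I_3) : R := ((a == j + 1) && (b == j + 2))%:R - ((a == j + 2) && (b == j + 1))%:R.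
  (* Cyclic symmetry of the Levi-Civita tensor; indices are added modulo 3, so there are finitely
     many cases. *)
  have e1 (a b j : 'I_3) : (a == j + 1) && (b == j + 2) = (j == b + 1) && (a == b + 2).
    by case: a => -[|[|[|//]]] ?; case: b => -[|[|[|//]]] ?; case: j => -[|[|[|//]]] ?.
  have e2 (a b j : 'I_3) : (a == j + 2) && (b == j + 1) = (j == b + 2) && (a == b + 1).
    by case: a => -[|[|[|//]]] ?; case: b => -[|[|[|//]]] ?; case: j => -[|[|[|//]]] ?.
  exists E; split=> [j a b|j a b|D v x j|D w x b|w nu b].
  + exact: bB.
  + by rewrite /E opprB; congr (_%:R - _%:R); rewrite andbC.
  + rewrite /= mxE /E.
    under eq_bigr do under eq_bigr do rewrite mulrBl.
    by under eq_bigr do rewrite sumrB; rewrite sumrB !sum_delta2.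
  + rewrite /= mxE /E.
    under [in RHS]eq_bigr do under eq_bigr do rewrite e1 e2 mulrBl.
    under [in RHS]eq_bigr do rewrite sumrB.
    by rewrite sumrB (sum_delta2 (b + 1) (b + 2) (fun j a => D a (fun y => w y 0 j) x)) (sum_delta2 (b + 2) (b + 1) (fun j a => D a (fun y => w y 0 j) x)) opprB.
  + rewrite /= mxE /E.
    under [in RHS]eq_bigr do under eq_bigr do rewrite e1 e2 mulrBl.
    under [in RHS]eq_bigr do rewrite sumrB.
    by rewrite sumrB (sum_delta2 (b + 1) (b + 2) (fun j a => w 0 j * nu 0 a)) (sum_delta2 (b + 2) (b + 1) (fun j a => w 0 j * nu 0 a)).
Qed.

End tensor.

(** * Jumps across a hyperplane *)
Section hyperplane.
Context {R : realType} {n : nat}.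
Local Notation leb := (lebesgue_rV R n).
Variables (c nu : 'rV[R]_n).
Hypothesis nu1 : dotv nu nu = 1.
Implicit Types (S U : set 'rV[R]_n) (f g phi psi : 'rV[R]_n -> R).

Let s x : R := dotv (x - c) nu.
Local Notation H := (halfspace c nu).
Definition above : set 'rV[R]_n := [set x | 0 < dotv (x - c) nu].
Definition below : set 'rV[R]_n := [set x | dotv (x - c) nu < 0].
Definition hyperplane : set 'rV[R]_n := [set x | dotv (x - c) nu = 0].

Let smooth_s : smooth s.
Proof.
apply: smooth_sum => i _; apply: smoothM; last exact: smooth_cst.
by under eq_fun do rewrite !mxE; apply: smoothD; [exact: smooth_coord|exact: smooth_cst].
Qed.

Let ms : measurable_fun setT s.
Proof. by apply: continuous_measurable_rV; exact: smooth_continuous. Qed.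

Lemma measurable_above : measurable above.
Proof.
rewrite (_ : above = s @^-1` `]0, +oo[); first exact: measurable_preT.
by apply/seteqP; split=> x /=; rewrite in_itv/= andbT.
Qed.

Lemma measurable_below : measurable below.
Proof.
rewrite (_ : below = s @^-1` `]-oo, 0[); first exact: measurable_preT.
by apply/seteqP; split=> x /=; rewrite in_itv/=.
Qed.

Lemma measurable_hyperplane : measurable hyperplane.
Proof.
rewrite (_ : hyperplane = s @^-1` [set 0]); first exact: measurable_preT.
by apply/seteqP; split=> x.
Qed.

Lemma int_setU2 (A B : set 'rV[R]_n) f : measurable A -> measurable B -> A `&` B = set0 ->
  integr (A `|` B) f -> \int[leb]_(x in A `|` B) f x = \int[leb]_(x in A) f x + \int[leb]_(x in B) f x.
Proof. by move=> mA mB AB fi; rewrite Rintegral_setU//; apply/disj_set2P. Qed.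

(* Apply [int_derive_normal] to [s * g] on both sides of the hyperplane. *)
Lemma int_hyperplane g K : smooth g -> compact K -> (forall x, ~ K x -> g x = 0) ->
  \int[leb]_(x in hyperplane) g x = 0.
Proof.
move=> sg cK gK; pose f x := s x * g x.
have sf : smooth f by exact: smoothM.
have fK x : ~ K x -> f x = 0 by move=> h; rewrite /f gK// mulr0.
have mH := measurable_halfspace c nu.
have mHC : measurable (~` H) by exact: measurableC.
have fi : integr setT (fun x => 'D_nu f x).
  apply: (cpt_integr cK); first by apply: smooth_continuous; exact: smooth_derive.
  by move=> x; exact: cpt_derive_out cK fK _ _.
have i1 : \int[leb]_(x in H) 'D_nu f x = 0.
  by apply: (int_derive_normal sf cK fK nu1) => x sx; rewrite /f /s sx mul0r.
have i2 : \int[leb]_(x in halfspace c (- nu)) 'D_nu f x = 0.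
  have n1 : dotv (- nu) (- nu) = 1 by rewrite dotvNl dotvC dotvNl opprK.
  have := int_derive_normal sf cK fK n1 (c := c).
  have -> : (fun x => 'D_(- nu) f x) = (fun x => - 'D_nu f x).
    apply/funext => x; have df : differentiable f x by exact: smooth_diff.
    rewrite !derive_partial// -sumrN; apply: eq_bigr => i _.
    by rewrite mxE mulNr.
  rewrite RintegralN; [|exact: measurable_halfspace|].
    move=> h; apply/eqP; rewrite -oppr_eq0; apply/eqP; apply: h => x.
    by rewrite dotvC dotvNl dotvC => /eqP; rewrite oppr_eq0 => /eqP sx; rewrite /f /s sx mul0r.
  by apply: (@integrS _ _ _ setT) => //; exact: measurable_halfspace.
have i3 := int_derive_setT sf cK fK nu.
have HU : H `|` ~` H = setT by rewrite setUv.
have nE y : dotv y (- nu) = - dotv y nu by rewrite dotvC dotvNl dotvC.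
(* The two closed half-spaces overlap exactly in the hyperplane, so the integral over it is what
   their integrals exceed the total by; all three are zero. *)
have HN : ~` H `|` hyperplane = halfspace c (- nu).
  apply/seteqP; split=> x; rewrite /halfspace /hyperplane/= nE oppr_ge0.
    by case=> [/negP|->//]; rewrite -ltNge => /ltW.
  by rewrite le_eqVlt => /predU1P[->|h]; [right|left; apply/negP; rewrite -ltNge].
have i4 : \int[leb]_(x in ~` H) 'D_nu f x = 0.
  by move: i3; rewrite -HU int_setU2 ?setICr//; [rewrite i1 add0r|rewrite HU].
move: i2; rewrite -HN int_setU2//; last 3 first.
- exact: measurable_hyperplane.
- by apply/seteqP; split=> // x [h1 h2]; apply: h1; rewrite /halfspace /= h2.
- apply: (@integrS _ _ _ setT) => //; apply: measurableU => //; exact: measurable_hyperplane.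
rewrite i4 add0r => <-; apply: eq_Rintegral => x; rewrite inE => sx.
(* On the hyperplane [s] vanishes and has normal derivative 1, so the normal derivative of [s * g]
   is [g] there. *)
have ds : is_derive x nu s 1.
  apply: is_derive_line => h; rewrite /s -dotvBl opprB addrA subrK addrK dotvZl nu1.
  by rewrite mulr1.
rewrite /f deriveM; [|by have [] := ds|by apply: diff_derivable; exact: smooth_diff].
by have [_ ->] := ds; rewrite /s sx scale0r add0r /GRing.scale/= mulr1.
Qed.

(** A bump so wide that [S] lies within three quarters of its radius is bounded below on [S], while
    its integral over the hyperplane is zero. *)
Lemma null_hyperplane S : measurable S -> bounded_set S -> S `<=` hyperplane -> leb S = 0%E.
Proof.
move=> mS bS SH; have [r r0 Sr] := bounded_cube bS.
pose rho : R := 2 * (n%:R * r + 1).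
have nr0 : 0 <= n%:R * r by rewrite mulr_ge0// ltW.
have rho0 : 0 < rho by rewrite /rho mulr_gt0// ltr_wpDl.
have sb := @smooth_bump R n 0 rho.
pose K : set 'rV[R]_n := closed_box (const_mx (- rho)) (const_mx rho).
have bK x : ~ K x -> rbump 0 rho x = 0.
  move=> /existsNP[i]; rewrite in_itv/= !mxE => /negP h; apply: bump_out => //; rewrite subr0.
  apply: le_trans (coord_enorm x i); rewrite leNgt; apply: contra h => h.
  by rewrite -ler_norml ltW.
have cK : compact K by exact: compact_closed_box.
have := int_hyperplane sb cK bK.
have bi : integr setT (rbump 0 rho) := cpt_integr cK (smooth_continuous sb) bK.
have mh := measurable_hyperplane.
have -> : hyperplane = S `|` (hyperplane `\` S).
  by rewrite setDUK.
have mD : measurable (hyperplane `\` S) by exact: measurableD.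
rewrite int_setU2//; last 2 first.
- by rewrite setIDA setIidl// setDv.
- by apply: (@integrS _ _ _ setT) => //; exact: measurableU.
have p1 : 0 <= \int[leb]_(x in hyperplane `\` S) rbump 0 rho x by apply: Rintegral_ge0 => x _; exact: bump_ge0.
have k0 : 0 < expR (- (16 / 7)) :> R by exact: expR_gt0.
have p2 : expR (- (16 / 7)) * fine (leb S) <= \int[leb]_(x in S) rbump 0 rho x.
  rewrite -Rintegral_cst//; apply: le_Rintegral => //.
  - by apply: (@integr_bounded _ _ _ _ (expR (- (16 / 7)))) => // x _; rewrite ger0_norm// ltW.
  - exact: (@integrS _ _ _ setT).
  - move=> x /Sr xr; apply: bump_lower => //; rewrite subr0.
    apply: (@le_trans _ _ (n%:R * r)); last by rewrite /rho; lra.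
    apply: enorm_coord => [|i]; first exact: ltW.
    by have := xr i; rewrite !mxE sub0r add0r ler_norml => /andP[/ltW -> /ltW ->].
move=> tot; have f0 : 0 <= fine (leb S) by exact: fine_ge0.
have fin : leb S \is a fin_num by rewrite ge0_fin_numE// lebesgue_bounded.
rewrite -(fineK fin); congr (_%:E); apply/eqP; rewrite eq_le f0 andbT.
rewrite -(pmulr_rle0 _ k0); lra.
Qed.

Lemma int_above_below S f : measurable S -> bounded_set S -> integr S f ->
  \int[leb]_(x in S) f x = \int[leb]_(x in S `&` above) f x + \int[leb]_(x in S `&` below) f x.
Proof.
move=> mS bS fi.
have ma := measurable_above; have mb := measurable_below; have mh := measurable_hyperplane.
have mSa : measurable (S `&` above) by exact: measurableI.
have mSb : measurable (S `&` below) by exact: measurableI.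
have mSh : measurable (S `&` hyperplane) by exact: measurableI.
have E : S = (S `&` above `|` S `&` below) `|` (S `&` hyperplane).
  apply/seteqP; split=> x; last by move=> [[[]|[]]|[]].
  move=> Sx; rewrite /above /below /hyperplane /=.
  by have [h|h|h] := ltgtP 0 (dotv (x - c) nu); [left; left|left; right|right].
rewrite {1}E int_setU2//; [|exact: measurableU| |by rewrite -E]; last first.
  apply/seteqP; split=> // x [[[_ h]|[_ h]] [_]]; move: h; rewrite /above /below /hyperplane/= => + h;
    by rewrite h ltxx.
rewrite int_setU2//; last 2 first.
- apply/seteqP; split=> // x [[_ h] [_]]; rewrite /below/= => h'.
  by move: (lt_trans h h'); rewrite ltxx.
- apply: (@integrS _ _ _ S) => //; first exact: measurableU.
  by rewrite subUset; split=> x [].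
rewrite [X in _ + X](_ : _ = 0) ?addr0// /Rintegral null_set_integral//.
- apply/measurable_EFinP; apply: (measurable_funS mS) => [x []//|].
  exact: integr_measurable.
- apply: null_hyperplane; [exact: mSh| |by move=> x []].
  by case: bS => N [Nr hN]; exists N; split=> // N' NN' x [Sx _]; exact: hN.
Qed.

(** The coordinate direction is split into [nu 0 a *: nu] and a tangent part, which contributes
    nothing. Exchanging [above] for the closed half-space is harmless since the hyperplane is
    null. *)
Lemma int_above_partial U psi a : open U -> bounded_set U -> test_function U psi ->
  \int[leb]_(x in U `&` above) partial a psi x = nu 0 a * \int[leb]_(x in H) 'D_nu psi x.
Proof.
move=> oU bU tpsi; have mU := open_measurable_rV oU; have [sp [K [cK KU pK]]] := tpsi.
have mH := measurable_halfspace c nu.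
have pi v : integr H (fun x => 'D_v psi x).
  apply: (@integrS _ _ _ setT) => //; apply: (cpt_integr cK).
    by apply: smooth_continuous; exact: smooth_derive.
  by move=> x; exact: cpt_derive_out.
have ma := measurable_above.
have bUH : bounded_set (U `&` H).
  by case: bU => N [Nr hN]; exists N; split=> // N' NN' x [Ux _]; exact: hN.
have -> : \int[leb]_(x in U `&` above) partial a psi x = \int[leb]_(x in H) partial a psi x.
  rewrite [RHS](@Rintegral_subset _ _ (U `&` H)); last 2 first.
  - by move=> x [].
  - move=> x Hx nUH; apply: (test_function_out (test_function_partial a tpsi)) => Ux.
    by apply: nUH.
  rewrite [RHS]int_above_below//; last 2 first.
  - exact: measurableI.
  - by apply: (integrS mH _ _ (pi (delta_mx 0 a))); [exact: measurableI|move=> x []].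
  rewrite [X in _ + X](_ : _ = 0) ?addr0.
    rewrite -setIA (_ : H `&` above = above)//; apply/setIidPr => x.
    by rewrite /above /halfspace/= => /ltW.
  rewrite (_ : _ `&` below = set0) ?Rintegral_set0//.
  by apply/seteqP; split=> // x [[_ h]]; rewrite /below/= ltNge => /negP; apply.
pose tau := delta_mx 0 a - nu 0 a *: nu.
have tn : dotv tau nu = 0.
  rewrite /tau dotvBl dotvZl nu1 mulr1 /dotv (bigD1 a)//= mxE !eqxx mul1r big1 ?addr0 ?subrr//.
  by move=> i /negbTE ia; rewrite mxE ia andbF mul0r.
have := int_derive_tangent sp cK pK c tn.
have -> : (fun x => 'D_tau psi x) = (fun x => partial a psi x - nu 0 a * 'D_nu psi x).
  apply/funext => x; have dp : differentiable psi x by exact: smooth_diff.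
  have h : partial a psi x = \sum_i (delta_mx 0 a : 'rV[R]_n) 0 i * partial i psi x by exact: derive_partial.
  rewrite derive_partial// [X in _ = _ - _ * X]derive_partial// h big_distrr/=.
  by rewrite -sumrB; apply: eq_bigr => i _; rewrite /tau !mxE; ring.
rewrite RintegralB//; last 2 first.
- exact: pi.
- by apply: integrZ.
by rewrite (RintegralZl _ mH (pi nu)) => /eqP; rewrite subr_eq0 => /eqP.
Qed.

Lemma int_below_partial U psi a : open U -> bounded_set U -> test_function U psi ->
  \int[leb]_(x in U `&` below) partial a psi x = - (nu 0 a * \int[leb]_(x in H) 'D_nu psi x).
Proof.
move=> oU bU tpsi; have mU := open_measurable_rV oU.
have := test_function_int_partial a mU tpsi.
rewrite int_above_below//.
  by rewrite (int_above_partial a oU bU tpsi) => /eqP; rewrite addrC addr_eq0 => /eqP.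
have [sp [K [cK KU pK]]] := tpsi.
apply: (@integrS _ _ _ setT) => //; apply: (cpt_integr cK).
  by apply: smooth_continuous; exact: smooth_derive.
by move=> x; exact: cpt_derive_out.
Qed.

(** Joins the two one-sided gradients. On the hyperplane, a null set, the choice of [f] is
    immaterial. *)
Definition hglue f g : 'rV[R]_n -> R := fun x => \1_H x * f x + (1 - \1_H x) * g x.

Lemma hglue_above f g x : above x -> hglue f g x = f x.
Proof. by move=> h; rewrite /hglue indicE mem_set/= ?mul1r ?subrr ?mul0r ?addr0//; exact: ltW. Qed.

Lemma hglue_below f g x : below x -> hglue f g x = g x.
Proof.
move=> h; rewrite /hglue indicE memNset/= ?mul0r ?subr0 ?mul1r ?add0r//.
by apply/negP; rewrite -ltNge.
Qed.

Lemma L2_hglue S f g : measurable S -> bounded_set S -> continuous f -> continuous g -> L2 S (hglue f g).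
Proof.
move=> mS bS cf cg; have [M M0 fM] := continuous_bounded cf bS; have [N N0 gN] := continuous_bounded cg bS.
have mi : measurable_fun setT (\1_H : 'rV[R]_n -> R) by apply: measurable_indic; exact: measurable_halfspace.
apply: (@L2_bounded _ _ _ _ (M + N)) => //.
  apply: measurable_funTS; apply: measurable_funD; apply: measurable_funM => //;
    try exact: continuous_measurable_rV.
  by apply: measurable_funB.
move=> x Sx; rewrite /hglue indicE; case: (_ \in _) => /=.
  by rewrite mul1r subrr mul0r addr0 (le_trans (fM _ Sx))// lerDl.
by rewrite mul0r subr0 mul1r add0r (le_trans (gN _ Sx))// lerDr.
Qed.

(** The last term stands for a surface integral: [nu] points into [halfspace c nu], so there the
    normal derivative of a compactly supported function integrates to minus its integral over the
    bounding plane. *)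
Lemma jump_parts U phi w q1 q2 a : open U -> bounded_set U -> test_function U phi -> L2 U w ->
  smooth q1 -> smooth q2 -> (forall x, U x -> above x -> w x = q1 x) ->
  (forall x, U x -> below x -> w x = q2 x) ->
  \int[leb]_(x in U) (w x * partial a phi x) =
  - (\int[leb]_(x in U) (hglue (partial a q1) (partial a q2) x * phi x)) +
  nu 0 a * \int[leb]_(x in H) 'D_nu (fun y => (q1 y - q2 y) * phi y) x.
Proof.
move=> oU bU tphi lw sq1 sq2 wq1 wq2; have mU := open_measurable_rV oU.
have lphi := test_function_L2 mU tphi.
have ldphi := test_function_L2 mU (test_function_partial a tphi).
have lg : L2 U (hglue (partial a q1) (partial a q2)).
  by apply: L2_hglue => //; apply: smooth_continuous; exact: smooth_partial.
have mUa : measurable (U `&` above) by apply: measurableI => //; exact: measurable_above.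
have mUb : measurable (U `&` below) by apply: measurableI => //; exact: measurable_below.
have lq q S : measurable S -> S `<=` U -> smooth q -> L2 S q.
  move=> mS SU sq; apply: continuous_L2 => //; last exact: smooth_continuous.
  by case: bU => N [Nr hN]; exists N; split=> // N' NN' x /SU; exact: hN.
have key q S : measurable S -> S `<=` U -> smooth q ->
    \int[leb]_(x in S) (q x * partial a phi x) =
    - (\int[leb]_(x in S) (partial a q x * phi x)) + \int[leb]_(x in S) partial a (fun y => q y * phi y) x.
  move=> mS SU sq; have [sphi _] := tphi.
  rewrite partialM; [|by move=> x; exact: smooth_diff..].
  rewrite RintegralD//; last 2 first.
  - by apply: L2_integrM => //; [exact: lq|exact: (L2S mU mS SU)].
  - by apply: L2_integrM => //; [exact: (L2S mU mS SU)|apply: lq => //; exact: smooth_partial].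
  under [X in _ = _ + (_ + X)]eq_Rintegral do rewrite mulrC.
  by ring.
rewrite int_above_below//; last exact: L2_integrM.
rewrite [X in _ = - X + _]int_above_below//; last exact: L2_integrM.
under eq_Rintegral => x /set_mem[Ux ax] do rewrite wq1//.
under [X in _ + X = _]eq_Rintegral => x /set_mem[Ux ax] do rewrite wq2//.
under [X in _ = - (X + _) + _]eq_Rintegral => x /set_mem[Ux ax] do rewrite hglue_above//.
under [X in _ = - (_ + X) + _]eq_Rintegral => x /set_mem[Ux ax] do rewrite hglue_below//.
rewrite (key q1 _ mUa (@subIsetl _ _ _) sq1) (key q2 _ mUb (@subIsetl _ _ _) sq2).
have t1 := test_functionM sq1 tphi; have t2 := test_functionM sq2 tphi.
rewrite (int_above_partial a oU bU t1) (int_below_partial a oU bU t2).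
have -> : (fun y => (q1 y - q2 y) * phi y) = (fun y => q1 y * phi y - q2 y * phi y).
  by apply/funext => y; rewrite mulrBl.
have hi psi : test_function U psi -> integr H (fun x => 'D_nu psi x).
  move=> [sp [K [cK KU pK]]]; apply: (@integrS _ _ _ setT) => //; first exact: measurable_halfspace.
  apply: (cpt_integr cK); first by apply: smooth_continuous; exact: smooth_derive.
  by move=> x; exact: cpt_derive_out.
have -> : \int[leb]_(x in H) 'D_nu (fun y => q1 y * phi y - q2 y * phi y) x =
    \int[leb]_(x in H) 'D_nu (fun y => q1 y * phi y) x - \int[leb]_(x in H) 'D_nu (fun y => q2 y * phi y) x.
  rewrite -RintegralB; [|exact: measurable_halfspace|exact: hi|exact: hi].
  by apply: eq_Rintegral => x _; rewrite deriveB//; apply: diff_derivable; apply: smooth_diff; [case: t1|case: t2].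
by rewrite mulrBr opprD addrACA.
Qed.

Lemma sqnormL2_above_below S f : measurable S -> bounded_set S -> L2 S f ->
  sqnormL2 S f = sqnormL2 (S `&` above) f + sqnormL2 (S `&` below) f.
Proof. by move=> mS bS lf; rewrite /sqnormL2 int_above_below//; exact: L2_sqr. Qed.

End hyperplane.

(** * Testing the weak equations with bumps *)
Section pairing.
Context {R : realType} {n m : nat}.
Local Notation leb := (lebesgue_rV R n).
Variable E : 'I_m -> 'I_n -> 'I_n -> R.
Hypothesis E1 : forall j a b, `|E j a b| <= 1.
Implicit Types (S U : set 'rV[R]_n) (p ep : 'rV[R]_n -> R) (w ew : 'I_m -> 'rV[R]_n -> R)
  (f ef v : 'I_n -> 'rV[R]_n -> R).

(** The momentum equation, left minus right side, evaluated at errors [ew] and [ep] and a force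
    defect [ef], and tested with [v]. *)
Definition pairing S s ew ep ef v : R :=
  s * (\sum_j \sum_a \sum_b E j a b * \int[leb]_(x in S) (ew j x * partial a (v b) x))
  - \sum_b \int[leb]_(x in S) (ep x * partial b (v b) x)
  - \sum_b \int[leb]_(x in S) (ef b x * v b x).

Lemma sum_sqr_le (J : finType) (F : J -> R) :
  (\sum_j F j) ^+ 2 <= 2 ^+ #|J| * \sum_j F j ^+ 2.
Proof.
have e (G : J -> R) : \sum_j G j = \sum_(j <- enum J) G j by rewrite big_enum.
by rewrite !e cardE; exact: sqr_sum_le.
Qed.

(** Cauchy-Schwarz in each integral, the test field entering through its supremum bounds and the
    measure of [S]. The constant is independent of [S] and of all the fields. *)
Lemma pairing_bound : exists2 C : R, 0 < C & forall S s ew ep ef v (M1 M V : R),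
  measurable S -> bounded_set S -> (leb S <= V%:E)%E -> 0 <= V ->
  (forall j, L2 S (ew j)) -> L2 S ep -> (forall b, L2 S (ef b)) -> (forall b, smooth (v b)) ->
  (forall a b x, S x -> `|partial a (v b) x| <= M1) -> (forall b x, S x -> `|v b x| <= M) ->
  pairing S s ew ep ef v ^+ 2 <= C * V * (M1 ^+ 2 *
    (s ^+ 2 * (\sum_j sqnormL2 S (ew j)) + sqnormL2 S ep) + M ^+ 2 * \sum_b sqnormL2 S (ef b)).
Proof.
pose C1 : R := 2 ^+ m * 2 ^+ n * 2 ^+ n * (n%:R + 1) ^+ 2; pose C2 : R := 2 ^+ n * (n%:R + 1).
have C10 : 0 < C1 by rewrite /C1 !mulr_gt0// ?exprn_gt0// ltr_wpDl.
have C20 : 0 < C2 by rewrite /C2 mulr_gt0// ?exprn_gt0// ltr_wpDl.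
have nn1 : n%:R <= n%:R + 1 :> R by rewrite lerDl.
exists (3 * (C1 + C2)); first by rewrite mulr_gt0// addr_gt0.
move=> S s ew ep ef v M1 M V mS bS SV V0 lw lp lf sv vM1 vM.
have mv b : measurable_fun S (v b).
  by apply: measurable_funTS; apply: continuous_measurable_rV; exact: smooth_continuous.
have mdv a b : measurable_fun S (partial a (v b)).
  by apply: measurable_funTS; apply: continuous_measurable_rV; apply: smooth_continuous; exact: smooth_partial.
have MV0 : 0 <= M1 ^+ 2 * V by rewrite mulr_ge0// sqr_ge0.
have MV1 : 0 <= M ^+ 2 * V by rewrite mulr_ge0// sqr_ge0.
rewrite /pairing; set A := \sum_j _; set B := \sum_b _; set D := \sum_b _.
have hA : A ^+ 2 <= C1 * (M1 ^+ 2 * V * \sum_j sqnormL2 S (ew j)).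
  have h1 : A ^+ 2 <= 2 ^+ m * \sum_(j < m) (2 ^+ n * \sum_(a < n) (2 ^+ n * \sum_(b < n) (M1 ^+ 2 * V * sqnormL2 S (ew j)))).
    apply: le_trans (sum_sqr_le _) _; rewrite card_ord ler_wpM2l ?exprn_ge0//; apply: ler_sum => j _.
    apply: le_trans (sum_sqr_le _) _; rewrite card_ord ler_wpM2l ?exprn_ge0//; apply: ler_sum => a _.
    apply: le_trans (sum_sqr_le _) _; rewrite card_ord ler_wpM2l ?exprn_ge0//; apply: ler_sum => b _.
    rewrite exprMn; apply: le_trans (L2_CS_bounded mS bS (lw j) (mdv a b) (vM1 a b) SV).
    by rewrite ler_piMl ?sqr_ge0// -(real_normK (num_real (E _ _ _))) expr_le1.
  apply: le_trans h1 _; rewrite /C1.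
  rewrite [leLHS]mulr_sumr [X in _ <= _ * X]mulr_sumr [leRHS]mulr_sumr; apply: ler_sum => j _.
  have X0 : 0 <= M1 ^+ 2 * V * sqnormL2 S (ew j) by rewrite mulr_ge0// sqnormL2_ge0.
  set X := M1 ^+ 2 * V * _ in X0 *.
  rewrite !sumr_const !card_ord -(mulr_natl X) -(mulr_natl (2 ^+ n * _)).
  rewrite (_ : 2 ^+ m * _ = 2 ^+ m * 2 ^+ n * 2 ^+ n * (n%:R ^+ 2 * X)); last by ring.
  rewrite -[leRHS]mulrA ler_wpM2l ?mulr_ge0 ?exprn_ge0// ler_wpM2r// ler_pXn2r// ?nnegrE// addr_ge0//.
have hB : B ^+ 2 <= C2 * (M1 ^+ 2 * V * sqnormL2 S ep).
  apply: le_trans (sum_sqr_le _) _; rewrite card_ord /C2 -mulrA ler_wpM2l ?exprn_ge0//.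
  apply: (@le_trans _ _ (\sum_(b < n) (M1 ^+ 2 * V * sqnormL2 S ep))).
    by apply: ler_sum => b _; apply: L2_CS_bounded => //; exact: vM1.
  by rewrite sumr_const card_ord -(mulr_natl (_ * _)) ler_wpM2r// mulr_ge0 ?sqnormL2_ge0.
have hD : D ^+ 2 <= C2 * (M ^+ 2 * V * \sum_b sqnormL2 S (ef b)).
  apply: le_trans (sum_sqr_le _) _; rewrite card_ord /C2 -mulrA ler_wpM2l ?exprn_ge0//.
  apply: (@le_trans _ _ (\sum_(b < n) (M ^+ 2 * V * sqnormL2 S (ef b)))).
    by apply: ler_sum => b _; apply: L2_CS_bounded => //; exact: vM.
  rewrite -mulr_sumr ler_peMl//; last by rewrite lerDr.
  by rewrite mulr_ge0// sumr_ge0// => b _; exact: sqnormL2_ge0.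
set W := \sum_j _ in hA *; set P := sqnormL2 S ep in hB *; set F := \sum_b _ in hD *.
have W0 : 0 <= W by rewrite sumr_ge0// => j _; exact: sqnormL2_ge0.
have P0 : 0 <= P by exact: sqnormL2_ge0.
have F0 : 0 <= F by rewrite sumr_ge0// => j _; exact: sqnormL2_ge0.
have h3 : (s * A - B - D) ^+ 2 <= 3 * (s ^+ 2 * A ^+ 2 + B ^+ 2 + D ^+ 2).
  have := sqr_ge0 (s * A + B); have := sqr_ge0 (s * A + D); have := sqr_ge0 (B - D); nra.
apply: le_trans h3 _.
have k1 : 0 <= M1 ^+ 2 * V * W by rewrite mulr_ge0.
have k2 : 0 <= M1 ^+ 2 * V * P by rewrite mulr_ge0.
have k3 : 0 <= M ^+ 2 * V * F by rewrite mulr_ge0.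
have hA' : s ^+ 2 * A ^+ 2 <= (C1 + C2) * (s ^+ 2 * (M1 ^+ 2 * V * W)).
  apply: le_trans (ler_wpM2l (sqr_ge0 s) hA) _; rewrite mulrCA ler_wpM2r//.
    by apply: mulr_ge0 => //; exact: sqr_ge0.
  by rewrite lerDl (ltW C20).
have hB' : B ^+ 2 <= (C1 + C2) * (M1 ^+ 2 * V * P).
  by apply: le_trans hB _; rewrite ler_wpM2r// lerDr ltW.
have hD' : D ^+ 2 <= (C1 + C2) * (M ^+ 2 * V * F).
  by apply: le_trans hD _; rewrite ler_wpM2r// lerDr ltW.
apply: le_trans (ler_wpM2l _ (lerD (lerD hA' hB') hD')) _ => //.
by rewrite le_eqVlt; apply/orP; left; apply/eqP; ring.
Qed.

(** Common to elements and facets: [Yw] and [Yp] are the boundary terms of the discrete fields, zero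
    inside an element and jump terms across a facet. The constant [c] drops out because the
    divergence of a compactly supported field has integral zero. *)
Lemma defect_identity U s c w wh (Dw : 'I_m -> 'I_n -> 'rV[R]_n -> R) p ph Dp f v
    (Yw : 'I_m -> 'I_n -> 'I_n -> R) (Yp : 'I_n -> R) : measurable U ->
  (forall b, test_function U (v b)) -> bounded_set U ->
  (forall j, L2 U (w j)) -> (forall j, L2 U (wh j)) -> (forall j a, L2 U (Dw j a)) ->
  L2 U p -> L2 U ph -> (forall b, L2 U (Dp b)) -> (forall b, L2 U (f b)) ->
  (forall j a b, \int[leb]_(x in U) (wh j x * partial a (v b) x) =
    - (\int[leb]_(x in U) (Dw j a x * v b x)) + Yw j a b) ->
  (forall b, \int[leb]_(x in U) (ph x * partial b (v b) x) =
    - (\int[leb]_(x in U) (Dp b x * v b x)) + Yp b) ->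
  s * (\sum_j \sum_a \sum_b E j a b * \int[leb]_(x in U) (w j x * partial a (v b) x))
  - \sum_b \int[leb]_(x in U) (p x * partial b (v b) x) = \sum_b \int[leb]_(x in U) (f b x * v b x) ->
  pairing U s (fun j x => w j x - wh j x) (fun x => p x - ph x - c)
    (fun b x => f b x - (Dp b x - s * \sum_j \sum_a E j a b * Dw j a x)) v =
  - (s * (\sum_j \sum_a \sum_b E j a b * Yw j a b)) + \sum_b Yp b.
Proof.
move=> mU tv bU lw lwh lDw lp lph lDp lf hw hp heq.
have lv b := test_function_L2 mU (tv b).
have ldv a b := test_function_L2 mU (test_function_partial a (tv b)).
have l1 : L2 U (fun=> c) by apply: continuous_L2 => //; exact: cst_continuous.
rewrite /pairing.
pose Iw j a b := \int[leb]_(x in U) (w j x * partial a (v b) x).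
pose Ip b := \int[leb]_(x in U) (p x * partial b (v b) x).
pose If b := \int[leb]_(x in U) (f b x * v b x).
pose Jw j a b := \int[leb]_(x in U) (Dw j a x * v b x).
pose Jp b := \int[leb]_(x in U) (Dp b x * v b x).
have e1 j a b : \int[leb]_(x in U) ((w j x - wh j x) * partial a (v b) x) = Iw j a b + Jw j a b - Yw j a b.
  under eq_Rintegral do rewrite mulrBl.
  by rewrite RintegralB; [rewrite hw /Iw /Jw; ring|exact: mU|exact: L2_integrM..].
have e2 b : \int[leb]_(x in U) ((p x - ph x - c) * partial b (v b) x) = Ip b + Jp b - Yp b.
  under eq_Rintegral do rewrite !mulrBl.
  rewrite RintegralB; [|exact: mU|apply: integrB => //; exact: L2_integrM|exact: L2_integrM].
  rewrite RintegralB; [|exact: mU|exact: L2_integrM..].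
  rewrite hp RintegralZl; [|exact: mU|].
    by rewrite test_function_int_partial// /Ip /Jp; ring.
  have [sv [K [cK KU vK]]] := tv b.
  apply: (@integrS _ _ _ setT) => //; apply: (cpt_integr cK).
    by apply: smooth_continuous; exact: smooth_partial.
  by move=> x; exact: cpt_derive_out.
have lS b : L2 U (fun x => \sum_j \sum_a E j a b * Dw j a x).
  by apply: L2_sum => // j _; apply: L2_sum => // a _; exact: L2Z.
have e3 b : \int[leb]_(x in U) ((f b x - (Dp b x - s * \sum_j \sum_a E j a b * Dw j a x)) * v b x) =
    If b - Jp b + s * \sum_j \sum_a E j a b * Jw j a b.
  have -> : (fun x => (f b x - (Dp b x - s * \sum_j \sum_a E j a b * Dw j a x)) * v b x) =
      (fun x => (f b x * v b x - Dp b x * v b x) + s * (\sum_j \sum_a E j a b * (Dw j a x * v b x))).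
    apply/funext => x; rewrite (_ : \sum_j \sum_a E j a b * (Dw j a x * v b x) =
      (\sum_j \sum_a E j a b * Dw j a x) * v b x); first by ring.
    rewrite mulr_suml; apply: eq_bigr => j _; rewrite mulr_suml; apply: eq_bigr => a _.
    by rewrite mulrA.
  have i1 j a : integr U (fun x => E j a b * (Dw j a x * v b x)) by apply: integrZ => //; exact: L2_integrM.
  have i2 j : integr U (fun x => \sum_a E j a b * (Dw j a x * v b x)) by apply: integr_sum.
  rewrite RintegralD; [|exact: mU|apply: integrB => //; exact: L2_integrM|]; last first.
    by apply: integrZ => //; exact: integr_sum.
  rewrite RintegralB; [|exact: mU|exact: L2_integrM..].
  rewrite RintegralZl; [|exact: mU|exact: integr_sum].
  rewrite Rintegral_sum//; congr (_ + s * _); apply: eq_bigr => j _.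
  rewrite Rintegral_sum//; apply: eq_bigr => a _.
  by rewrite RintegralZl//; exact: L2_integrM.
under eq_bigr do under eq_bigr do under eq_bigr do rewrite e1 mulrBr mulrDr.
under eq_bigr do under eq_bigr do rewrite sumrB big_split/=.
under eq_bigr do rewrite sumrB big_split/=.
rewrite sumrB big_split/=.
under [X in _ - X - _]eq_bigr do rewrite e2.
under [X in _ - _ - X]eq_bigr do rewrite e3.
rewrite sumrB !big_split/= sumrN -mulr_sumr.
have -> : \sum_b \sum_j \sum_a E j a b * Jw j a b = \sum_j \sum_a \sum_b E j a b * Jw j a b.
  by rewrite exchange_big/=; apply: eq_bigr => j _; rewrite exchange_big.
move: heq; rewrite -/(Iw _ _ _) -/(Ip _) -/(If _).
set tI := \sum_j \sum_a \sum_b E j a b * Iw j a b.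
set tp := \sum_b Ip b; set tf := \sum_b If b.
by move=> heq; rewrite -heq; ring.
Qed.

End pairing.

(** * Euclidean balls as supports of bumps *)

Section eball.
Context {R : realType} {n : nat}.
Local Notation leb := (lebesgue_rV R n).
Implicit Types (c x : 'rV[R]_n) (r : R) (S A : set 'rV[R]_n).

Definition eball c r : set 'rV[R]_n := [set x | enorm (x - c) < r].

Let continuous_sq c : continuous (fun x => dotv (x - c) (x - c)).
Proof. by apply: smooth_continuous; exact: smooth_dotv_sub. Qed.

Lemma open_eball c r : open (eball c r).
Proof.
have [r0|r0] := leP r 0.
  rewrite (_ : eball c r = set0); first exact: open0.
  by apply/seteqP; split=> // x; rewrite /eball /= ltNge (le_trans r0 (enorm_ge0 _)).
rewrite (_ : eball c r = (fun x => dotv (x - c) (x - c)) @^-1` [set t | t < r ^+ 2]).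
  by apply: open_comp; [move=> x _; exact: continuous_sq|exact: open_lt].
by apply/seteqP; split=> x; rewrite /eball/= enorm_lt// ltW.
Qed.

Lemma eball_cube c r : eball c r `<=` cube c r.
Proof.
move=> x xr i; rewrite !mxE.
have := le_lt_trans (coord_enorm (x - c) i) xr; rewrite !mxE ltr_norml => /andP[h1 h2].
by apply/andP; split; lra.
Qed.

Lemma bounded_subset S A : A `<=` S -> bounded_set S -> bounded_set A.
Proof. by move=> AS [N [Nr hN]]; exists N; split=> // N' NN' x /AS; exact: hN. Qed.

Lemma bounded_eball c r : bounded_set (eball c r).
Proof. exact: bounded_subset (@eball_cube c r) (bounded_set_cube c r). Qed.

Lemma measurable_eball c r : measurable (eball c r).
Proof. by apply: open_measurable_rV; exact: open_eball. Qed.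

Lemma lebesgue_eball c r : 0 < r -> (leb (eball c r) <= ((2 * r) ^+ n)%:E)%E.
Proof.
move=> r0; rewrite -(lebesgue_cube c r0); apply: le_measure; rewrite ?inE; last exact: eball_cube.
  exact: measurable_eball.
exact: measurable_box.
Qed.

(** The support is the closed ball of radius [r]; the doubled radius makes it a compact subset of an
    open ball. *)
Lemma test_function_bump c r g : 0 < r -> smooth g ->
  test_function (eball c (2 * r)) (fun x => rbump c r x * g x).
Proof.
move=> r0 sg; split; first by apply: smoothM => //; exact: smooth_bump.
exists [set x | dotv (x - c) (x - c) <= r ^+ 2]; split.
- have h : [set x | dotv (x - c) (x - c) <= r ^+ 2] `<=` closed_box (c - const_mx r) (c + const_mx r).
    move=> x; rewrite /= -(enorm_le _ (ltW r0)) => xr i; rewrite in_itv/= !mxE.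
    by have := le_trans (coord_enorm (x - c) i) xr; rewrite !mxE ler_norml => /andP[h1 h2]; lra.
  apply: (subclosed_compact _ (@compact_closed_box R n _ _)); last exact: h.
  rewrite (_ : mkset _ = (fun x => dotv (x - c) (x - c)) @^-1` [set t | t <= r ^+ 2])//.
  by apply: preimage_closed; [move=> x _; exact: continuous_sq|exact: closed_le].
- by move=> x; rewrite /eball /= -(enorm_le _ (ltW r0)) => /le_lt_trans; apply; lra.
- move=> x; rewrite /= => /negP; rewrite -ltNge => h; rewrite bump_out ?mul0r//.
  by rewrite leNgt enorm_lt ?ltW// -leNgt ltW.
Qed.

Lemma Rintegral_le_subset S A (g : 'rV[R]_n -> R) : measurable S -> measurable A -> A `<=` S ->
  integr S g -> (forall x, S x -> 0 <= g x) ->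
  \int[leb]_(x in A) g x <= \int[leb]_(x in S) g x.
Proof.
move=> mS mA AS ig g0; rewrite -[in leRHS](setDUK AS) int_setU2//; last 3 first.
- exact: measurableD.
- by rewrite setIDA setIidl// setDv.
- by rewrite setDUK.
by rewrite lerDl; apply: Rintegral_ge0 => x [Sx _]; exact: g0.
Qed.

End eball.

(** With [q = t * Q], the bounds [k * q <= X] and [X ^+ 2 <= C * q * B] allow one factor [q] to be
    cancelled. Only [Q] may vanish, so the known positive factor [t] is kept apart. *)
Lemma absorb (R : realType) (C k t Q X B : R) : 0 <= C -> 0 < t -> 0 < k -> 0 <= Q -> 0 <= B ->
  k * (t * Q) <= X -> X ^+ 2 <= C * (t * Q) * B -> t * Q <= C / k ^+ 2 * B.
Proof.
move=> C0 t0 k0 Q0 B0 h1 h2; have [->|Qn] := eqVneq Q 0.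
  by rewrite mulr0 mulr_ge0// divr_ge0// sqr_ge0.
have q0 : 0 < t * Q by rewrite mulr_gt0// lt_def Qn.
rewrite -mulrAC ler_pdivlMr ?exprn_gt0//; set q := t * Q in q0 h1 h2 *.
have h3 : (k * q) ^+ 2 <= C * q * B.
  by apply: le_trans h2; rewrite ler_pXn2r ?nnegrE ?(le_trans _ h1)// ltW// mulr_gt0.
by rewrite -(ler_pM2r q0); move: h3; rewrite exprMn; lra.
Qed.

(** * Bumps multiplied by polynomials *)

Section bumpbound.
Context {R : realType} {n m : nat}.
Local Notation N := (n.+1).
Local Notation leb := (lebesgue_rV R N).
Variable E : 'I_m -> 'I_N -> 'I_N -> R.
Hypothesis E1 : forall j a b, `|E j a b| <= 1.
Variable md : nat.
Implicit Types (c z x : 'rV[R]_N) (r : R) (q : 'rV[R]_N -> R).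

(* A cube of this half-width lies in the concentric ball of radius [r / 4]. *)
Definition cutradius (r : R) : R := r / (4 * N%:R).

Lemma cutradius_gt0 r : 0 < r -> 0 < cutradius r.
Proof. by move=> r0; rewrite divr_gt0// mulr_gt0// ltr0n. Qed.

Lemma cutradiusE r : N%:R * cutradius r = r / 4.
Proof.
have N0 : N%:R != 0 :> R by rewrite pnatr_eq0.
by rewrite /cutradius; field.
Qed.

Lemma cube_cutradius z r x : 0 < r -> cube z (cutradius r) x -> enorm (x - z) <= r / 4.
Proof.
move=> r0 xz; rewrite -cutradiusE; apply: enorm_coord => [|i]; first exact/ltW/cutradius_gt0.
by have := xz i; rewrite !mxE ler_norml => /andP[h1 h2]; apply/andP; split; lra.
Qed.

(** The polynomial is measured on a cube whose centre [z] may differ from the centre [c] of the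
    bump: for a facet the cube has to lie on one side of the plane. *)
Lemma rbump_poly_bound : exists2 C : R, 0 < C & forall c z r q x, 0 < r -> enorm (z - c) <= r ->
  ispoly md q -> enorm (x - c) <= 2 * r ->
  (rbump c r x * q x) ^+ 2 <= C * meansq q z (cutradius r) /\
  forall a, partial a (fun y => rbump c r y * q y) x ^+ 2 <= C * (r ^- 2 * meansq q z (cutradius r)).
Proof.
have N0 : (0 : R) < N%:R by rewrite ltr0n.
(* Points within [2 * r] of [c] are within [3 * r] of [z], and [3 * r] equals
   [12 * N%:R * cutradius r]. *)
have L0 : 0 <= 12 * N%:R :> R by rewrite mulr_ge0// ltW.
have [C0 C00 hC] := @ispoly_bound R N md _ L0.
exists (C0 * (32 * N%:R ^+ 2 + 33)).
  by rewrite mulr_gt0// ltr_wpDl// mulr_ge0// sqr_ge0.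
move=> c z r q x r0 zc pq xc; have r'0 := cutradius_gt0 r0.
have xz : enorm (x - z) <= 12 * N%:R * cutradius r.
  rewrite -mulrA cutradiusE (_ : x - z = (x - c) - (z - c)); last by rewrite opprB addrA subrK.
  by apply: le_trans (enormD _ _) _; rewrite enormN; lra.
have [h1 h2] := hC z _ q x r'0 pq xz.
have Q0 : 0 <= meansq q z (cutradius r) by apply: meansq_ge0; exact: ltW.
set Q := meansq _ _ _ in Q0 h1 h2 *.
have b0 := bump_ge0 c r x; have b1 := bump_le1 c r x.
have b2 : rbump c r x ^+ 2 <= 1 by rewrite expr_le1.
have k2 : 1 <= 32 * N%:R ^+ 2 + 33 :> R by have := sqr_ge0 (N%:R : R); lra.
split.
  rewrite exprMn; apply: (@le_trans _ _ (q x ^+ 2)); first by rewrite ler_piMl ?sqr_ge0.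
  by apply: le_trans h1 _; rewrite -mulrA (ler_wpM2l (ltW C00))// ler_peMl.
move=> a; have sb := @smooth_bump R N c r.
rewrite partialM; [|by move=> y; exact: smooth_diff|by move=> y; apply: smooth_diff; case: pq].
apply: le_trans (sqrD_le _ _) _; rewrite !exprMn.
have d1 : partial a (rbump c r) x ^+ 2 <= 16 * r ^- 2.
  have := derive_bump_bound c x (delta_mx 0 a) r0.
  have -> : enorm (delta_mx 0 a : 'rV[R]_N) = 1.
    rewrite /enorm /dotv (bigD1 a)//= mxE !eqxx mulr1 big1 ?addr0 ?sqrtr1//.
    by move=> i /negbTE ia; rewrite mxE ia andbF mul0r.
  rewrite mulr1 -/(partial a (rbump c r) x) => h.
  rewrite -(real_normK (num_real (partial _ _ _))).
  rewrite (_ : 16 * r ^- 2 = (4 / r) ^+ 2); last by rewrite expr_div_n; ring.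
  by rewrite ler_pXn2r ?nnegrE// divr_ge0// ltW.
have d2 : partial a q x ^+ 2 <= C0 * (16 * N%:R ^+ 2 * (r ^- 2 * Q)).
  apply: le_trans (h2 a) _; rewrite (ler_wpM2l (ltW C00))// le_eqVlt; apply/orP; left; apply/eqP.
  by rewrite /cutradius; field; rewrite !gt_eqF.
have rQ : 0 <= r ^- 2 * Q by rewrite mulr_ge0// invr_ge0 sqr_ge0.
apply: (@le_trans _ _ (2 * (C0 * (16 * N%:R ^+ 2 * (r ^- 2 * Q))) + 2 * (C0 * Q * (16 * r ^- 2)))).
  rewrite lerD// ler_wpM2l//.
    by apply: le_trans d2; rewrite ler_piMl ?sqr_ge0.
  by apply: ler_pM; rewrite ?sqr_ge0.
rewrite (_ : _ + _ = C0 * ((32 * N%:R ^+ 2 + 32) * (r ^- 2 * Q))); last by ring.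
rewrite -[leRHS]mulrA (ler_wpM2l (ltW C00))// ler_wpM2r// lerD2l; lra.
Qed.

(** The upper half of the absorption argument. The factor [r ^+ N] is the volume of the ball up to a
    constant, and [r ^- 2] is the price of a derivative of the test field. *)
Lemma rbump_pairing : exists2 C : R, 0 < C & forall c z r s ew ep ef (q : 'I_N -> 'rV[R]_N -> R),
  let U := eball c (2 * r) in let Q := \sum_b meansq (q b) z (cutradius r) in
  0 < r -> enorm (z - c) <= r -> (forall b, ispoly md (q b)) ->
  (forall j, L2 U (ew j)) -> L2 U ep -> (forall b, L2 U (ef b)) ->
  pairing E U s ew ep ef (fun b x => rbump c r x * q b x) ^+ 2 <= C * (r ^+ N * Q) *
    (r ^- 2 * (s ^+ 2 * (\sum_j sqnormL2 U (ew j)) + sqnormL2 U ep) + \sum_b sqnormL2 U (ef b)).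
Proof.
have [C1 C10 h1] := pairing_bound E1; have [C2 C20 h2] := rbump_poly_bound.
exists (C1 * 4 ^+ N * C2) => [|c z r s ew ep ef q U Q r0 zc pq lw lp lf].
  by rewrite !mulr_gt0// exprn_gt0.
have r'0 := cutradius_gt0 r0.
have Qb b : 0 <= meansq (q b) z (cutradius r) by apply: meansq_ge0; exact: ltW.
have Q0 : 0 <= Q by exact: sumr_ge0.
have QQ b : meansq (q b) z (cutradius r) <= Q by rewrite /Q (bigD1 b)//= lerDl sumr_ge0.
have r20 : 0 < 2 * r by rewrite mulr_gt0.
have sb := @smooth_bump R N c r.
have sqb (y B : R) : y ^+ 2 <= B -> `|y| <= Num.sqrt B.
  by move=> yB; rewrite -sqrtr_sqr ler_wsqrtr.
have rQ : 0 <= r ^- 2 * Q by rewrite mulr_ge0// invr_ge0 sqr_ge0.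
have := h1 U s ew ep ef (fun b x => rbump c r x * q b x) (Num.sqrt (C2 * (r ^- 2 * Q)))
  (Num.sqrt (C2 * Q)) ((2 * (2 * r)) ^+ N) (@measurable_eball _ _ _ _) (@bounded_eball _ _ _ _) (lebesgue_eball _ r20).
rewrite !sqr_sqrtr ?mulr_ge0 ?(ltW C20) ?invr_ge0 ?sqr_ge0//.
move=> /(_ _ lw lp lf) h; apply: le_trans (h _ _ _ _) _.
- by rewrite exprn_ge0// mulr_ge0// ltW.
- by move=> b; apply: smoothM => //; case: (pq b).
- move=> a b x Ux; apply: sqb.
  have [_ h3] := h2 c z r (q b) x r0 zc (pq b) (ltW Ux).
  apply: le_trans (h3 a) _; rewrite (ler_wpM2l (ltW C20))// ler_wpM2l ?QQ// invr_ge0 sqr_ge0//.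
- move=> b x Ux; apply: sqb.
  have [h3 _] := h2 c z r (q b) x r0 zc (pq b) (ltW Ux).
  by apply: le_trans h3 _; rewrite (ler_wpM2l (ltW C20))// QQ.
rewrite le_eqVlt; apply/orP; left; apply/eqP.
rewrite (_ : 2 * (2 * r) = 4 * r); last by ring.
by rewrite exprMn; ring.
Qed.

End bumpbound.

(** * Local bounds for the equilibrium residual and for the jump *)

Section local.
Context {R : realType} {n m : nat}.
Local Notation N := (n.+1).
Local Notation leb := (lebesgue_rV R N).
Variable E : 'I_m -> 'I_N -> 'I_N -> R.
Hypothesis E1 : forall j a b, `|E j a b| <= 1.
Variables (md : nat) (L : R).
Hypothesis L0 : 0 <= L.
Local Notation rad := (@cutradius R n).
Implicit Types (c z x nu : 'rV[R]_N) (r : R) (p ph q : 'rV[R]_N -> R)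
  (w wh : 'I_m -> 'rV[R]_N -> R) (f : 'I_N -> 'rV[R]_N -> R).

(** Stated on an arbitrary [U], so that it restricts to balls, and for test functions only, the
    class to which the bumps belong. *)
Definition weak_balance U (s : R) w p f : Prop := forall v : 'I_N -> 'rV[R]_N -> R,
  (forall b, test_function U (v b)) ->
  s * (\sum_j \sum_a \sum_b E j a b * \int[leb]_(x in U) (w j x * partial a (v b) x))
  - \sum_b \int[leb]_(x in U) (p x * partial b (v b) x) = \sum_b \int[leb]_(x in U) (f b x * v b x).

(* [grad p + s curl w], for the gradients [Dw] and [Dp] of [w] and [p]; the sign
   comes from the antisymmetry of [E]. *)
Definition strong_force (s : R) (Dw : 'I_m -> 'I_N -> 'rV[R]_N -> R) (Dp : 'I_N -> 'rV[R]_N -> R)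
    b x : R := Dp b x - s * \sum_j \sum_a E j a b * Dw j a x.

(** The lower half of the absorption argument: [k] bounds the weight on the cube from below, and
    [(4 * N%:R) ^+ N] is the ratio of [r ^+ N] to the power of [rad r] in [meansq]. *)
Lemma meansq_sum_lower (k : R) z r (q : 'I_N -> 'rV[R]_N -> R) (g : 'I_N -> 'rV[R]_N -> R) S :
  0 < r -> measurable S -> cube z (rad r) `<=` S -> 0 <= k ->
  (forall b, ispoly md (q b)) -> (forall b, integr S (g b)) -> (forall b x, S x -> 0 <= g b x) ->
  (forall b x, cube z (rad r) x -> k * q b x ^+ 2 <= g b x) ->
  k / (4 * N%:R) ^+ N * (r ^+ N * \sum_b meansq (q b) z (rad r)) <=
  \sum_b \int[leb]_(x in S) g b x.
Proof.
move=> r0 mS cS k0 pq ig g0 kg; have r'0 := @cutradius_gt0 R n r r0.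
have mc : measurable (cube z (rad r)) by exact: measurable_box.
rewrite !mulr_sumr; apply: ler_sum => b _.
apply: le_trans (Rintegral_le_subset mS mc cS (ig b) (g0 b)).
have lq : L2 (cube z (rad r)) (q b) by apply: ispoly_L2 (pq b) => //; exact: bounded_set_cube.
rewrite (_ : _ * _ = k * sqnormL2 (cube z (rad r)) (q b)); last first.
  rewrite /meansq {1}/cutradius expr_div_n; field.
  by rewrite gt_eqF//= expf_neq0// gt_eqF// ltr0n.
rewrite /sqnormL2 -RintegralZl//; last exact: L2_sqr.
apply: le_Rintegral => //.
- by apply: integrZ => //; exact: L2_sqr.
- by apply: integrS cS (ig b).
- exact: kg.
Qed.

(** The bound is pointwise and reaches up to distance [L * r], beyond the ball that carries the test
    function, so that it holds on an entire shape-regular element. The factor [r ^+ 2] becomes the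
    weight of the residual. *)
Lemma element_local : exists2 C : R, 0 < C &
  forall s r (c0 : R) c w p f wh ph fh qw qp qf, let U := eball c (2 * r) in 0 < r ->
  (forall j, L2 U (w j)) -> L2 U p -> (forall b, L2 U (f b)) ->
  (forall j, L2 U (wh j)) -> L2 U ph -> (forall b, L2 U (fh b)) ->
  (forall j, ispoly md (qw j)) -> ispoly md qp -> (forall b, ispoly md (qf b)) ->
  (forall j x, U x -> wh j x = qw j x) -> (forall x, U x -> ph x = qp x) ->
  (forall b x, U x -> fh b x = qf b x) -> weak_balance U s w p f ->
  forall b x, enorm (x - c) <= L * r ->
  r ^+ N * r ^+ 2 * (qf b x - strong_force s (fun j a => partial a (qw j)) (fun b => partial b qp) b x) ^+ 2
  <= C * (s ^+ 2 * (\sum_j sqnormL2 U (fun x => w j x - wh j x)) + sqnormL2 U (fun x => p x - ph x - c0)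
    + r ^+ 2 * \sum_b sqnormL2 U (fun x => f b x - fh b x)).
Proof.
have [C1 C10 h1] := rbump_pairing E1 md.
have N0 : (0 : R) < 4 * N%:R by rewrite mulr_gt0// ltr0n.
have L'0 : 0 <= 4 * N%:R * L by rewrite mulr_ge0// ltW.
have [C2 C20 h2] := @ispoly_bound R N md _ L'0.
have e0 : 0 < expR (- (16 / 7)) :> R by exact: expR_gt0.
pose k : R := expR (- (16 / 7)) / (4 * N%:R) ^+ N.
have k0 : 0 < k by rewrite divr_gt0// exprn_gt0.
exists (C2 * (C1 / k ^+ 2)); first by rewrite mulr_gt0// divr_gt0// exprn_gt0.
move=> s r c0 c w p f wh ph fh qw qp qf U r0 lw lp lf lwh lph lfh pqw pqp pqf ew ep ef bal b x xc.
pose R1 b x := qf b x - strong_force s (fun j a => partial a (qw j)) (fun b => partial b qp) b x.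
have pR1 b' : ispoly md (R1 b').
  apply: ispolyB => //; apply: ispolyB; first exact: ispoly_partial.
  apply: ispolyZ; apply: ispoly_sum => j _; apply: ispoly_sum => a _; apply: ispolyZ.
  exact: ispoly_partial.
have r20 : 0 < 2 * r by rewrite mulr_gt0.
have mU : measurable U := @measurable_eball _ _ _ _.
have bU : bounded_set U := @bounded_eball _ _ _ _.
have lpoly q : ispoly md q -> L2 U q by move=> pq; exact: ispoly_L2 pq.
pose v b x := rbump c r x * R1 b x.
have tv b' : test_function U (v b') by apply: test_function_bump => //; case: (pR1 b').
have lv b' := test_function_L2 mU (tv b').
have l1 : L2 U (fun=> c0) by apply: continuous_L2 => //; exact: cst_continuous.
pose g := strong_force s (fun j a => partial a (qw j)) (fun b => partial b qp).
have lg b' : L2 U (g b').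
  apply: lpoly; apply: ispolyB; first exact: ispoly_partial.
  apply: ispolyZ; apply: ispoly_sum => j _; apply: ispoly_sum => a _; apply: ispolyZ.
  exact: ispoly_partial.
(* With the force defect taken as [f b - g b] the pairing vanishes, as there are no boundary terms.
   Writing [f b - g b] as [f b - fh b] plus [R1 b] then isolates the bump times the squared
   residual. *)
have key : pairing E U s (fun j x => w j x - wh j x) (fun x => p x - ph x - c0) (fun b x => f b x - fh b x) v =
    \sum_b \int[leb]_(x in U) (rbump c r x * R1 b x ^+ 2).
  have := @defect_identity R n.+1 m E U s c0 w wh (fun j a => partial a (qw j)) p ph (fun b => partial b qp) f v
    (fun _ _ _ => 0) (fun=> 0) mU tv bU lw lwh (fun j a => lpoly _ (ispoly_partial a (pqw j))) lp lph
    (fun b => lpoly _ (ispoly_partial b pqp)) lf.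
  have ih j a b' : \int[leb]_(x in U) (wh j x * partial a (v b') x) =
      - (\int[leb]_(x in U) (partial a (qw j) x * v b' x)) + 0.
    under eq_Rintegral => y /set_mem Uy do rewrite ew//.
    by rewrite addr0; apply: test_function_parts => //; case: (pqw j).
  have ip b' : \int[leb]_(x in U) (ph x * partial b' (v b') x) =
      - (\int[leb]_(x in U) (partial b' qp x * v b' x)) + 0.
    under eq_Rintegral => y /set_mem Uy do rewrite ep//.
    by rewrite addr0; apply: test_function_parts => //; case: pqp.
  move=> /(_ ih ip (bal v tv)).
  rewrite [X in - (s * X)]big1; last first.
    by move=> j _; rewrite big1// => a _; rewrite big1// => b' _; rewrite mulr0.
  rewrite mulr0 oppr0 add0r big1// /pairing => hd.
  set A := s * _ in hd *; set B := \sum_b _ in hd *.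
  have hb b' : \int[leb]_(x in U) ((f b' x - fh b' x) * v b' x) =
      \int[leb]_(x in U) ((f b' x - g b' x) * v b' x) - \int[leb]_(x in U) (rbump c r x * R1 b' x ^+ 2).
    have lsR : integr U (fun x => rbump c r x * R1 b' x ^+ 2).
      rewrite (_ : (fun x => _) = fun x => R1 b' x * v b' x); last by apply/funext => y; rewrite /v; ring.
      by apply: L2_integrM => //; exact: lpoly.
    rewrite -RintegralB//; last by apply: L2_integrM => //; exact: L2B.
    apply: eq_Rintegral => y /set_mem Uy; rewrite /v ef// /R1 -/(g b' y); ring.
  rewrite (eq_bigr _ (fun b' _ => hb b')) sumrB opprB.
  set X := \sum_b _; set G := \sum_b _.
  have hd' : A - B - G = 0 by exact: hd.
  by rewrite addrA addrAC hd' add0r.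
have cU : cube c (rad r) `<=` U.
  by move=> y /(cube_cutradius r0) yc; rewrite /U /eball/=; apply: le_lt_trans yc _; lra.
have low : k * (r ^+ N * \sum_b meansq (R1 b) c (rad r)) <=
    \sum_b \int[leb]_(x in U) (rbump c r x * R1 b x ^+ 2).
  apply: (meansq_sum_lower (k := expR (- (16 / 7))) r0 mU cU) => //.
  - move=> b'; rewrite (_ : (fun x => _) = fun x => R1 b' x * v b' x); last by apply/funext => y; rewrite /v; ring.
    by apply: L2_integrM => //; exact: lpoly.
  - by move=> b' y _; rewrite mulr_ge0 ?bump_ge0 ?sqr_ge0.
  - move=> b' y /(cube_cutradius r0) yc; rewrite ler_wpM2r ?sqr_ge0//.
    by apply: bump_lower => //; lra.
have cc : enorm (c - c) <= r by rewrite subrr /enorm dotv0l sqrtr0 ltW.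
have := h1 c c r s (fun j x => w j x - wh j x) (fun x => p x - ph x - c0) (fun b x => f b x - fh b x) R1 r0 cc pR1.
move=> /(_ (fun j => L2B mU (lw j) (lwh j)) (L2B mU (L2B mU lp lph) l1) (fun b => L2B mU (lf b) (lfh b))).
rewrite -/U -/(v _) key.
set Q := \sum_b meansq _ _ _; set A := s ^+ 2 * _; set P := sqnormL2 _ _; set F := \sum_b sqnormL2 _ _ => up.
have r'0 := @cutradius_gt0 R n r r0.
have Qb b' : 0 <= meansq (R1 b') c (rad r) by apply: meansq_ge0; exact: ltW.
have Q0 : 0 <= Q by exact: sumr_ge0.
have A0 : 0 <= A by rewrite mulr_ge0 ?sqr_ge0 ?sumr_ge0// => j _; exact: sqnormL2_ge0.
have P0 : 0 <= P by exact: sqnormL2_ge0.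
have F0 : 0 <= F by rewrite sumr_ge0// => j _; exact: sqnormL2_ge0.
have B0 : 0 <= r ^- 2 * (A + P) + F by rewrite addr_ge0// mulr_ge0 ?invr_ge0 ?sqr_ge0 ?addr_ge0.
have rN : 0 < r ^+ N by rewrite exprn_gt0.
have fin := absorb (ltW C10) rN k0 Q0 B0 low up.
have xc' : enorm (x - c) <= 4 * N%:R * L * rad r.
  apply: le_trans xc _; rewrite le_eqVlt; apply/orP; left; apply/eqP.
  rewrite (_ : 4 * N%:R * L * rad r = 4 * L * (N%:R * rad r)); last by ring.
  by rewrite cutradiusE; field.
have [h3 _] := h2 c _ (R1 b) x r'0 (pR1 b) xc'.
have QQ : meansq (R1 b) c (rad r) <= Q by rewrite /Q (bigD1 b)//= lerDl sumr_ge0.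
have h4 : R1 b x ^+ 2 <= C2 * Q by apply: le_trans h3 _; rewrite (ler_wpM2l (ltW C20)).
rewrite -/(R1 b x).
apply: (@le_trans _ _ (C2 * (r ^+ 2 * (r ^+ N * Q)))).
  rewrite (_ : C2 * _ = r ^+ N * r ^+ 2 * (C2 * Q)); last by ring.
  by rewrite ler_wpM2l// mulr_ge0 ?sqr_ge0// ltW.
rewrite -[leRHS]mulrA (ler_wpM2l (ltW C20))//.
apply: (@le_trans _ _ (r ^+ 2 * (C1 / k ^+ 2 * (r ^- 2 * (A + P) + F)))).
  by rewrite ler_wpM2l ?sqr_ge0.
rewrite le_eqVlt; apply/orP; left; apply/eqP; field.
by rewrite !gt_eqF.
Qed.

Lemma derive_sumf (I : finType) (F : I -> 'rV[R]_N -> R) x (v : 'rV[R]_N) : (forall i, smooth (F i)) ->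
  'D_v (fun y => \sum_i F i y) x = \sum_i 'D_v (F i) x.
Proof.
move=> sF; have dd (g : 'rV[R]_N -> R) : smooth g -> derivable g x v.
  by move=> sg; apply: diff_derivable; exact: smooth_diff.
elim: (index_enum I) => [|i r IH].
  by under eq_fun do rewrite big_nil; rewrite derive_cst big_nil.
under eq_fun do rewrite big_cons; rewrite big_cons -IH deriveD//; apply: dd => //.
exact: smooth_sum.
Qed.

(* [Jt] is the jump extended to be constant along the normal, so that the boundary
   term becomes the integral of [- 'D_nu (rbump c r)] times its square. *)
Lemma facet_local : exists2 C : R, 0 < C &
  forall s r (c0 : R) c nu w p f wh ph q1w q2w q1p q2p, let U := eball c (2 * r) in 0 < r ->
  dotv nu nu = 1 ->
  (forall j, L2 U (w j)) -> L2 U p -> (forall b, L2 U (f b)) -> (forall j, L2 U (wh j)) -> L2 U ph ->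
  (forall j, ispoly md (q1w j)) -> (forall j, ispoly md (q2w j)) -> ispoly md q1p -> ispoly md q2p ->
  (forall j x, U x -> above c nu x -> wh j x = q1w j x) ->
  (forall j x, U x -> below c nu x -> wh j x = q2w j x) ->
  (forall x, U x -> above c nu x -> ph x = q1p x) ->
  (forall x, U x -> below c nu x -> ph x = q2p x) -> weak_balance U s w p f ->
  forall b x, dotv (x - c) nu = 0 -> enorm (x - c) <= L * r ->
  r ^+ N * (s * (\sum_j \sum_a E j a b * (nu 0 a * (q1w j x - q2w j x))) - nu 0 b * (q1p x - q2p x)) ^+ 2
  <= C * (s ^+ 2 * (\sum_j sqnormL2 U (fun x => w j x - wh j x)) + sqnormL2 U (fun x => p x - ph x - c0)
    + r ^+ 2 * \sum_b sqnormL2 U (fun x => f b x -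
      strong_force s (fun j a => hglue c nu (partial a (q1w j)) (partial a (q2w j)))
        (fun b => hglue c nu (partial b q1p) (partial b q2p)) b x)).
Proof.
have [C1 C10 h1] := rbump_pairing E1 md.
have N0 : (0 : R) < 4 * N%:R by rewrite mulr_gt0// ltr0n.
have L'0 : 0 <= 4 * N%:R * (L + 1) by rewrite mulr_ge0// ?addr_ge0// ltW.
have [C2 C20 h2] := @ispoly_bound R N md _ L'0.
have e0 : 0 < expR (- (16 / 7)) :> R by exact: expR_gt0.
pose k : R := expR (- (16 / 7)) / 2 / (4 * N%:R) ^+ N.
have k0 : 0 < k by rewrite !divr_gt0// exprn_gt0.
exists (C2 * (C1 / k ^+ 2)); first by rewrite mulr_gt0// divr_gt0// exprn_gt0.
move=> s r c0 c nu w p f wh ph q1w q2w q1p q2p U r0 nu1 lw lp lf lwh lph pq1w pq2w pq1p pq2p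
  wh1 wh2 ph1 ph2 bal b x xp xc.
have rn0 : r != 0 by rewrite gt_eqF.
pose dw j y := q1w j y - q2w j y; pose dp y := q1p y - q2p y.
have pdw j : ispoly md (dw j) by exact: ispolyB.
have pdp : ispoly md dp by exact: ispolyB.
pose J b y := s * (\sum_j \sum_a E j a b * (nu 0 a * dw j y)) - nu 0 b * dp y.
have pJ b' : ispoly md (J b').
  apply: ispolyB; last exact: ispolyZ.
  by apply: ispolyZ; apply: ispoly_sum => j _; apply: ispoly_sum => a _; do 2 apply: ispolyZ.
(* Orthogonal projection onto the plane; composing with it makes a polynomial constant along [nu]
   without raising its degree. *)
pose proj y : 'rV[R]_N := y - dotv (y - c) nu *: nu.
pose Jt b := J b \o proj.
have proj_line y e t : proj (y + t *: e) = proj y + t *: (e - dotv e nu *: nu).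
  rewrite /proj (_ : y + t *: e - c = (y - c) + t *: e); last by rewrite addrAC.
  by rewrite dotvDl dotvZl; apply/rowP => i; rewrite !mxE; ring.
have pJt b' : ispoly md (Jt b').
  apply: ispoly_comp (pJ b') => [j|y e]; last by exists (e - dotv e nu *: nu) => t; exact: proj_line.
  rewrite (_ : (fun y => _) = fun y : 'rV[R]_N => y 0 j - dotv (y - c) nu * nu 0 j); last first.
    by apply/funext => y; rewrite !mxE.
  apply: smoothB; first exact: smooth_coord.
  apply: smoothM; last exact: smooth_cst.
  apply: smooth_sum => i _; apply: smoothM; last exact: smooth_cst.
  by under eq_fun do rewrite !mxE; apply: smoothB; [exact: smooth_coord|exact: smooth_cst].
have Jtp b' y : dotv (y - c) nu = 0 -> Jt b' y = J b' y.
  by move=> h; rewrite /Jt /= /proj h scale0r subr0.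
have dJt b' y : 'D_nu (Jt b') y = 0.
  have hd : is_derive y nu (Jt b') 0.
    apply: is_derive_line => h; rewrite /Jt /= [h *: nu + _]addrC proj_line nu1 scale1r subrr scaler0 addr0.
    by rewrite subrr mulr0.
  by have [] := hd.
have r20 : 0 < 2 * r by rewrite mulr_gt0.
have oU : open U := @open_eball _ _ _ _.
have mU : measurable U := @measurable_eball _ _ _ _.
have bU : bounded_set U := @bounded_eball _ _ _ _.
have mH := measurable_halfspace c nu.
pose v b y := rbump c r y * Jt b y.
have tv b' : test_function U (v b') by apply: test_function_bump => //; case: (pJt b').
have l1 : L2 U (fun=> c0) by apply: continuous_L2 => //; exact: cst_continuous.
have lglue q q' a : ispoly md q -> ispoly md q' -> L2 U (hglue c nu (partial a q) (partial a q')).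
  move=> [sq _] [sq' _]; apply: L2_hglue => //; apply: smooth_continuous; exact: smooth_partial.
pose Dw j a := hglue c nu (partial a (q1w j)) (partial a (q2w j)).
pose Dp b := hglue c nu (partial b q1p) (partial b q2p).
have lDw j a : L2 U (Dw j a) by exact: lglue.
have lDp b' : L2 U (Dp b') by exact: lglue.
have lef b' : L2 U (fun x => f b' x - strong_force s Dw Dp b' x).
  apply: L2B => //; apply: L2B => //; apply: L2Z => //; apply: L2_sum => // j _.
  by apply: L2_sum => // a _; exact: L2Z.
(* Minus the surface integral of [g * v b], as a functional that is linear in [g]; linearity
   reassembles [J] from the separate jumps of [wh] and [ph]. *)
pose hd g b := \int[leb]_(y in halfspace c nu) 'D_nu (fun z => g z * v b z) y.
have hdi g b' : smooth g -> integr (halfspace c nu) (fun y => 'D_nu (fun z => g z * v b' z) y).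
  move=> sg; have [sgv [K [cK KU vK]]] := test_functionM sg (tv b').
  apply: (@integrS _ _ _ setT) => //; apply: (cpt_integr cK).
    by apply: smooth_continuous; exact: smooth_derive.
  by move=> y; exact: cpt_derive_out.
have dg g b' y : smooth g -> 'D_nu (fun z => g z * v b' z) y = g y * 'D_nu (v b') y + v b' y * 'D_nu g y.
  move=> sg; have [sv _] := tv b'.
  by rewrite deriveM; [|by apply: diff_derivable; exact: smooth_diff..].
have dsm (g : 'rV[R]_N -> R) y : smooth g -> derivable g y nu.
  by move=> sg; apply: diff_derivable; exact: smooth_diff.
have hdB g g' b' : smooth g -> smooth g' -> hd (fun y => g y - g' y) b' = hd g b' - hd g' b'.
  move=> sg sg'; rewrite /hd -RintegralB//; [|exact: hdi..].
  apply: eq_Rintegral => y _; rewrite !dg//; last exact: smoothB.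
  by rewrite deriveB; [ring|exact: dsm..].
have hdZ a g b' : smooth g -> hd (fun y => a * g y) b' = a * hd g b'.
  move=> sg; rewrite /hd -RintegralZl//; last exact: hdi.
  apply: eq_Rintegral => y _; rewrite !dg//; last exact: smoothZ.
  by rewrite (@deriveMl _ _ g a); [ring|exact: dsm].
have hd_sum (I : finType) (g : I -> 'rV[R]_N -> R) b' : (forall i, smooth (g i)) ->
    hd (fun y => \sum_i g i y) b' = \sum_i hd (g i) b'.
  move=> sg; rewrite /hd -Rintegral_sum//; last by move=> i _; exact: hdi.
  apply: eq_Rintegral => y _; rewrite dg; last exact: smooth_sum.
  rewrite derive_sumf// mulr_suml mulr_sumr -big_split/=; apply: eq_bigr => i _.
  by rewrite dg.
have key : pairing E U s (fun j x => w j x - wh j x) (fun x => p x - ph x - c0)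
    (fun b x => f b x - strong_force s Dw Dp b x) v = - \sum_b hd (J b) b.
  rewrite (@defect_identity R n.+1 m E U s c0 w wh Dw p ph Dp f v
    (fun j a b => nu 0 a * hd (dw j) b) (fun b => nu 0 b * hd dp b))//; last 3 first.
  - by move=> j a b'; apply: jump_parts => //; [case: (pq1w j)|case: (pq2w j)|exact: wh1|exact: wh2].
  - by move=> b'; apply: jump_parts => //; [case: pq1p|case: pq2p].
  - exact: bal.
  have sdw j : smooth (dw j) by case: (pdw j).
  have sdp : smooth dp by case: pdp.
  have hJ b' : hd (J b') b' = s * (\sum_j \sum_a E j a b' * (nu 0 a * hd (dw j) b')) - nu 0 b' * hd dp b'.
    rewrite /J hdB; last 2 first.
    - apply: smoothZ; apply: smooth_sum => j _; apply: smooth_sum => a _.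
      by do 2 apply: smoothZ.
    - exact: smoothZ.
    rewrite hdZ; last by apply: smooth_sum => j _; apply: smooth_sum => a _; do 2 apply: smoothZ.
    rewrite hdZ//; congr (_ * _ - _); rewrite hd_sum => [|j]; last first.
      by apply: smooth_sum => a _; do 2 apply: smoothZ.
    apply: eq_bigr => j _; rewrite hd_sum => [|a]; last by do 2 apply: smoothZ.
    apply: eq_bigr => a _; rewrite hdZ; last exact: smoothZ.
    by rewrite hdZ.
  rewrite (eq_bigr _ (fun b' _ => hJ b')) sumrB opprB addrC -mulr_sumr; congr (_ - s * _).
  rewrite [in RHS]exchange_big/=; apply: eq_bigr => j _.
  by rewrite [in RHS]exchange_big.
(* [J] and [Jt] agree on the plane, so their difference times the test function vanishes there and
   its normal derivative integrates to zero; with [Jt] the derivative falls on the bump alone. *)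
have key2 b' : - hd (J b') b' = \int[leb]_(y in halfspace c nu) (- 'D_nu (rbump c r) y * Jt b' y ^+ 2).
  have sJ : smooth (J b') by case: (pJ b').
  have sJt : smooth (Jt b') by case: (pJt b').
  have : hd (fun y => J b' y - Jt b' y) b' = 0.
    have sd : smooth (fun y => J b' y - Jt b' y) by exact: smoothB.
    have [sgv [K [cK KU vK]]] := test_functionM sd (tv b').
    apply: (int_derive_normal sgv cK vK nu1) => y hy.
    by rewrite Jtp// subrr mul0r.
  rewrite hdB// => /eqP; rewrite subr_eq0 => /eqP ->.
  rewrite /hd -RintegralN//; last exact: hdi.
  apply: eq_Rintegral => y _; rewrite dg// dJt mulr0 addr0.
  rewrite /v deriveM; [|apply: diff_derivable; apply: smooth_diff..]; last 2 first.
  - exact: smooth_bump.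
  - exact: sJt.
  by rewrite dJt /GRing.scale/=; ring.
have en : enorm nu = 1 by rewrite /enorm nu1 sqrtr1.
(* The ball of radius [r / 4] about [z] keeps a height of at least [r / 4] above the plane and stays
   within [3 / 4 * r] of [c], which are the hypotheses of [derive_bump_lower]. *)
pose z := c + (r / 2) *: nu.
have zc : enorm (z - c) <= r.
  rewrite /z addrAC subrr add0r enormZ en mulr1 ger0_norm; first by lra.
  by rewrite divr_ge0// ltW.
have zin y : cube z (rad r) y -> r / 4 <= dotv (y - c) nu.
  move=> /(cube_cutradius r0) yz.
  have -> : y - c = (y - z) + (r / 2) *: nu by rewrite /z opprD addrA subrK.
  rewrite dotvDl dotvZl nu1.
  have := dotv_enorm (y - z) nu; rewrite en mulr1 => /(le_trans (ler_norm _)).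
  have := dotv_enorm (z - y) nu; rewrite en mulr1 => /(le_trans (ler_norm _)).
  by rewrite -opprB enormN dotvNl; lra.
have zc2 y : cube z (rad r) y -> enorm (y - c) <= 3 / 4 * r.
  move=> /(cube_cutradius r0) yz.
  have -> : y - c = (y - z) + (r / 2) *: nu by rewrite /z opprD addrA subrK.
  apply: le_trans (enormD _ _) _; rewrite enormZ en mulr1 ger0_norm; first by lra.
  by rewrite divr_ge0// ltW.
have low : k / r * (r ^+ N * \sum_b meansq (Jt b) z (rad r)) <=
    pairing E U s (fun j x => w j x - wh j x) (fun x => p x - ph x - c0)
    (fun b x => f b x - strong_force s Dw Dp b x) v.
  rewrite key -sumrN (eq_bigr _ (fun b' _ => key2 b')).
  rewrite (_ : k / r = expR (- (16 / 7)) / (2 * r) / (4 * N%:R) ^+ N); last first.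
    by rewrite /k invfM; ring.
  apply: meansq_sum_lower => //.
  - by move=> y /zin h; rewrite /halfspace/=; apply: le_trans h; rewrite divr_ge0// ltW.
  - by rewrite divr_ge0// ltW// mulr_gt0.
  - move=> b'; have := hdi (Jt b') b'; case: (pJt b') => sJt _ /(_ sJt) /(integrN mH).
    rewrite (_ : (fun y => - _) = fun y => - 'D_nu (rbump c r) y * Jt b' y ^+ 2)//.
    apply/funext => y; rewrite dg// dJt mulr0 addr0.
    rewrite /v deriveM; [|apply: diff_derivable; apply: smooth_diff..]; last 2 first.
    + exact: smooth_bump.
    + exact: sJt.
    by rewrite dJt /GRing.scale/=; ring.
  - move=> b' y hy; rewrite mulr_ge0 ?sqr_ge0// derive_bump opprK mulr_ge0 ?flat_ge0//.
    by rewrite !mulr_ge0// invr_ge0 sqr_ge0.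
  - move=> b' y hy; rewrite ler_wpM2r ?sqr_ge0//; apply: derive_bump_lower => //.
      exact: zc2.
    exact: zin.
have := h1 c z r s (fun j x => w j x - wh j x) (fun x => p x - ph x - c0)
  (fun b x => f b x - strong_force s Dw Dp b x) Jt r0 zc pJt.
move=> /(_ (fun j => L2B mU (lw j) (lwh j)) (L2B mU (L2B mU lp lph) l1) lef).
rewrite -/U -/(v _).
set Q := \sum_b meansq _ _ _; set A := s ^+ 2 * _; set P := sqnormL2 _ _; set F := \sum_b sqnormL2 _ _ => up.
have r'0 := @cutradius_gt0 R n r r0.
have Qb b' : 0 <= meansq (Jt b') z (rad r) by apply: meansq_ge0; exact: ltW.
have Q0 : 0 <= Q by exact: sumr_ge0.
have A0 : 0 <= A by rewrite mulr_ge0 ?sqr_ge0 ?sumr_ge0// => j _; exact: sqnormL2_ge0.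
have P0 : 0 <= P by exact: sqnormL2_ge0.
have F0 : 0 <= F by rewrite sumr_ge0// => j _; exact: sqnormL2_ge0.
have B0 : 0 <= r ^- 2 * (A + P) + F by rewrite addr_ge0// mulr_ge0 ?invr_ge0 ?sqr_ge0 ?addr_ge0.
have rN : 0 < r ^+ N by rewrite exprn_gt0.
have kr0 : 0 < k / r by rewrite divr_gt0.
have fin := absorb (ltW C10) rN kr0 Q0 B0 low up.
have xc' : enorm (x - z) <= 4 * N%:R * (L + 1) * rad r.
  have -> : x - z = (x - c) + - ((r / 2) *: nu) by rewrite /z opprD addrA.
  apply: le_trans (enormD _ _) _; rewrite enormN enormZ en mulr1 ger0_norm; last by rewrite divr_ge0// ltW.
  rewrite (_ : 4 * _ * _ * _ = (L + 1) * r); first by lra.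
  rewrite (_ : 4 * N%:R * (L + 1) * rad r = 4 * (L + 1) * (N%:R * rad r)); last by ring.
  by rewrite cutradiusE; field.
have [h3 _] := h2 z _ (Jt b) x r'0 (pJt b) xc'.
have QQ : meansq (Jt b) z (rad r) <= Q by rewrite /Q (bigD1 b)//= lerDl sumr_ge0.
have h4 : J b x ^+ 2 <= C2 * Q by rewrite -Jtp//; apply: le_trans h3 _; rewrite (ler_wpM2l (ltW C20)).
rewrite -/(J b x).
apply: (@le_trans _ _ (C2 * (r ^+ N * Q))).
  rewrite (_ : C2 * _ = r ^+ N * (C2 * Q)); last by ring.
  by rewrite ler_wpM2l// ltW.
rewrite -[leRHS]mulrA (ler_wpM2l (ltW C20))//.
apply: le_trans fin _.
rewrite le_eqVlt; apply/orP; left; apply/eqP; field.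
by rewrite !gt_eqF.
Qed.

End local.

(** * The continuous equations *)
Section balance.
Context {R : realType} {d : spacedim}.
Local Notation point := 'rV[R]_(space_dim d).
Local Notation rotation := 'rV[R]_(rot_dim d).
Local Notation leb := (lebesgue_rV R (space_dim d)).
Variables (Omega : set point) (muE lamE : R).
Hypotheses (oO : open Omega) (bO : bounded_set Omega).
Variable E : 'I_(rot_dim d) -> 'I_(space_dim d) -> 'I_(space_dim d) -> R.
Hypothesis tE : is_curl_tensor E.
Local Notation wD := (wpartial Omega).
Implicit Types (u f z : point -> point) (w th : point -> rotation) (p q : point -> R)
  (v : 'I_(space_dim d) -> point -> R).

Let mO : measurable Omega := open_measurable_rV oO.

Definition field_of v : point -> point := fun x => \row_b v b x.

Lemma field_ofE v b : (fun x => field_of v x 0 b) = v b.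
Proof. by apply/funext => x; rewrite mxE. Qed.

Lemma field_of_H10 v : (forall b, test_function Omega (v b)) -> H10_vec Omega (field_of v).
Proof. by move=> tv b; rewrite field_ofE; exact: test_function_H10. Qed.

Lemma wpartial_test_int v a b g : (forall b, test_function Omega (v b)) -> L2 Omega g ->
  integr Omega (fun x => g x * wD a (v b) x) /\
  \int[leb]_(x in Omega) (g x * wD a (v b) x) = \int[leb]_(x in Omega) (g x * partial a (v b) x).
Proof.
move=> tv lg; have [ln n0] := wpartial_test a oO bO (tv b).
have ld := test_function_L2 mO (test_function_partial a (tv b)).
have lw : L2 Omega (wD a (v b)).
  rewrite (_ : wD a (v b) = fun x => (wD a (v b) x - partial a (v b) x) + partial a (v b) x).
    exact: L2D.
  by apply/funext => x; rewrite subrK.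
split; first exact: L2_integrM.
apply/eqP; rewrite -subr_eq0 -RintegralB//; [|exact: L2_integrM..].
under eq_Rintegral do rewrite -mulrBr mulrC.
by rewrite (nullL2_int mO (wpartial_test a oO bO (tv b)) lg).
Qed.

Lemma dotv_integr m (F G : point -> 'rV[R]_m) : L2_vec Omega F -> L2_vec Omega G ->
  integr Omega (fun x => dotv (F x) (G x)).
Proof. by move=> lF lG; apply: integr_sum => // j _; exact: L2_integrM. Qed.

Lemma curl_test_int v w : (forall b, test_function Omega (v b)) -> L2_vec Omega w ->
  \int[leb]_(x in Omega) dotv (curl wD (field_of v) x) (w x) =
  \sum_j \sum_a \sum_b E j a b * \int[leb]_(x in Omega) (w x 0 j * partial a (v b) x).
Proof.
move=> tv lw; have [_ _ cE _ _] := tE.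
rewrite (_ : (fun x => _) = fun x => \sum_j \sum_a \sum_b E j a b * (w x 0 j * wD a (v b) x)).
  have h j a b := wpartial_test_int a b tv (lw j).
  have i3 j a b : integr Omega (fun x => E j a b * (w x 0 j * wD a (v b) x)).
    by apply: integrZ => //; case: (h j a b).
  rewrite Rintegral_sum//; last by move=> j _; apply: integr_sum => // a _; exact: integr_sum.
  apply: eq_bigr => j _; rewrite Rintegral_sum//; last by move=> a _; exact: integr_sum.
  apply: eq_bigr => a _; rewrite Rintegral_sum//; apply: eq_bigr => b _.
  by have [i e] := h j a b; rewrite RintegralZl// e.
apply/funext => x; rewrite /dotv; apply: eq_bigr => j _; rewrite cE mulr_suml.
apply: eq_bigr => a _; rewrite mulr_suml; apply: eq_bigr => b _.
by rewrite field_ofE; ring.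
Qed.

Lemma div_test_int v p : (forall b, test_function Omega (v b)) -> L2 Omega p ->
  \int[leb]_(x in Omega) (p x * div wD (field_of v) x) =
  \sum_b \int[leb]_(x in Omega) (p x * partial b (v b) x).
Proof.
move=> tv lp; have h b := wpartial_test_int b b tv lp.
rewrite (_ : (fun x => _) = fun x => \sum_b (p x * wD b (v b) x)).
  rewrite Rintegral_sum//; last by move=> b _; case: (h b).
  by apply: eq_bigr => b _; have [i ->] := h b.
by apply/funext => x; rewrite /div mulr_sumr; apply: eq_bigr => b _; rewrite field_ofE.
Qed.

Let L2_0_vec m : L2_vec Omega (fun=> 0 : 'rV[R]_m).
Proof. by move=> j; under eq_fun do rewrite mxE; exact: L2_0. Qed.

Let int_0 : \int[leb]_(x in Omega) 0 = 0.
Proof. by rewrite Rintegral_cst// mul0r. Qed.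

Let load_sum f v : L2_vec Omega f -> (forall b, test_function Omega (v b)) ->
  load Omega f (field_of v) = - \sum_b \int[leb]_(x in Omega) (f x 0 b * v b x).
Proof.
move=> lf tv; rewrite /load; congr (- _).
rewrite (_ : (fun x => _) = fun x => \sum_b (f x 0 b * v b x)).
  by rewrite Rintegral_sum// => b _; apply: L2_integrM => //; exact: test_function_L2.
by apply/funext => x; rewrite /dotv; apply: eq_bigr => b _; rewrite mxE.
Qed.

Section solution.
Variables (f u : point -> point) (w : point -> rotation) (p : point -> R).
Hypotheses (lf : L2_vec Omega f) (sol : continuous_solution Omega muE lamE f u w p).

Lemma solution_balance : weak_balance E Omega (Num.sqrt muE) (fun j x => w x 0 j) p (fun b x => f x 0 b).
Proof.
move=> v tv; have [hu lw lp eqn] := sol.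
have := eqn (field_of v) (fun=> 0) (fun=> 0) (field_of_H10 tv) (@L2_0_vec _) (L2_0 mO).
rewrite /formE curl_test_int// div_test_int// load_sum//.
rewrite (_ : (fun x => dotv (w x) 0) = fun=> 0); last by apply/funext => x; rewrite dotvC dotv0l.
rewrite (_ : (fun x => dotv 0 (curl wD u x)) = fun=> 0); last by apply/funext => x; rewrite dotv0l.
rewrite (_ : (fun x => 0 * div wD u x) = fun=> 0); last by apply/funext => x; rewrite mul0r.
rewrite (_ : (fun x => p x * 0) = fun=> 0); last by apply/funext => x; rewrite mulr0.
by rewrite int_0 => h; lra.
Qed.

Let tv0 (b : 'I_(space_dim d)) : test_function Omega ((fun _ _ => 0 : R) b).
Proof. exact: test_function0. Qed.

Let partial0 (a : 'I_(space_dim d)) (x : point) : partial a (fun=> 0 : R) x = 0.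
Proof. by rewrite /partial derive_cst. Qed.

(** The equation with [v = 0], the zero field being written as [field_of] of zero test functions so
    that the evaluation of the integrals applies to it. *)
Lemma form_constitutive th q : L2_vec Omega th -> L2 Omega q ->
  \int[leb]_(x in Omega) dotv (w x) (th x)
  - Num.sqrt muE * \int[leb]_(x in Omega) dotv (th x) (curl wD u x)
  + \int[leb]_(x in Omega) (q x * div wD u x)
  + (2 * muE + lamE)^-1 * \int[leb]_(x in Omega) (p x * q x) = 0.
Proof.
move=> lth lq; have [hu lw lp eqn] := sol.
have := eqn _ th q (field_of_H10 tv0) lth lq.
rewrite /formE curl_test_int// div_test_int// load_sum//.
under eq_bigr do under eq_bigr do under eq_bigr do under eq_Rintegral do rewrite partial0 mulr0.
rewrite [X in _ * X]big1; last first.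
  by move=> j _; rewrite big1// => a _; rewrite big1// => b _; rewrite int_0 mulr0.
rewrite (@big1 _ _ _ _ _ _ (fun b => \int[leb]_(x in Omega) (p x * partial b (fun=> 0) x))); last first.
  by move=> b _; under eq_Rintegral do rewrite partial0 mulr0; rewrite int_0.
rewrite (@big1 _ _ _ _ _ _ (fun b => \int[leb]_(x in Omega) (f x 0 b * 0))); last first.
  by move=> b _; under eq_Rintegral do rewrite mulr0; rewrite int_0.
by rewrite mulr0 !add0r oppr0.
Qed.

Lemma curl_L2 z : H10_vec Omega z -> L2_vec Omega (curl wD z).
Proof.
move=> hv j; have [_ _ cE _ _] := tE.
under eq_fun do rewrite cE.
apply: L2_sum => // a _; apply: L2_sum => // b _; apply: L2Z => //.
by apply: H1_wpartial_L2; case: (hv b).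
Qed.

Lemma div_L2 z : H10_vec Omega z -> L2 Omega (div wD z).
Proof.
move=> hv; apply: L2_sum => // a _.
by apply: H1_wpartial_L2; case: (hv a).
Qed.

(** Testing with the residual itself leaves its squared norm, which is therefore zero. The pressure
    equation below is obtained in the same way. *)
Lemma rotation_constitutive j :
  nullL2 Omega (fun x => w x 0 j - Num.sqrt muE * curl wD u x 0 j).
Proof.
have [hu lw lp eqn] := sol; have lc := curl_L2 hu.
pose th x := w x - Num.sqrt muE *: curl wD u x.
have lth : L2_vec Omega th.
  by move=> i; under eq_fun do rewrite !mxE; apply: L2B => //; apply: L2Z => //; exact: lc.
have := form_constitutive lth (L2_0 mO).
under [X in _ + X + _]eq_Rintegral do rewrite mul0r.
under [X in _ + _ * X]eq_Rintegral do rewrite mulr0.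
rewrite int_0 mulr0 !addr0 -RintegralZl//; last exact: dotv_integr.
rewrite -RintegralB//; [|exact: dotv_integr|by apply: integrZ => //; exact: dotv_integr].
have e x : dotv (w x) (th x) - Num.sqrt muE * dotv (th x) (curl wD u x) = dotv (th x) (th x).
  by rewrite (dotvC (w x)) -dotvZr -dotvBr.
under eq_Rintegral do rewrite e.
rewrite -/(sqnormL2_vec Omega th) sqnormL2_vecE// => h.
split; first by apply: L2B => //; apply: L2Z => //; exact: lc.
have : sqnormL2 Omega (fun x => th x 0 j) <= 0.
  rewrite -h (bigD1 j)//= lerDl sumr_ge0// => i _; exact: sqnormL2_ge0.
rewrite (_ : (fun x => th x 0 j) = fun x => w x 0 j - Num.sqrt muE * curl wD u x 0 j); last first.
  by apply/funext => x; rewrite !mxE.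
by move=> h0; apply/eqP; rewrite eq_le h0 sqnormL2_ge0.
Qed.

Lemma pressure_constitutive :
  nullL2 Omega (fun x => div wD u x + (2 * muE + lamE)^-1 * p x).
Proof.
have [hu lw lp eqn] := sol; have ld := div_L2 hu.
set c := (2 * muE + lamE)^-1; pose q x := div wD u x + c * p x.
have lq : L2 Omega q by apply: L2D => //; exact: L2Z.
have := form_constitutive (@L2_0_vec _) lq.
rewrite (_ : (fun x => dotv (w x) 0) = fun=> 0); last by apply/funext => x; rewrite dotvC dotv0l.
rewrite (_ : (fun x => dotv 0 (curl wD u x)) = fun=> 0); last by apply/funext => x; rewrite dotv0l.
rewrite int_0 mulr0 subrr add0r -/c -RintegralZl//; last exact: L2_integrM.
rewrite -RintegralD//; [|exact: L2_integrM|by apply: integrZ => //; exact: L2_integrM].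
have e x : q x * div wD u x + c * (p x * q x) = q x ^+ 2 by rewrite /q; ring.
under eq_Rintegral do rewrite e.
by split.
Qed.

End solution.
End balance.

Section subset.
Context {R : realType} {n m : nat}.
Variable E : 'I_m -> 'I_n.+1 -> 'I_n.+1 -> R.

Lemma weak_balanceS (U V : set 'rV[R]_n.+1) s w p f : U `<=` V ->
  weak_balance E V s w p f -> weak_balance E U s w p f.
Proof.
move=> UV bal v tv; have tv' b := test_functionS UV (tv b).
have e1 (g : 'rV[R]_n.+1 -> R) a b : \int[lebesgue_rV R n.+1]_(x in U) (g x * partial a (v b) x) =
    \int[lebesgue_rV R n.+1]_(x in V) (g x * partial a (v b) x).
  apply/esym/Rintegral_subset => // x _ nU.
  by rewrite (test_function_out (test_function_partial a (tv b)) nU) mulr0.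
have e2 (g : 'rV[R]_n.+1 -> R) b : \int[lebesgue_rV R n.+1]_(x in U) (g x * v b x) =
    \int[lebesgue_rV R n.+1]_(x in V) (g x * v b x).
  apply/esym/Rintegral_subset => // x _ nU.
  by rewrite (test_function_out (tv b) nU) mulr0.
have := bal v tv'.
under eq_bigr do under eq_bigr do under eq_bigr do rewrite -e1.
under [X in _ - X = _]eq_bigr do rewrite -e1.
by under [X in _ = X]eq_bigr do rewrite -e2.
Qed.

End subset.

(** * Local efficiency on a mesh *)
Section meshlocal.
Context {R : realType} {n m : nat}.
Local Notation N := (n.+1).
Local Notation leb := (lebesgue_rV R N).
Variable E : 'I_m -> 'I_N -> 'I_N -> R.
Hypothesis E1 : forall j a b, `|E j a b| <= 1.
Variables (Omega : set 'rV[R]_N) (md : nat) (sigma : R).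
Hypotheses (lO : lipschitz_domain Omega) (sigma0 : 0 <= sigma).

(** The diameter of an element is at most [8 * sigma] times the radius of [element_ball]; the factor
    [N%:R] compensates the smaller ball used at a facet. *)
Let L : R := 8 * sigma * N%:R.
Let L0 : 0 <= L. Proof. by rewrite !mulr_ge0. Qed.
(** The constants are extracted before the mesh, the parameters and the functions are introduced, so
    they can depend only on the dimensions, [E], [md] and [sigma]; this is the uniformity claimed by
    the theorem. *)
Let Ce : R := s2val (cid2 (element_local E1 md L0)).
Let Ce0 : 0 < Ce. Proof. exact: s2valP (cid2 (element_local E1 md L0)). Qed.
Let CeP := s2valP' (cid2 (element_local E1 md L0)).
Let Cf : R := s2val (cid2 (facet_local E1 md L0)).
Let Cf0 : 0 < Cf. Proof. exact: s2valP (cid2 (facet_local E1 md L0)). Qed.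
Let CfP := s2valP' (cid2 (facet_local E1 md L0)).

Let oO : open Omega. Proof. by case: lO. Qed.
Let bO : bounded_set Omega. Proof. by case: lO. Qed.
Let mO : measurable Omega := open_measurable_rV oO.

Variables (T : mesh R n) (mu c0 : R).
Hypotheses (mu0 : 0 < mu) (pT : simplicial_partition T Omega)
  (shapeT : forall K, K \in elements T -> diam (@hull _ _ T K) <= sigma * inball_diam (@hull _ _ T K)).
Variables (w : 'I_m -> 'rV[R]_N -> R) (p : 'rV[R]_N -> R) (f : 'I_N -> 'rV[R]_N -> R).
Variables (wh : 'I_m -> 'rV[R]_N -> R) (ph : 'rV[R]_N -> R) (fh : 'I_N -> 'rV[R]_N -> R).
Hypotheses (lw : forall j, L2 Omega (w j)) (lp : L2 Omega p) (lf : forall b, L2 Omega (f b))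
  (lwh : forall j, L2 Omega (wh j)) (lph : L2 Omega ph) (lfh : forall b, L2 Omega (fh b)).
Local Notation "K ^int" := (interior (@hull _ _ T K)) (at level 2, format "K ^int").
Hypotheses
  (polw : forall K j, K \in elements T -> exists2 q, ispoly md q & forall x, K^int x -> wh j x = q x)
  (polp : forall K, K \in elements T -> exists2 q, ispoly md q & forall x, K^int x -> ph x = q x)
  (polf : forall K b, K \in elements T -> exists2 q, ispoly md q & forall x, K^int x -> fh b x = q x)
  (bal : weak_balance E Omega (Num.sqrt mu) w p f).
Local Notation s := (Num.sqrt mu).
Implicit Types (K e : {set 'I_(nverts T)}).

Let s2 : s ^+ 2 = mu. Proof. by rewrite sqr_sqrtr// ltW. Qed.

(** The constant [c0] is left open here; the global argument takes the mean of the pressure error.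
    The last term is the local oscillation. *)
Definition local_error K : R := \sum_j sqnormL2 K^int (fun x => w j x - wh j x)
  + mu^-1 * sqnormL2 K^int (fun x => p x - ph x - c0)
  + diam (@hull _ _ T K) ^+ 2 / mu * \sum_b sqnormL2 K^int (fun x => f b x - fh b x).

Definition equilibrium_residual b x : R :=
  fh b x - strong_force E s (fun j a => partial a (wh j)) (fun b => partial b ph) b x.

Lemma local_error_ge0 K : 0 <= local_error K.
Proof.
have h0 : 0 <= diam (@hull _ _ T K) ^+ 2 by rewrite sqr_ge0.
have m0 : 0 <= mu^-1 by rewrite invr_ge0 ltW.
apply: addr_ge0; first apply: addr_ge0.
- by apply: sumr_ge0 => j _; exact: sqnormL2_ge0.
- by apply: mulr_ge0 => //; exact: sqnormL2_ge0.
- by apply: mulr_ge0; [exact: mulr_ge0|apply: sumr_ge0 => b _; exact: sqnormL2_ge0].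
Qed.

Lemma inball_diam_ge0 (A : set 'rV[R]_N) : 0 <= inball_diam A.
Proof.
rewrite /inball_diam; set S := (X in sup X).
have [hs|hs] := pselect (has_sup S); last by rewrite sup_out.
have [[y Sy] _] := hs; apply: le_trans (sup_upper_bound hs Sy).
by case: Sy => r [r0 _] <-; rewrite mulr_ge0.
Qed.

Lemma interior_hull_domain K : K \in elements T -> K^int `<=` Omega.
Proof.
move=> KT; have [_ _ _ _ lb] := lO; apply: (open_closure_subset lb); first exact: open_interior.
by apply: subset_trans (element_closure pT KT); exact: interior_subset.
Qed.

(** Shape regularity enters the estimates here: it forces [inball_diam] to be positive and bounds
    the diameter by the radius. [r] is half the radius of an inscribed ball, so that the ball of
    radius [2 * r] carrying the bump fits into the element. *)
Lemma element_ball K : K \in elements T -> 0 < diam (@hull _ _ T K) ->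
  exists r z, [/\ 0 < r, eball z (2 * r) `<=` K^int,
    forall x, enorm (x - z) <= 2 * r -> @hull _ _ T K x,
    diam (@hull _ _ T K) <= 8 * sigma * r & 2 * r <= diam (@hull _ _ T K)].
Proof.
move=> KT h0; have ib0 : 0 < inball_diam (@hull _ _ T K).
  rewrite lt_def inball_diam_ge0 andbT; apply: contraTneq h0 => e.
  by rewrite -leNgt; have := shapeT KT; rewrite e mulr0.
have [rho [z [rho0 ib hz]]] := inball_witness ib0.
have e2 : 2 * (rho / 2) = rho by field.
exists (rho / 2), z; rewrite e2; split => //; first by rewrite divr_gt0.
- rewrite -open_subsetE; last exact: open_eball.
  by move=> x; rewrite /eball/= => /ltW/hz.
- apply: le_trans (shapeT KT) _; rewrite (_ : 8 * sigma * (rho / 2) = sigma * (4 * rho)); last by field.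
  by rewrite ler_wpM2l// ltW.
- have d1 : enorm (delta_mx 0 ord0 : 'rV[R]_N) = 1.
    rewrite /enorm /dotv (bigD1 ord0)//= mxE !eqxx mulr1 big1 ?addr0 ?sqrtr1//.
    by move=> i /negbTE ia; rewrite mxE ia andbF mul0r.
  pose y := z + rho *: (delta_mx 0 ord0 : 'rV[R]_N).
  have ey : enorm (y - z) = rho by rewrite /y addrAC subrr add0r enormZ d1 mulr1 gtr0_norm.
  rewrite -{1}ey; apply: hull_diam; apply: hz; first by rewrite ey.
  by rewrite subrr /enorm dotv0l sqrtr0 ltW.
Qed.

Lemma partial_eq (U : set 'rV[R]_N) (g g' : 'rV[R]_N -> R) a x : open U -> (forall y, U y -> g y = g' y) ->
  U x -> partial a g x = partial a g' x.
Proof.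
move=> oU gg Ux; rewrite /partial; apply: near_eq_derive.
by apply: filterS (open_nbhs_nbhs (conj oU Ux)) => y; exact: gg.
Qed.

Let iK K : K \in elements T -> measurable K^int.
Proof. by move=> _; apply: open_measurable_rV; exact: open_interior. Qed.

Let normS K U g : K \in elements T -> measurable U -> U `<=` K^int -> L2 Omega g ->
  sqnormL2 U g <= sqnormL2 K^int g.
Proof.
move=> KT mU UK lg; apply: sqnormL2S => //; first exact: iK.
exact: (L2S mO (iK KT) (interior_hull_domain KT)).
Qed.

Let lew j : L2 Omega (fun x => w j x - wh j x). Proof. exact: L2B. Qed.
Let lep : L2 Omega (fun x => p x - ph x - c0).
Proof. by apply: L2B => //; [exact: L2B|apply: continuous_L2 => //; exact: cst_continuous]. Qed.
Let lef b : L2 Omega (fun x => f b x - fh b x). Proof. exact: L2B. Qed.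

(** Of the [N.+2] powers of [diam / r <= 8 * sigma], [N] compare the volumes of element and ball and
    two come from the weight of the residual. *)
Definition equilibrium_const : R := N%:R * Ce * 4 ^+ N * (8 * sigma) ^+ N.+2.

Lemma equilibrium_const_ge0 : 0 <= equilibrium_const.
Proof.
apply: mulr_ge0; last by apply: exprn_ge0; exact: mulr_ge0.
by apply: mulr_ge0; [apply: mulr_ge0; [exact: ler0n|exact: ltW Ce0]|exact: exprn_ge0].
Qed.

(** The pointwise bound of [element_local] holds on all of the element; squared norms follow on
    multiplying by the volume, at most [(4 * h) ^+ N]. *)
Lemma equilibrium_bound K : K \in elements T ->
  diam (@hull _ _ T K) ^+ 2 / mu * (\sum_b sqnormL2 K^int (equilibrium_residual b))
  <= equilibrium_const * local_error K.
Proof.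
move=> KT; have le0 := local_error_ge0 K; have c1 := equilibrium_const_ge0.
set h := diam _; have [h0|h0] := eqVneq h 0; first by rewrite h0 expr0n mul0r mul0r mulr_ge0.
have hp : 0 < h by rewrite lt_def h0 diam_hull_ge0.
have [r [z [r0 zK zh hr rh]]] := element_ball KT hp.
have /choice[qw hqw] : forall j, exists q, ispoly md q /\ forall x, K^int x -> wh j x = q x.
    by move=> j; have [q ? ?] := polw j KT; exists q.
have [qp pqp eqp] := polp KT.
have /choice[qf hqf] : forall b, exists q, ispoly md q /\ forall x, K^int x -> fh b x = q x.
    by move=> b; have [q ? ?] := polf b KT; exists q.
pose U := eball z (2 * r); have mU : measurable U := @measurable_eball _ _ _ _.
have UO : U `<=` Omega by exact: subset_trans zK (interior_hull_domain KT).
have lU g : L2 Omega g -> L2 U g by exact: L2S.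
pose R1 b x := qf b x - strong_force E s (fun j a => partial a (qw j)) (fun b => partial b qp) b x.
have oK : open K^int by exact: open_interior.
have R1E b x : K^int x -> equilibrium_residual b x = R1 b x.
  move=> Kx; rewrite /equilibrium_residual /R1 /strong_force (hqf b).2// (partial_eq b oK eqp Kx).
  congr (_ - (_ - _ * _)); apply: eq_bigr => j _; apply: eq_bigr => a _.
  by rewrite (partial_eq a oK (hqw j).2 Kx).
have pt b x : K^int x -> r ^+ N * r ^+ 2 * R1 b x ^+ 2 <= Ce * (mu * local_error K).
  move=> Kx; have xz : enorm (x - z) <= L * r.
    apply: (@le_trans _ _ h).
      apply: hull_diam; first exact: interior_subset Kx.
      by apply: zh; rewrite subrr /enorm dotv0l sqrtr0 mulr_ge0// ltW.
    apply: le_trans hr _; rewrite (ler_wpM2r (ltW r0))// /L ler_peMr ?mulr_ge0// ler1n//.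
  have := CeP; move=> /(_ s r c0 z w p f wh ph fh qw qp qf r0 (fun j => lU _ (lw j)) (lU _ lp)
    (fun b => lU _ (lf b)) (fun j => lU _ (lwh j)) (lU _ lph) (fun b => lU _ (lfh b))
    (fun j => (hqw j).1) pqp (fun b => (hqf b).1) (fun j x Ux => (hqw j).2 x (zK _ Ux))
    (fun x Ux => eqp x (zK _ Ux)) (fun b x Ux => (hqf b).2 x (zK _ Ux)) (weak_balanceS UO bal) b x xz).
  move=> /le_trans; apply; rewrite (ler_wpM2l (ltW Ce0))// /local_error !mulrDr s2.
  rewrite mulVKf ?gt_eqF//; apply: lerD; first apply: lerD.
  - by rewrite (ler_wpM2l (ltW mu0))//; apply: ler_sum => j _; apply: normS.
  - exact: normS.
  - rewrite -/h mulrA mulrCA mulfV ?gt_eqF// mulr1; apply: ler_pM.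
    + exact: sqr_ge0.
    + by rewrite sumr_ge0// => i _; exact: sqnormL2_ge0.
    + have rh' : r <= h by apply: le_trans rh; rewrite ler_peMl ?ler1n// ltW.
      by rewrite ler_pXn2r ?nnegrE ?(ltW r0) ?(ltW hp).
    + by apply: ler_sum => b' _; apply: normS.
pose D := Ce * (mu * local_error K) / (r ^+ N * r ^+ 2).
have rN : 0 < r ^+ N * r ^+ 2 by rewrite mulr_gt0// exprn_gt0.
have D0 : 0 <= D.
  apply: divr_ge0; last exact: ltW.
  by apply: mulr_ge0; [exact: ltW|apply: mulr_ge0 => //; exact: ltW].
have bK : bounded_set K^int by exact: bounded_subset (interior_hull_domain KT) bO.
have vol : (leb K^int <= ((4 * h) ^+ N)%:E)%E.
  have h20 : 0 < 2 * h by rewrite mulr_gt0.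
  rewrite (_ : 4 * h = 2 * (2 * h)); last by ring.
  apply: le_trans (lebesgue_eball z h20); apply: le_measure; rewrite ?inE; [exact: iK|exact: measurable_eball|].
  move=> x Kx; rewrite /eball/=; apply: (@le_lt_trans _ _ h); last by lra.
  apply: hull_diam; first exact: interior_subset Kx.
  by apply: zh; rewrite subrr /enorm dotv0l sqrtr0 mulr_ge0// ltW.
have each b : sqnormL2 K^int (equilibrium_residual b) <= D * (4 * h) ^+ N.
  have -> : sqnormL2 K^int (equilibrium_residual b) = sqnormL2 K^int (R1 b).
    by apply: eq_Rintegral => x /set_mem Kx; rewrite R1E.
  rewrite -(sqr_sqrtr D0); apply: sqnormL2_bounded => //; first exact: iK.
    apply: measurable_funTS; apply: continuous_measurable_rV; apply: smooth_continuous.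
    have [sf _] := (hqf b).1; apply: smoothB => //; apply: smoothB; first by apply: smooth_partial; case: pqp.
    apply: smoothZ; apply: smooth_sum => j _; apply: smooth_sum => a _; apply: smoothZ; apply: smooth_partial.
    by case: (hqw j) => -[].
  move=> x Kx; rewrite -sqrtr_sqr ler_wsqrtr// /D ler_pdivlMr// mulrC; exact: pt.
have sum_each : \sum_b sqnormL2 K^int (equilibrium_residual b) <= N%:R * (D * (4 * h) ^+ N).
  apply: (@le_trans _ _ (\sum_(b < N) (D * (4 * h) ^+ N))); first by apply: ler_sum => b _; exact: each.
  by rewrite sumr_const card_ord -(mulr_natl (D * _)).
have hmu : 0 <= h ^+ 2 / mu by rewrite divr_ge0 ?sqr_ge0// ltW.
apply: le_trans (ler_wpM2l hmu sum_each) _.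
have hrN : (h / r) ^+ N.+2 <= (8 * sigma) ^+ N.+2.
  have h1 : h / r <= 8 * sigma by rewrite ler_pdivrMr.
  have h2 : 0 <= h / r by rewrite divr_ge0// ltW.
  by rewrite ler_pXn2r ?nnegrE// (le_trans h2).
rewrite (_ : h ^+ 2 / mu * (N%:R * _) = N%:R * Ce * 4 ^+ N * (h / r) ^+ N.+2 * local_error K); last first.
  have e3 (y : R) : y ^+ N.+2 = y ^+ N * y ^+ 2 by rewrite -exprD addn2.
  rewrite /D expr_div_n !e3 exprMn.
  by field; rewrite !gt_eqF// ?exprn_gt0.
rewrite /equilibrium_const ler_wpM2r// ler_wpM2l// !mulr_ge0 ?exprn_ge0// ltW//.
Qed.

(** The square root and [4 ^+ n] come from [facet_integral_le], the power of [8 * sigma * N%:R] from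
    the ratio of the facet diameter to the radius, and the last factor from bounding the force
    defect on both sides by [equilibrium_bound]. *)
Definition facet_const : R :=
  Num.sqrt n`!%:R * 4 ^+ n * (8 * sigma * N%:R) ^+ N * N%:R * Cf * (3 + 2 * equilibrium_const).

Lemma facet_const_ge0 : 0 <= facet_const.
Proof.
have c1 := equilibrium_const_ge0; have c2 := ltW Cf0.
by rewrite /facet_const !mulr_ge0 ?sqrtr_ge0 ?exprn_ge0 ?mulr_ge0// addr_ge0// mulr_ge0.
Qed.

(** The hypothesis on [F] is the squared facet residual, [4^-1] being the square of its factor one
    half. On each half-ball the force defect is [f - fh] plus the equilibrium residual of that
    neighbour, which is already estimated. *)
Lemma facet_bound e K1 K2 nu q1w q2w q1p q2p F : #|e| = N -> K1 \in elements T -> K2 \in elements T ->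
  K1 != K2 -> e \subset K1 -> e \subset K2 -> dotv nu nu = 1 ->
  (forall a b, a \in e -> b \in e -> dotv nu (@vertex _ _ T a - vertex b) = 0) ->
  (forall j, ispoly md (q1w j)) -> (forall j, ispoly md (q2w j)) -> ispoly md q1p -> ispoly md q2p ->
  (forall j x, K1^int x -> wh j x = q1w j x) -> (forall j x, K2^int x -> wh j x = q2w j x) ->
  (forall x, K1^int x -> ph x = q1p x) -> (forall x, K2^int x -> ph x = q2p x) ->
  (forall x, @hull _ _ T e x -> F x = 4^-1 * \sum_b
    (s * (\sum_j \sum_a E j a b * (nu 0 a * (q1w j x - q2w j x))) - nu 0 b * (q1p x - q2p x)) ^+ 2) ->
  diam (@hull _ _ T e) / mu * @facet_integral _ _ T e F <= facet_const * (local_error K1 + local_error K2).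
Proof.
move=> ce KT1 KT2 K12 eK1 eK2 nu1 nue pq1w pq2w pq1p pq2p e1w e2w e1p e2p FE.
have l1 := local_error_ge0 K1; have l2 := local_error_ge0 K2; have cf := facet_const_ge0.
have ec := equilibrium_const_ge0.
set h := diam _; have [h0|h0] := eqVneq h 0; first by rewrite h0 !mul0r mulr_ge0// addr_ge0.
have hp : 0 < h by rewrite lt_def h0 diam_hull_ge0.
have [v0 v0e] : exists v0, v0 \in e by apply/finset.set0Pn; rewrite -cards_eq0 ce.
have hK K : e \subset K -> h <= diam (@hull _ _ T K) by exact: diam_hullS v0e.
have [r1 [z1 [r10 z1K z1h hr1 rh1]]] := element_ball KT1 (lt_le_trans hp (hK _ eK1)).
have [r2 [z2 [r20 z2K z2h hr2 rh2]]] := element_ball KT2 (lt_le_trans hp (hK _ eK2)).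
have N0 : (0 : R) < N%:R by rewrite ltr0n.
have N1 : (1 : R) <= N%:R by rewrite ler1n.
(* The division by [N%:R] is the one demanded by [facet_patch], with all radii doubled. *)
pose r := Num.min r1 r2 / N%:R.
have m0 : 0 < Num.min r1 r2 by rewrite lt_min r10 r20.
have r0 : 0 < r by rewrite divr_gt0.
have rr i : Num.min r1 r2 <= i -> 0 < i -> 2 * r <= 2 * i / N%:R.
  by move=> mi i0; rewrite /r mulrA ler_pM2r ?invr_gt0// ler_pM2l.
have rr1 : 2 * r <= 2 * r1 / N%:R by apply: rr; rewrite ?ge_min ?lexx.
have rr2 : 2 * r <= 2 * r2 / N%:R by apply: rr; rewrite ?ge_min ?lexx ?orbT.
have rm : r <= Num.min r1 r2 by rewrite /r ler_pdivrMr// ler_peMr// ltW.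
have hL : h <= L * r.
  rewrite /L /r -mulrA [N%:R * _]mulrC divfK ?gt_eqF// /Num.min; case: ifP => _.
    exact: le_trans (hK _ eK1) hr1.
  exact: le_trans (hK _ eK2) hr2.
have g20 i : 0 < i -> 0 < 2 * i :> R by move=> ?; rewrite mulr_gt0.
have [sg [sg2 patch]] := facet_patch pT ce nu1 nue KT1 KT2 K12 eK1 eK2 (g20 _ r10) z1h (g20 _ r20) z2h (g20 _ r0) rr1 rr2.
(* With [nu'] the element [K1] is above and [K2] below. The sign does not affect the squares of the
   jump. *)
pose c := @barycenter R n T e; pose nu' := sg *: nu.
have nu'1 : dotv nu' nu' = 1 by rewrite /nu' dotvZl dotvZr nu1 mulr1 -expr2.
pose U := eball c (2 * r); have mU : measurable U := @measurable_eball _ _ _ _.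
have oU : open U := @open_eball _ _ _ _.
have bU : bounded_set U := @bounded_eball _ _ _ _.
have nuE x : dotv x nu' = sg * dotv x nu by rewrite /nu' dotvZr.
have oab : open (above c nu').
  by apply: open_comp (@open_gt R 0) => x _; exact: continuous_dotv_sub.
have obe : open (below c nu').
  by apply: open_comp (@open_lt R 0) => x _; exact: continuous_dotv_sub.
have Ua : U `&` above c nu' `<=` K1^int.
  rewrite -open_subsetE; last exact: openI.
  by move=> x [Ux]; rewrite /above/= nuE => /ltW; exact: (patch x (ltW Ux)).1.
have Ub : U `&` below c nu' `<=` K2^int.
  rewrite -open_subsetE; last exact: openI.
  by move=> x [Ux]; rewrite /below/= nuE => /ltW; exact: (patch x (ltW Ux)).2.
have UO : U `<=` Omega.
  have [_ _ _ _ lb] := lO; apply: (open_closure_subset lb) => // x Ux.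
  have [h1 h2] := patch x (ltW Ux); have [/h1 h3|/ltW/h2 h3] := leP 0 (sg * dotv (x - c) nu).
    exact: (element_closure pT KT1 h3).
  exact: (element_closure pT KT2 h3).
have lU g : L2 Omega g -> L2 U g by exact: L2S.
have mUa : measurable (U `&` above c nu') by apply: open_measurable_rV; exact: openI.
have mUb : measurable (U `&` below c nu') by apply: open_measurable_rV; exact: openI.
have split g : L2 Omega g -> sqnormL2 U g <= sqnormL2 K1^int g + sqnormL2 K2^int g.
  move=> lg; rewrite (sqnormL2_above_below c nu'1 mU bU (lU _ lg)).
  by apply: lerD; [exact: normS|exact: normS].
pose Dw j a := hglue c nu' (partial a (q1w j)) (partial a (q2w j)).
pose Dp b := hglue c nu' (partial b q1p) (partial b q2p).
pose G b x := f b x - strong_force E s Dw Dp b x.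
have lG b : L2 U (G b).
  have lg q q' a : ispoly md q -> ispoly md q' -> L2 U (hglue c nu' (partial a q) (partial a q')).
    move=> [sq _] [sq' _]; apply: L2_hglue => //; apply: smooth_continuous; exact: smooth_partial.
  apply: L2B => //; first exact: lU.
  apply: L2B => //; first exact: lg.
  apply: L2Z => //; apply: L2_sum => // j _; apply: L2_sum => // a _; apply: L2Z => //.
  exact: lg.
(* One half-ball, written once for both sides: the weighted force defect on [S] is controlled by the
   error of the neighbour that contains [S]. *)
have side K (S : set 'rV[R]_N) qw qp : K \in elements T -> measurable S -> S `<=` K^int ->
    (forall j, ispoly md (qw j)) -> ispoly md qp ->
    (forall j x, K^int x -> wh j x = qw j x) -> (forall x, K^int x -> ph x = qp x) ->
    (forall b x, S x -> G b x = f b x - strong_force E s (fun j a => partial a (qw j)) (fun b => partial b qp) b x) ->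
    r <= diam (@hull _ _ T K) ->
    r ^+ 2 * \sum_b sqnormL2 S (G b) <= mu * ((2 + 2 * equilibrium_const) * local_error K).
  move=> KT mS SK pqw pqp ew ep GE rd.
  have oK : open K^int by exact: open_interior.
  have mK : measurable K^int by exact: iK.
  have KO := interior_hull_domain KT.
  have bK : bounded_set K^int by exact: bounded_subset KO bO.
  have lK g : L2 Omega g -> L2 K^int g by exact: L2S.
  have /choice[qf hqf] : forall b, exists q, ispoly md q /\ forall x, K^int x -> fh b x = q x.
    by move=> b; have [q ? ?] := polf b KT; exists q.
  pose R1 b x := qf b x - strong_force E s (fun j a => partial a (qw j)) (fun b => partial b qp) b x.
  have pR1 b : ispoly md (R1 b).
    apply: ispolyB; first by have [] := hqf b.
    apply: ispolyB; first exact: ispoly_partial.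
    apply: ispolyZ; apply: ispoly_sum => j _; apply: ispoly_sum => a _; apply: ispolyZ.
    exact: ispoly_partial.
  have lR1 b : L2 K^int (R1 b) by exact: ispoly_L2 (pR1 b).
  have R1E b : sqnormL2 K^int (R1 b) = sqnormL2 K^int (equilibrium_residual b).
    apply: eq_Rintegral => x /set_mem Kx; congr (_ ^+ 2).
    rewrite /equilibrium_residual /R1 /strong_force (hqf b).2// (partial_eq b oK ep Kx).
    congr (_ - (_ - _ * _)); apply: eq_bigr => j _; apply: eq_bigr => a _.
    by rewrite (partial_eq a oK (ew j) Kx).
  have each b : sqnormL2 S (G b) <= 2 * sqnormL2 K^int (fun x => f b x - fh b x) +
      2 * sqnormL2 K^int (equilibrium_residual b).
    rewrite -R1E; apply: le_trans (sqnormL2D mK (lK _ (lef b)) (lR1 b)).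
    have -> : sqnormL2 S (G b) = sqnormL2 S (fun x => (f b x - fh b x) + R1 b x).
      by apply: eq_Rintegral => x /set_mem Sx; rewrite GE// (hqf b).2 ?/R1; [congr (_ ^+ 2); ring|exact: SK].
    by apply: sqnormL2S => //; apply: L2D => //; exact: lK.
  apply: (@le_trans _ _ (diam (@hull _ _ T K) ^+ 2 * (2 * (\sum_b sqnormL2 K^int (fun x => f b x - fh b x)) +
      2 * \sum_b sqnormL2 K^int (equilibrium_residual b)))).
    apply: ler_pM; rewrite ?sqr_ge0//; first by rewrite sumr_ge0// => b _; exact: sqnormL2_ge0.
      by rewrite ler_pXn2r ?nnegrE ?diam_hull_ge0// ltW.
    by rewrite !mulr_sumr -big_split/=; apply: ler_sum => b _; exact: each.
  have eb := equilibrium_bound KT.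
  set d2 := diam (@hull _ _ T K) ^+ 2 in eb *; set X := \sum_b _; set Y := \sum_b _ in eb *.
  have hX : d2 * X <= mu * local_error K.
    rewrite /local_error -/d2 -/X !mulrDr.
    have -> : mu * (d2 / mu * X) = d2 * X by field; rewrite gt_eqF.
    rewrite lerDr addr_ge0// mulr_ge0 ?(ltW mu0)// ?sumr_ge0// ?mulr_ge0 ?invr_ge0 ?(ltW mu0) ?sqnormL2_ge0//.
    by move=> j _; exact: sqnormL2_ge0.
  have hY : d2 * Y <= mu * (equilibrium_const * local_error K).
    have := ler_wpM2l (ltW mu0) eb; have -> // : mu * (d2 / mu * Y) = d2 * Y by field; rewrite gt_eqF.
  rewrite mulrDr; nra.
have rd K ri : Num.min r1 r2 <= ri -> 2 * ri <= diam (@hull _ _ T K) -> 0 < ri -> r <= diam (@hull _ _ T K).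
  by move=> h1 h2 h3; apply: le_trans rm _; apply: le_trans h1 _; apply: le_trans h2; lra.
have rd1 : r <= diam (@hull _ _ T K1) by apply: rd rh1 r10; rewrite ge_min lexx.
have rd2 : r <= diam (@hull _ _ T K2) by apply: rd rh2 r20; rewrite ge_min lexx orbT.
pose W := \sum_j sqnormL2 U (fun x => w j x - wh j x); pose P := sqnormL2 U (fun x => p x - ph x - c0).
pose B := s ^+ 2 * W + P + r ^+ 2 * \sum_b sqnormL2 U (G b).
have hB : B <= mu * ((3 + 2 * equilibrium_const) * (local_error K1 + local_error K2)).
  have hG : r ^+ 2 * \sum_b sqnormL2 U (G b) <=
      mu * ((2 + 2 * equilibrium_const) * local_error K1) + mu * ((2 + 2 * equilibrium_const) * local_error K2).
    rewrite (eq_bigr _ (fun b _ => sqnormL2_above_below c nu'1 mU bU (lG b))) big_split/= mulrDr.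
    apply: lerD.
      apply: (side K1 _ q1w q1p KT1 mUa Ua pq1w pq1p e1w e1p _ rd1) => b x [_ ax].
      rewrite /G /strong_force /Dp hglue_above//; congr (_ - (_ - _ * _)).
      by apply: eq_bigr => j _; apply: eq_bigr => a _; rewrite /Dw hglue_above.
    apply: (side K2 _ q2w q2p KT2 mUb Ub pq2w pq2p e2w e2p _ rd2) => b x [_ ax].
    rewrite /G /strong_force /Dp hglue_below//; congr (_ - (_ - _ * _)).
    by apply: eq_bigr => j _; apply: eq_bigr => a _; rewrite /Dw hglue_below.
  have hWP : s ^+ 2 * W + P <= mu * (local_error K1 + local_error K2).
    rewrite s2; pose w1 K := \sum_j sqnormL2 K^int (fun x => w j x - wh j x).
    pose p1 K := sqnormL2 K^int (fun x => p x - ph x - c0).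
    have hW : W <= w1 K1 + w1 K2 by rewrite -big_split/=; apply: ler_sum => j _; exact: split.
    have hP : P <= p1 K1 + p1 K2 by exact: split.
    have le1 K : mu * w1 K + p1 K <= mu * local_error K.
      rewrite /local_error -/(w1 K) -/(p1 K) !mulrDr mulVKf ?gt_eqF// lerDl.
      apply: mulr_ge0; first exact: ltW.
      apply: mulr_ge0; first by apply: divr_ge0; [exact: sqr_ge0|exact: ltW].
      by apply: sumr_ge0 => b _; exact: sqnormL2_ge0.
    have := le1 K1; have := le1 K2; have := ler_wpM2l (ltW mu0) hW; rewrite !mulrDr; lra.
  rewrite /B; apply: le_trans (lerD hWP hG) _; rewrite le_eqVlt; apply/orP; left; apply/eqP; ring.
have B0 : 0 <= B.
  apply: addr_ge0; first apply: addr_ge0.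
  - by apply: mulr_ge0; [exact: sqr_ge0|apply: sumr_ge0 => j _; exact: sqnormL2_ge0].
  - exact: sqnormL2_ge0.
  - by apply: mulr_ge0; [exact: sqr_ge0|apply: sumr_ge0 => b _; exact: sqnormL2_ge0].
have rN : 0 < r ^+ N by rewrite exprn_gt0.
pose J b x := s * (\sum_j \sum_a E j a b * (nu 0 a * (q1w j x - q2w j x))) - nu 0 b * (q1p x - q2p x).
have pt b x : @hull _ _ T e x -> J b x ^+ 2 <= Cf * B / r ^+ N.
  move=> ex; have xp : dotv (x - c) nu' = 0.
    by rewrite nuE (facet_plane ce nue ex (facet_center ce)) mulr0.
  have xc : enorm (x - c) <= L * r by apply: le_trans hL; apply: hull_diam => //; exact: facet_center.
  have := CfP; move=> /(_ s r c0 c nu' w p f wh ph q1w q2w q1p q2p r0 nu'1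
    (fun j => lU _ (lw j)) (lU _ lp) (fun b => lU _ (lf b)) (fun j => lU _ (lwh j)) (lU _ lph)
    pq1w pq2w pq1p pq2p
    (fun j x Ux ax => e1w j x (Ua x (conj Ux ax))) (fun j x Ux ax => e2w j x (Ub x (conj Ux ax)))
    (fun x Ux ax => e1p x (Ua x (conj Ux ax))) (fun x Ux ax => e2p x (Ub x (conj Ux ax)))
    (weak_balanceS UO bal) b x xp xc).
  rewrite -/U -/W -/P -/(B) => hh.
  rewrite ler_pdivlMr// mulrC; apply: le_trans hh.
  have nuc a : nu' 0 a = sg * nu 0 a by rewrite mxE.
  have Je : s * (\sum_j \sum_a E j a b * (nu' 0 a * (q1w j x - q2w j x))) - nu' 0 b * (q1p x - q2p x) = sg * J b x.
    rewrite /J [in RHS]mulrBr [sg * (s * _)]mulrCA [sg * (nu 0 b * _)]mulrA -nuc; congr (_ * _ - _).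
    rewrite mulr_sumr; apply: eq_bigr => j _; rewrite mulr_sumr; apply: eq_bigr => a _.
    by rewrite nuc; ring.
  by rewrite Je [(sg * _) ^+ 2]exprMn sg2 mul1r.
pose Q x := 4^-1 * \sum_b J b x ^+ 2.
have sQ : smooth Q.
  apply: smoothZ; apply: smooth_sum => b _; apply: smoothX; apply: smoothB.
    apply: smoothZ; apply: smooth_sum => j _; apply: smooth_sum => a _; do 2 apply: smoothZ.
    by apply: smoothB; [case: (pq1w j)|case: (pq2w j)].
  by apply: smoothZ; apply: smoothB; [case: pq1p|case: pq2p].
have Qb x : @hull _ _ T e x -> F x = Q x /\ 0 <= Q x <= N%:R * (Cf * B / r ^+ N).
  move=> ex; split; first exact: FE.
  rewrite mulr_ge0 ?invr_ge0 ?sumr_ge0// => [|b _]; last exact: sqr_ge0.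
  apply: (@le_trans _ _ (\sum_b J b x ^+ 2)).
    by rewrite ler_piMl ?sumr_ge0// => [b _|]; [exact: sqr_ge0|rewrite invf_le1// ler1n].
  apply: (@le_trans _ _ (\sum_(b < N) (Cf * B / r ^+ N))); first by apply: ler_sum => b _; exact: pt.
  by rewrite sumr_const card_ord -(mulr_natl (Cf * B / _)).
have hmu : 0 <= h / mu by rewrite divr_ge0// ltW.
apply: le_trans (ler_wpM2l hmu (facet_integral_le ce sQ Qb)) _.
rewrite -/h.
have hrN : (h / r) ^+ N <= (8 * sigma * N%:R) ^+ N.
  have h1 : h / r <= 8 * sigma * N%:R by rewrite ler_pdivrMr.
  have h2 : 0 <= h / r by rewrite divr_ge0// ltW.
  by rewrite ler_pXn2r ?nnegrE// (le_trans h2).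
set F0 := Num.sqrt n`!%:R * 4 ^+ n.
have F00 : 0 <= F0 by rewrite mulr_ge0 ?sqrtr_ge0 ?exprn_ge0.
rewrite (_ : h / mu * _ = F0 * (h / r) ^+ N * N%:R * Cf * (B / mu)); last first.
  by rewrite [(h / r) ^+ N]expr_div_n [h ^+ N]exprS; field; rewrite !gt_eqF.
have hB' : B / mu <= (3 + 2 * equilibrium_const) * (local_error K1 + local_error K2).
  by rewrite ler_pdivrMr// mulrC.
rewrite /facet_const -/F0 -[leRHS]mulrA; apply: ler_pM => //.
- by rewrite !mulr_ge0 ?exprn_ge0 ?divr_ge0// ltW.
- by rewrite divr_ge0// ltW.
- rewrite (ler_wpM2r (ltW Cf0))// ler_wpM2r// ler_wpM2l//.
Qed.

End meshlocal.

(** * Global efficiency *)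
Section nullbound.
Context {R : realType} {n : nat}.
Implicit Types (S : set 'rV[R]_n) (f g a b : 'rV[R]_n -> R).

Lemma L2_eq S f g : measurable S -> (forall x, S x -> f x = g x) -> L2 S f -> L2 S g.
Proof.
move=> mS e [mf fi]; split; first by apply: eq_measurable_fun mf => x /set_mem; exact: e.
by apply: eq_integrable fi => // x /set_mem Sx; rewrite /= e.
Qed.

Lemma nullL2_bound S g a b : measurable S -> L2 S a -> L2 S b ->
  nullL2 S (fun x => g x - (a x + b x)) ->
  L2 S g /\ sqnormL2 S g <= 4 * sqnormL2 S a + 4 * sqnormL2 S b.
Proof.
move=> mS la lb [ln n0]; have lab := L2D mS la lb.
have e : g = fun x => (g x - (a x + b x)) + (a x + b x) by apply/funext => x; rewrite subrK.
split; first by rewrite e; exact: L2D.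
rewrite {1}e; apply: le_trans (sqnormL2D mS ln lab) _; rewrite n0 mulr0 add0r.
by have := sqnormL2D mS la lb; lra.
Qed.

Lemma nullL2_eq S f g : measurable S -> (forall x, S x -> f x = g x) -> nullL2 S f -> nullL2 S g.
Proof.
move=> mS e [lf f0]; split; first exact: L2_eq lf.
by rewrite -f0; apply: eq_Rintegral => x /set_mem Sx; rewrite e.
Qed.

End nullbound.

Lemma facet_integral_le0 (R : realType) n (T : mesh R n) (e : {set 'I_(nverts T)}) (F : 'rV[R]_n.+1 -> R) : #|e| = n.+1 ->
  (forall x, @hull _ _ T e x -> F x = 0) -> @facet_integral _ _ T e F <= 0.
Proof.
move=> ce F0; have := @facet_integral_le R n T e F (fun=> 0) 0 ce (smooth_cst 0).
by rewrite mulr0; apply => x hx; rewrite F0// lexx.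
Qed.

(** * From the local bounds to the estimator *)

Section efficiency.
Context {R : realType} {d : spacedim}.
Local Notation N := (space_dim d).
Local Notation point := 'rV[R]_(space_dim d).
Local Notation rotation := 'rV[R]_(rot_dim d).
Local Notation leb := (lebesgue_rV R (space_dim d)).
Variable E : 'I_(rot_dim d) -> 'I_(space_dim d) -> 'I_(space_dim d) -> R.
Hypotheses (E1 : forall j a b, `|E j a b| <= 1) (tE : is_curl_tensor E).
Variables (Omega : set point) (k l : nat) (sigma : R).
Hypotheses (lO : lipschitz_domain Omega) (sigma0 : 0 <= sigma).
Variables (T : mesh R (facet_dim d)) (muE lamE : R).
Hypotheses (mu0 : 0 < muE) (lam0 : 0 <= lamE) (pT : simplicial_partition T Omega)
  (shapeT : forall K, K \in elements T -> diam (@hull _ _ T K) <= sigma * inball_diam (@hull _ _ T K)).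
Variables (f u : point -> point) (w : point -> rotation) (p : point -> R).
Variables (uh : point -> point) (wh : point -> rotation) (ph : point -> R) (fh : point -> point).
Hypotheses (lf : L2_vec Omega f) (sol : continuous_solution Omega muE lamE f u w p)
  (uhV : Vh Omega T k uh) (whW : Wh Omega T k wh) (phZ : Zh Omega T k ph)
  (fhP : piecewise_polynomial Omega T l fh).
Local Notation "K ^int" := (interior (@hull _ _ T K)) (at level 2, format "K ^int").
Local Notation wD := (wpartial Omega).
Local Notation D := (@partial R N).
Local Notation s := (Num.sqrt muE).
Local Notation md := (maxn k l).
Implicit Types (K e : {set 'I_(nverts T)}).

Let oO : open Omega. Proof. by case: lO. Qed.
Let bO : bounded_set Omega. Proof. by case: lO. Qed.
Let mO : measurable Omega := open_measurable_rV oO.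
Let hu : H10_vec Omega u. Proof. by case: sol. Qed.
Let huh : H10_vec Omega uh. Proof. by case: uhV. Qed.
Let lw : forall j, L2 Omega (fun x => w x 0 j). Proof. by case: sol. Qed.
Let lp : L2 Omega p. Proof. by case: sol. Qed.
Let lwh : forall j, L2 Omega (fun x => wh x 0 j). Proof. by case: whW. Qed.
Let lph : L2 Omega ph. Proof. by case: phZ. Qed.
Let lfh : forall b, L2 Omega (fun x => fh x 0 b). Proof. by case: fhP. Qed.
Let s2 : s ^+ 2 = muE. Proof. by rewrite sqr_sqrtr// ltW. Qed.

Let oK K : open K^int. Proof. exact: open_interior. Qed.
Let mK K : measurable K^int. Proof. exact: open_measurable_rV. Qed.
Let KO K : K \in elements T -> K^int `<=` Omega. Proof. exact: interior_hull_domain. Qed.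
Let bK K : K \in elements T -> bounded_set K^int.
Proof. by move=> KT; apply: bounded_subset bO; exact: KO. Qed.
Let lK K g : K \in elements T -> L2 Omega g -> L2 K^int g.
Proof. by move=> KT; exact: (L2S mO (mK K) (KO KT)). Qed.

Let polw K j : K \in elements T -> exists2 q, ispoly md q & forall x, K^int x -> wh x 0 j = q x.
Proof.
move=> KT; have [_ /(_ K j KT)/polynomial_onP[q pq e]] := whW.
by exists q => //; apply: ispolyW pq; exact: leq_maxl.
Qed.

Let polp K : K \in elements T -> exists2 q, ispoly md q & forall x, K^int x -> ph x = q x.
Proof.
move=> KT; have [_ /(_ K KT)/polynomial_onP[q pq e]] := phZ.
by exists q => //; apply: ispolyW pq; exact: leq_maxl.
Qed.

Let polf K b : K \in elements T -> exists2 q, ispoly md q & forall x, K^int x -> fh x 0 b = q x.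
Proof.
move=> KT; have [_ /(_ K b KT)/polynomial_onP[q pq e]] := fhP.
by exists q => //; apply: ispolyW pq; exact: leq_maxr.
Qed.

Let polu K b : K \in elements T -> exists2 q, smooth q & forall x, K^int x -> uh x 0 b = q x.
Proof.
move=> KT; have [_ _ /(_ K b KT)/polynomial_onP[q [sq _] e]] := uhV.
by exists q => // x Kx; apply: e; exact: interior_subset Kx.
Qed.

Let bal := solution_balance oO bO tE lf sol.
(** The mean of the pressure error; subtracting it produces [mean_free], whose norm carries the
    weight [muE^-1]. *)
Let c0 : R := (fine (leb Omega))^-1 * \int[leb]_(y in Omega) (p \- ph) y.
Local Notation err := (@local_error R (facet_dim d) (rot_dim d) T muE c0 (fun j x => w x 0 j) p (fun b x => f x 0 b)
  (fun j x => wh x 0 j) ph (fun b x => fh x 0 b)).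
Local Notation res b := (@equilibrium_residual R (facet_dim d) (rot_dim d) E muE
  (fun j x => wh x 0 j) ph (fun b x => fh x 0 b) b).
Local Notation CE := (equilibrium_const E1 md sigma0).
Local Notation CF := (facet_const E1 md sigma0).

Let err0 K : 0 <= err K. Proof. exact: local_error_ge0. Qed.

Let eqb K : K \in elements T ->
  diam (@hull _ _ T K) ^+ 2 / muE * (\sum_b sqnormL2 K^int (res b)) <= CE * err K.
Proof.
move=> KT.
exact: (equilibrium_bound E1 lO sigma0 c0 mu0 pT shapeT lw lp lf lwh lph lfh polw polp polf bal KT).
Qed.

(** The estimator differentiates [uh] classically inside the elements, the norm weakly on the
    domain; the two agree up to a null function. *)
Let D_local K b a : K \in elements T -> nullL2 K^int (fun x => wD a (fun y => uh y 0 b) x - D a (fun y => uh y 0 b) x).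
Proof.
move=> KT; have [q sq e] := polu b KT.
have lq : L2 K^int (partial a q).
  by apply: continuous_L2; [exact: mK|exact: bK|apply: smooth_continuous; exact: smooth_partial].
have h := @wpartial_local R N Omega K^int (fun y => uh y 0 b) q a oO bO (@oK K) (KO KT) (huh b).1 sq lq e.
apply: (nullL2_eq (mK K) _ h) => x Kx.
by rewrite (partial_eq a (@oK K) e Kx).
Qed.

Let wB a b : nullL2 Omega (fun x => wD a (fun y => (u \- uh) y 0 b) x -
  (wD a (fun y => u y 0 b) x - wD a (fun y => uh y 0 b) x)).
Proof.
have := wpartialB a oO bO (hu b).1 (huh b).1.
by rewrite (_ : (fun y => (u \- uh) y 0 b) = (fun y => u y 0 b - uh y 0 b))//; apply/funext => y; rewrite !mxE.
Qed.

Let lwB a b : L2 Omega (wD a (fun y => (u \- uh) y 0 b)).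
Proof.
rewrite (_ : wD a _ = fun x => (wD a (fun y => (u \- uh) y 0 b) x -
  (wD a (fun y => u y 0 b) x - wD a (fun y => uh y 0 b) x)) +
  (wD a (fun y => u y 0 b) x - wD a (fun y => uh y 0 b) x)); last by apply/funext => x; rewrite subrK.
apply: L2D => //; first by case: (wB a b).
by apply: L2B => //; apply: H1_wpartial_L2; [case: (hu b)|case: (huh b)].
Qed.

Let chi j x : R := curl wD (u \- uh) x 0 j.
Let cE (G : derivation R N) v x j : curl G v x 0 j = \sum_a \sum_b E j a b * G a (fun y => v y 0 b) x.
Proof. by case: tE. Qed.

Let lchi j : L2 Omega (chi j).
Proof.
rewrite /chi; under eq_fun do rewrite cE.
by apply: L2_sum => // a _; apply: L2_sum => // b _; exact: L2Z.
Qed.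

Let lchid : L2 Omega (div wD (u \- uh)).
Proof. by apply: L2_sum => // a _; exact: lwB. Qed.

(** Subtracting the constitutive equation of the exact solution, [res2] is [- (w - wh)] plus [s]
    times the curl of [u - uh], up to null functions. *)
Lemma rotation_residual_bound K j : K \in elements T ->
  L2 K^int (fun x => res2 muE uh wh x 0 j) /\
  sqnormL2 K^int (fun x => res2 muE uh wh x 0 j) <=
  4 * sqnormL2 K^int (fun x => w x 0 j - wh x 0 j) + 4 * (muE * sqnormL2 K^int (chi j)).
Proof.
move=> KT; have mKK := mK K.
have lww : L2 K^int (fun x => w x 0 j - wh x 0 j) by apply: lK => //; exact: L2B.
have lc : L2 K^int (chi j) by exact: lK.
have [|] := @nullL2_bound R N K^int (fun x => res2 muE uh wh x 0 j) (fun x => - (w x 0 j - wh x 0 j))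
  (fun x => s * chi j x) mKK (L2N mKK lww) (L2Z s mKK lc); last first.
  by rewrite sqnormL2N sqnormL2Z// s2.
have n1 : nullL2 K^int (fun x => w x 0 j - s * curl wD u x 0 j).
  exact: nullL2S mO mKK (KO KT) (rotation_constitutive oO bO tE lf sol j).
have n2 : nullL2 K^int (fun x => s * \sum_a \sum_b E j a b * (wD a (fun y => uh y 0 b) x - D a (fun y => uh y 0 b) x)).
  apply: nullL2Z => //; apply: nullL2_sum => // a _; apply: nullL2_sum => // b _; apply: nullL2Z => //.
  exact: D_local.
have n3 : nullL2 K^int (fun x => s * \sum_a \sum_b E j a b * (wD a (fun y => (u \- uh) y 0 b) x -
  (wD a (fun y => u y 0 b) x - wD a (fun y => uh y 0 b) x))).
  apply: nullL2S mO mKK (KO KT) _; apply: nullL2Z => //; apply: nullL2_sum => // a _.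
  by apply: nullL2_sum => // b _; apply: nullL2Z => //; exact: wB.
apply: nullL2_eq (nullL2D mKK n1 (nullL2D mKK n2 (nullL2N mKK n3))) => // x _.
rewrite /chi /res2 !mxE !cE.
have sB (F G : 'I_N -> 'I_N -> R) : \sum_a \sum_b E j a b * (F a b - G a b) =
    \sum_a \sum_b E j a b * F a b - \sum_a \sum_b E j a b * G a b.
  rewrite -sumrB; apply: eq_bigr => a _; rewrite -sumrB; apply: eq_bigr => b _.
  by rewrite mulrBr.
rewrite (sB (fun a b => wD a (fun y => uh y 0 b) x) (fun a b => D a (fun y => uh y 0 b) x)).
rewrite (sB (fun a b => wD a (fun y => (u \- uh) y 0 b) x) (fun a b => wD a (fun y => u y 0 b) x - wD a (fun y => uh y 0 b) x)).
rewrite (sB (fun a b => wD a (fun y => u y 0 b) x) (fun a b => wD a (fun y => uh y 0 b) x)).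
ring.
Qed.

Let c : R := (2 * muE + lamE)^-1.
Let cgt0 : 0 < c. Proof. by rewrite invr_gt0 ltr_wpDr// mulr_gt0. Qed.

(** Up to null functions [res3] is minus the divergence of [u - uh] minus [c] times [p - ph]. The
    weight is at most [muE] for the first part, and its product with [c] is at most 1 for the
    second, uniformly in [lamE]. *)
Lemma pressure_residual_bound K : K \in elements T ->
  (muE^-1 + c)^-1 * sqnormL2 K^int (res3 muE lamE uh ph) <=
  4 * (muE * sqnormL2 K^int (div wD (u \- uh))) + 4 * (c * sqnormL2 K^int (p \- ph)).
Proof.
move=> KT; have mKK := mK K.
have lpp : L2 K^int (p \- ph) by apply: lK => //; exact: L2B.
have lc : L2 K^int (div wD (u \- uh)) by exact: lK.
have [|_] := @nullL2_bound R N K^int (res3 muE lamE uh ph) (fun x => - div wD (u \- uh) x)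
  (fun x => - c * (p \- ph) x) mKK (L2N mKK lc) (L2Z (- c) mKK lpp); last first.
  rewrite sqnormL2N sqnormL2Z// sqrrN => h.
  have m0 : 0 < muE^-1 by rewrite invr_gt0.
  have g0 : 0 < (muE^-1 + c)^-1 by rewrite invr_gt0 addr_gt0.
  apply: le_trans (ler_wpM2l (ltW g0) h) _; rewrite mulrDr.
  have g1 : (muE^-1 + c)^-1 <= muE.
    by rewrite -[leRHS]invrK lef_pV2 ?posrE ?addr_gt0// lerDl ltW.
  have g2 : (muE^-1 + c)^-1 * c <= 1.
    by rewrite mulrC ler_pdivrMr ?addr_gt0// mul1r lerDr ltW.
  have q1 := sqnormL2_ge0 K^int (div wD (u \- uh)); have q2 := sqnormL2_ge0 K^int (p \- ph).
  apply: lerD.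
    by rewrite mulrCA ler_wpM2l// ler_wpM2r.
  rewrite mulrCA ler_wpM2l// mulrA ler_wpM2r// expr2 mulrA ler_piMl// ltW//.
have n1 : nullL2 K^int (fun x => div wD u x + c * p x).
  exact: nullL2S mO mKK (KO KT) (pressure_constitutive oO bO tE lf sol).
have n2 : nullL2 K^int (fun x => \sum_b (wD b (fun y => uh y 0 b) x - D b (fun y => uh y 0 b) x)).
  by apply: nullL2_sum => // b _; exact: D_local.
have n3 : nullL2 K^int (fun x => \sum_b (wD b (fun y => (u \- uh) y 0 b) x -
  (wD b (fun y => u y 0 b) x - wD b (fun y => uh y 0 b) x))).
  apply: nullL2S mO mKK (KO KT) _; apply: nullL2_sum => // b _; exact: wB.
apply: nullL2_eq (nullL2D mKK n1 (nullL2D mKK n3 (nullL2N mKK n2))) => // x _.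
rewrite /res3 /div !sumrB -/c /=; ring.
Qed.

(** The vector product with [nu] is orthogonal to [nu]. *)
Lemma antisym_sum (nu : point) j : \sum_a \sum_b E j a b * (nu 0 a * nu 0 b) = 0.
Proof.
have [_ aE _ _ _] := tE; set S := \sum_a _.
have : S = - S.
  rewrite {1}/S exchange_big/= -sumrN; apply: eq_bigr => a _; rewrite -sumrN; apply: eq_bigr => b _.
  by rewrite aE mulNr (mulrC (nu 0 b)).
lra.
Qed.

Definition facet_indicator e : R :=
  diam (@hull _ _ T e) / muE * facet_integral e (fun x => dotv (res_facet Omega muE wh ph e x) (res_facet Omega muE wh ph e x)).

(** The count on the left reflects that the sum over elements contains the facet term once for each
    neighbour. *)
Lemma facet_indicator_bound e : e \in facets T ->
  facet_indicator e * #|[set K in elements T | e \subset K]|%:R <=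
  2 * CF * \sum_(K in elements T | e \subset K) err K.
Proof.
rewrite inE => /andP[/eqP ce _].
have CF0 : 0 <= CF by exact: facet_const_ge0.
have rhs0 : 0 <= 2 * CF * \sum_(K in elements T | e \subset K) err K.
  by apply: mulr_ge0; [exact: mulr_ge0|apply: sumr_ge0].
have hm : 0 <= diam (@hull _ _ T e) / muE by rewrite divr_ge0 ?diam_hull_ge0// ltW.
have zero : (forall x, @hull _ _ T e x -> res_facet Omega muE wh ph e x = 0) ->
    facet_indicator e * #|[set K in elements T | e \subset K]|%:R <=
    2 * CF * \sum_(K in elements T | e \subset K) err K.
  move=> r0; apply: le_trans rhs0; rewrite mulr_le0_ge0// mulr_ge0_le0//.
  by apply: facet_integral_le0 => // x hx; rewrite r0// dotv0l.
case eb: `[< @hull _ _ T e `<=` closure Omega `\` Omega >].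
  by apply: zero => x _; rewrite /res_facet eb.
(* Without exactly two neighbours [jump] is 0 by default, and so is the residual. *)
case een: (enum [set K in elements T | e \subset K]%SET) => [|K1 [|K2 [|K3 r]]];
  try by apply: zero => x _; rewrite /res_facet eb /jump een scaler0.
have mem K : (K \in [set K in elements T | e \subset K]%SET) = (K == K1) || (K == K2).
  by rewrite -mem_enum een !in_cons in_nil orbF.
have := mem K1; have := mem K2; rewrite !inE !eqxx orbT/= => /andP[KT2 eK2] /andP[KT1 eK1].
have K12 : K1 != K2.
  by have := enum_uniq [set K in elements T | e \subset K]%SET; rewrite een /= inE andbT.
have card2 : #|[set K in elements T | e \subset K]%SET| = 2 by rewrite cardE een.
have sum2 : \sum_(K in elements T | e \subset K) err K = err K1 + err K2.
  rewrite (eq_bigl (fun K => (K == K1) || (K == K2))) => [|K]; last by rewrite -mem inE.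
  by rewrite (bigD1 K1) ?eqxx//= (bigD1 K2) ?eqxx ?orbT 1?eq_sym//= big1 ?addr0// => K /andP[/andP[/orP[->//|->//]]]; rewrite ?andbF.
have qex K : K \in elements T -> exists (qw : 'I_(rot_dim d) -> point -> R) (qp : point -> R),
    [/\ forall j, ispoly md (qw j), ispoly md qp, forall j x, K^int x -> wh x 0 j = qw j x &
      forall x, K^int x -> ph x = qp x].
  move=> KT; have /choice[qw hqw] : forall j, exists q, ispoly md q /\ forall x, K^int x -> wh x 0 j = q x.
    by move=> j; have [q ? ?] := polw j KT; exists q.
  have [qp pqp eqp] := polp KT.
  by exists qw, qp; split=> // j; have [] := hqw j.
have [q1w [q1p [pq1w pq1p e1w e1p]]] := qex _ KT1.
have [q2w [q2p [pq2w pq2p e2w e2p]]] := qex _ KT2.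
set nu := facet_normal e.
pose G (qw : 'I_(rot_dim d) -> point -> R) (qp : point -> R) x : point :=
  \row_b (s * (\sum_j \sum_a E j a b * (nu 0 a * qw j x)) + nu 0 b * qp x).
have tr K qw qp x : K \in elements T -> e \subset K -> (forall j, ispoly md (qw j)) -> ispoly md qp ->
    (forall j x, K^int x -> wh x 0 j = qw j x) -> (forall x, K^int x -> ph x = qp x) -> @hull _ _ T e x ->
    trace_from K (fun y => s *: cross_rot (wh y) nu + ph y *: nu) x = G qw qp x.
  move=> KT eK pqw pqp ew ep hx; have [al [be bary]] := element_barycentric pT KT.
  apply: (trace_fromE (element_card pT KT) bary (hullS eK hx)).
    apply: continuous_affine_row => b; rewrite (_ : (fun y => _) = fun y =>
      s * (\sum_j \sum_a E j a b * (nu 0 a * qw j y)) + nu 0 b * qp y); last by apply/funext => y; rewrite mxE.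
    apply: smoothD; last by apply: smoothZ; case: pqp.
    apply: smoothZ; apply: smooth_sum => j _; apply: smooth_sum => a _; do 2 apply: smoothZ.
    by case: (pqw j).
  have [_ _ _ _ xE] := tE.
  move=> y Ky; apply/rowP => b; rewrite !mxE xE (ep y Ky) [qp y * _]mulrC; congr (_ * _ + _).
  by apply: eq_bigr => j _; apply: eq_bigr => a _; rewrite (ew j y Ky) (mulrC (qw j y)).
have resE x : @hull _ _ T e x -> res_facet Omega muE wh ph e x = 2^-1 *: (G q1w q1p x - G q2w q2p x).
  by move=> hx; rewrite /res_facet eb /jump een (tr K1 q1w q1p)// (tr K2 q2w q2p).
have [nuP|nuP] := pselect (exists nu' : point, enorm nu' = 1 /\
    forall a b, a \in e -> b \in e -> dotv nu' (@vertex _ _ T a - vertex b) = 0); last first.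
  (* If no unit normal existed, [xget] would return its default 0 and the residual would vanish;
     this spares a proof of existence. *)
  have nu0 : nu = 0.
    rewrite /nu /facet_normal; case: xgetP => // y _ hy.
    by exfalso; apply: nuP; exists y.
  apply: zero => x hx; rewrite resE// (_ : _ - _ = 0) ?scaler0//; apply/rowP => b.
  rewrite !mxE nu0 !mxE !mul0r !addr0 !big1 ?subrr// => j _; rewrite big1// => a _; by rewrite mxE mul0r mulr0.
have [nu1 nue] : enorm nu = 1 /\ forall a b, a \in e -> b \in e -> dotv nu (@vertex _ _ T a - vertex b) = 0.
  exact: (xgetPex 0 nuP).
have nun : dotv nu nu = 1 by rewrite -enorm_sqr nu1 expr1n.
rewrite card2 sum2 mulrC -[2 * CF * _]mulrA ler_wpM2l//.
apply: (facet_bound E1 lO sigma0 c0 mu0 pT shapeT lw lp lf lwh lph lfh polw polp polf bal ce KT1 KT2 K12 eK1 eK2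
  nun nue pq1w pq2w pq1p pq2p e1w e2w e1p e2p) => x hx.
(* The estimator has the sign [+ p n]; as the vector product is orthogonal to [n],
   changing it to [- p n] does not change the norm. *)
rewrite resE// dotvZl dotvZr mulrA (_ : 2^-1 * 2^-1 = 4^-1); last by field.
congr (_ * _).
pose X b := s * (\sum_j \sum_a E j a b * (nu 0 a * (q1w j x - q2w j x))).
pose Y := q1p x - q2p x.
have XE b : X b = s * (\sum_j \sum_a E j a b * (nu 0 a * q1w j x)) - s * (\sum_j \sum_a E j a b * (nu 0 a * q2w j x)).
  rewrite /X -mulrBr -sumrB; congr (_ * _); apply: eq_bigr => j _; rewrite -sumrB; apply: eq_bigr => a _; ring.
have X0 : \sum_b X b * nu 0 b = 0.
  rewrite (eq_bigr (fun b => \sum_j s * (q1w j x - q2w j x) * \sum_a E j a b * (nu 0 a * nu 0 b))); last first.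
    move=> b _; rewrite /X mulr_sumr mulr_suml; apply: eq_bigr => j _.
    rewrite !mulr_sumr mulr_suml; apply: eq_bigr => a _; ring.
  rewrite exchange_big/= big1// => j _; rewrite -mulr_sumr exchange_big/= antisym_sum mulr0//.
rewrite /dotv -/Y; under [RHS]eq_bigr do rewrite -/(X _).
apply/eqP; rewrite -subr_eq0 -sumrB; apply/eqP.
rewrite (eq_bigr (fun b => 4 * Y * (X b * nu 0 b))) => [|b _]; last first.
  by rewrite !mxE XE /Y; ring.
by rewrite -mulr_sumr X0 mulr0.
Qed.

Let res2L K : K \in elements T -> L2_vec K^int (res2 muE uh wh).
Proof. by move=> KT j; case: (rotation_residual_bound j KT). Qed.

Lemma equilibrium_residual_L2 K b : K \in elements T -> L2 K^int (res b).
Proof.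
move=> KT; have [qf pqf ef] := polf b KT; have [qp pqp ep] := polp KT.
have /choice[qw hqw] : forall j, exists q, ispoly md q /\ forall x, K^int x -> wh x 0 j = q x.
  by move=> j; have [q ? ?] := polw j KT; exists q.
apply: (@L2_eq R N K^int (fun x => qf x - strong_force E s (fun j a => partial a (qw j)) (fun b => partial b qp) b x)).
- exact: mK.
- move=> x Kx; rewrite /equilibrium_residual /strong_force (ef x Kx) (partial_eq b (@oK K) ep Kx).
  congr (_ - (_ - _ * _)); apply: eq_bigr => j _; apply: eq_bigr => a _.
  by rewrite (partial_eq a (@oK K) (hqw j).2 Kx).
- apply: (@ispoly_L2 R N md); [exact: mK|exact: bK|].
  apply: ispolyB => //; apply: ispolyB; first exact: ispoly_partial.
  apply: ispolyZ; apply: ispoly_sum => j _; apply: ispoly_sum => a _; apply: ispolyZ.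
  by apply: ispoly_partial; case: (hqw j).
Qed.

Lemma res1_equilibrium K : K \in elements T ->
  sqnormL2_vec K^int (res1 muE fh wh ph) = \sum_b sqnormL2 K^int (res b).
Proof.
move=> KT; have [_ _ _ rE _] := tE.
have e b x : res1 muE fh wh ph x 0 b = res b x.
  by rewrite /res1 /equilibrium_residual /strong_force !mxE rE; ring.
rewrite sqnormL2_vecE; [|exact: mK|].
  by apply: eq_bigr => b _; apply: eq_Rintegral => x _; rewrite e.
move=> b; apply: (@L2_eq R N K^int (res b)); [exact: mK|by move=> x _; rewrite e|].
exact: equilibrium_residual_L2.
Qed.

Lemma local_oscillationE K : K \in elements T ->
  local_oscillation_sq muE f fh K =
  diam (@hull _ _ T K) ^+ 2 / muE * \sum_b sqnormL2 K^int (fun x => f x 0 b - fh x 0 b).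
Proof.
move=> KT; rewrite /local_oscillation_sq sqnormL2_vecE; [|exact: mK|].
  congr (_ * _); apply: eq_bigr => b _; apply: eq_Rintegral => x _; by rewrite !mxE.
by move=> b; under eq_fun do rewrite !mxE; apply: lK => //; exact: L2B.
Qed.

Lemma sum_elements_le g : L2 Omega g -> \sum_(K in elements T) sqnormL2 K^int g <= sqnormL2 Omega g.
Proof.
move=> lg; apply: (@sqnormL2_disjoint R N _ (fun K => K \in elements T) (fun K => K^int)) => // K K' hK hK' KK'.
exact: (interior_disjoint pT hK hK' KK').
Qed.

(** After exchanging the sums, each element error is counted once per facet. The facets of an
    element are subsets of its [N.+1] vertices, which gives the crude bound [2 ^+ N.+1]. *)
Lemma sum_facet_indicator : \sum_(K in elements T) \sum_(e in facets T | e \subset K) facet_indicator e <=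
  2 * CF * 2 ^+ N.+1 * \sum_(K in elements T) err K.
Proof.
have CF0 : 0 <= CF by exact: facet_const_ge0.
rewrite (exchange_big_dep (fun e => e \in facets T))/=; last by move=> K e _ /andP[].
apply: (@le_trans _ _ (\sum_(e in facets T) (2 * CF * \sum_(K in elements T | e \subset K) err K))).
  apply: ler_sum => e eF; rewrite (eq_bigl (fun K => (K \in elements T) && (e \subset K))) => [|K]; last by rewrite eF.
  apply: le_trans (facet_indicator_bound eF); rewrite sumr_const -(mulr_natr (facet_indicator e)).
  by rewrite (_ : #|_| = #|[set K in elements T | e \subset K]%SET|)//; apply: eq_card => K; rewrite inE.
rewrite -mulr_sumr -[leRHS]mulrA; apply: ler_wpM2l; first exact: mulr_ge0.
rewrite (exchange_big_dep (fun K => K \in elements T))/=; last by move=> e K _ /andP[].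
rewrite mulr_sumr; apply: ler_sum => K KT.
rewrite sumr_const -(mulr_natl (err K)) ler_wpM2r// -natrX ler_nat.
rewrite -(element_card pT KT) -card_powerset; apply: subset_leq_card.
by apply/fintype.subsetP => e; rewrite powersetE unfold_in => /and3P[].
Qed.

(** Stated for squares, in which the local bounds add up: element norms sum to at most the norm on
    [Omega], and with the chosen [c0] the sum of the local errors is part of the energy norm plus
    the oscillation. *)
Lemma estimator_bound : estimator Omega muE lamE T fh uh wh ph ^+ 2 <=
  (CE + 2 * CF * 2 ^+ N.+1 + 4) *
  (energy_norm Omega muE lamE (u \- uh) (w \- wh) (p \- ph) ^+ 2 + oscillation muE T f fh ^+ 2).
Proof.
have CF0 : 0 <= CF by exact: facet_const_ge0.
have CE0 : 0 <= CE by exact: equilibrium_const_ge0.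
have muV : 0 <= muE^-1 by rewrite invr_ge0 ltW.
have osc0 K : K \in elements T -> 0 <= local_oscillation_sq muE f fh K.
  move=> KT; rewrite local_oscillationE//; apply: mulr_ge0.
    by apply: divr_ge0; [exact: sqr_ge0|exact: ltW].
  by apply: sumr_ge0 => b _; exact: sqnormL2_ge0.
have lpp : L2 Omega (p \- ph) by exact: L2B.
have lmf : L2 Omega (mean_free Omega (p \- ph)).
  by apply: L2B => //; apply: continuous_L2 => //; exact: cst_continuous.
have lww j : L2 Omega (fun x => w x 0 j - wh x 0 j) by exact: L2B.
pose A := \sum_j sqnormL2 Omega (fun x => w x 0 j - wh x 0 j).
pose M := sqnormL2 Omega (mean_free Omega (p \- ph)).
pose X := \sum_j sqnormL2 Omega (chi j).
pose V := sqnormL2 Omega (div wD (u \- uh)).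
pose P := sqnormL2 Omega (p \- ph).
pose O := \sum_(K in elements T) local_oscillation_sq muE f fh K.
have A0 : 0 <= A by apply: sumr_ge0 => j _; exact: sqnormL2_ge0.
have X0 : 0 <= X by apply: sumr_ge0 => j _; exact: sqnormL2_ge0.
have M0 : 0 <= M by exact: sqnormL2_ge0.
have V0 : 0 <= V by exact: sqnormL2_ge0.
have P0 : 0 <= P by exact: sqnormL2_ge0.
have O0 : 0 <= O by exact: sumr_ge0.
have enE : energy_norm Omega muE lamE (u \- uh) (w \- wh) (p \- ph) ^+ 2 =
    muE * X + muE * V + A + c * P + muE^-1 * M.
  have lwv : L2_vec Omega (w \- wh) by move=> j; under eq_fun do rewrite !mxE; exact: lww.
  rewrite /energy_norm sqr_sqrtr; last first.
    have nv m (F : point -> 'rV[R]_m) : 0 <= sqnormL2_vec Omega F.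
      by apply: Rintegral_ge0 => x _; exact: dotv_ge0.
    apply: addr_ge0; last exact: mulr_ge0.
    apply: addr_ge0; last by apply: mulr_ge0 => //; exact: ltW.
    apply: addr_ge0 => //.
    by apply: addr_ge0; apply: mulr_ge0 => //; exact: ltW.
  rewrite !sqnormL2_vecE//; congr (_ + _ + _ + _ + _).
  by apply: eq_bigr => j _; apply: eq_Rintegral => x _; rewrite !mxE.
have osE : oscillation muE T f fh ^+ 2 = O by rewrite /oscillation sqr_sqrtr.
have serr : \sum_(K in elements T) err K <= A + muE^-1 * M + O.
  rewrite /local_error !big_split/= -mulr_sumr; apply: lerD; first apply: lerD.
  - by rewrite exchange_big/=; apply: ler_sum => j _; exact: sum_elements_le.
  - by rewrite ler_wpM2l//; exact: sum_elements_le.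
  - by apply: ler_sum => K KT; rewrite local_oscillationE.
have s1 : \sum_(K in elements T) diam (@hull _ _ T K) ^+ 2 / muE * sqnormL2_vec K^int (res1 muE fh wh ph) <=
    CE * \sum_(K in elements T) err K.
  by rewrite mulr_sumr; apply: ler_sum => K KT; rewrite res1_equilibrium//; exact: eqb.
have s3 : \sum_(K in elements T) sqnormL2_vec K^int (res2 muE uh wh) <= 4 * A + 4 * (muE * X).
  apply: (@le_trans _ _ (\sum_(K in elements T) \sum_j
      (4 * sqnormL2 K^int (fun x => w x 0 j - wh x 0 j) + 4 * (muE * sqnormL2 K^int (chi j))))).
    apply: ler_sum => K KT; rewrite sqnormL2_vecE; [|exact: mK|exact: res2L].
    by apply: ler_sum => j _; case: (rotation_residual_bound j KT).
  rewrite exchange_big/= !mulr_sumr -big_split/=; apply: ler_sum => j _.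
  rewrite big_split/= -!mulr_sumr; apply: lerD; first by rewrite ler_wpM2l//; exact: sum_elements_le.
  by rewrite ler_wpM2l// ler_wpM2l ?(ltW mu0)//; exact: sum_elements_le.
have s4 : \sum_(K in elements T) (muE^-1 + c)^-1 * sqnormL2 K^int (res3 muE lamE uh ph) <=
    4 * (muE * V) + 4 * (c * P).
  apply: (@le_trans _ _ (\sum_(K in elements T)
    (4 * (muE * sqnormL2 K^int (div wD (u \- uh))) + 4 * (c * sqnormL2 K^int (p \- ph))))).
    by apply: ler_sum => K KT; exact: pressure_residual_bound.
  rewrite big_split/= -!mulr_sumr; apply: lerD; rewrite ler_wpM2l//.
    by rewrite ler_wpM2l ?(ltW mu0)//; exact: sum_elements_le.
  by rewrite ler_wpM2l ?(ltW cgt0)//; exact: sum_elements_le.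
have s2' := sum_facet_indicator.
have t1 : 0 <= muE * X by rewrite mulr_ge0// ltW.
have t2 : 0 <= muE * V by rewrite mulr_ge0// ltW.
have t3 : 0 <= c * P by rewrite mulr_ge0// ltW.
have t4 : 0 <= muE^-1 * M by rewrite mulr_ge0.
pose Z := 2 * CF * 2 ^+ N.+1.
have Z0 : 0 <= Z by apply: mulr_ge0; [exact: mulr_ge0|exact: exprn_ge0].
pose Y := muE * X + muE * V + A + c * P + muE^-1 * M + O.
have Y0 : 0 <= Y by rewrite /Y; do 4 rewrite addr_ge0//; rewrite addr_ge0.
have tot : \sum_(K in elements T) local_estimator_sq Omega muE lamE fh uh wh ph K <= (CE + Z + 4) * Y.
  rewrite /local_estimator_sq !big_split/=.
  apply: le_trans (lerD (lerD (lerD s1 s2') s3) s4) _.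
  set S := \sum_(K in elements T) err K in serr *.
  have SY : S <= Y by apply: le_trans serr _; rewrite /Y; lra.
  apply: (@le_trans _ _ (CE * Y + (Z * Y + 4 * Y))); last by rewrite -!mulrDl addrA.
  rewrite -!addrA; apply: lerD; first by rewrite ler_wpM2l.
  by apply: lerD; [rewrite -/Z ler_wpM2l|rewrite /Y; lra].
rewrite enE osE -/Y -/Z /estimator; set W := \sum_(K in elements T) _ in tot *.
(* The sign of [W] is not examined: the square root of a negative number is 0, and the bound is then
   trivial. *)
have [W0|W0] := leP 0 W; first by rewrite sqr_sqrtr.
by rewrite ler0_sqrtr ?(ltW W0)// expr0n/= mulr_ge0// !addr_ge0.
Qed.

End efficiency.

Theorem theorem2p3 (R : realType) (d : spacedim) (Omega : set 'rV[R]_(space_dim d))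
    (I : Type) (T : I -> mesh R (facet_dim d)) (k l : nat) :
  lipschitz_domain Omega ->
  (forall i, simplicial_partition (T i) Omega) ->
  shape_regular T ->
  exists Ceff : R, 0 < Ceff /\
    forall (i : I) (muE lamE : R) (f : 'rV[R]_(space_dim d) -> 'rV[R]_(space_dim d))
      (u : 'rV[R]_(space_dim d) -> 'rV[R]_(space_dim d))
      (w : 'rV[R]_(space_dim d) -> 'rV[R]_(rot_dim d)) (p : 'rV[R]_(space_dim d) -> R)
      (uh : 'rV[R]_(space_dim d) -> 'rV[R]_(space_dim d))
      (wh : 'rV[R]_(space_dim d) -> 'rV[R]_(rot_dim d)) (ph : 'rV[R]_(space_dim d) -> R)
      (fh : 'rV[R]_(space_dim d) -> 'rV[R]_(space_dim d)),
    0 < muE -> 0 <= lamE ->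
    L2_vec Omega f ->
    continuous_solution Omega muE lamE f u w p ->
    (galerkin_solution Omega muE lamE (T i) k f uh wh ph \/
     exists2 mu, 0 < mu &
       stabilised_solution Omega muE lamE (T i) k mu f uh wh ph) ->
    piecewise_polynomial Omega (T i) l fh ->
    estimator Omega muE lamE (T i) fh uh wh ph <=
    Ceff * (energy_norm Omega muE lamE (u \- uh) (w \- wh) (p \- ph)
            + oscillation muE (T i) f fh).
Proof.
move=> lO pT [sig shp]; have [E tE] := curl_tensor R d.
(* Shape regularity gives a constant of unknown sign; its absolute value serves as well because
   [inball_diam] is nonnegative. *)
have sigma0 : 0 <= `|sig| by [].
have E1 : forall j a b, `|E j a b| <= 1 by case: tE.
(* Fixed before the mesh index and the parameters are introduced; [maxn k l] is a common degree for
   the discrete fields [wh], [ph] and the approximate force. *)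
pose C0 : R := equilibrium_const E1 (maxn k l) sigma0 +
  2 * facet_const E1 (maxn k l) sigma0 * 2 ^+ (space_dim d).+1 + 4.
have C00 : 0 < C0.
  rewrite /C0 ltr_wpDl// addr_ge0 ?equilibrium_const_ge0//.
  by apply: mulr_ge0; [apply: mulr_ge0 => //; exact: facet_const_ge0|exact: exprn_ge0].
exists (Num.sqrt C0); split; first by rewrite sqrtr_gt0.
move=> i muE lamE f u w p uh wh ph fh mu0 lam0 lf sol dis fhP.
have [uhV whW phZ] : [/\ Vh Omega (T i) k uh, Wh Omega (T i) k wh & Zh Omega (T i) k ph].
  by case: dis => [[]|[mu _ []]].
have shapeT K : K \in elements (T i) -> diam (@hull _ _ (T i) K) <= `|sig| * inball_diam (@hull _ _ (T i) K).
  by move=> KT; apply: le_trans (shp i K KT) _; rewrite ler_wpM2r ?inball_diam_ge0 ?ler_norm.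
have := estimator_bound E1 tE lO sigma0 mu0 lam0 (pT i) shapeT lf sol uhV whW phZ fhP.
set En := energy_norm _ _ _ _ _ _; set Os := oscillation _ _ _ _; set Es := estimator _ _ _ _ _ _ _ _.
have En0 : 0 <= En by exact: sqrtr_ge0.
have Os0 : 0 <= Os by exact: sqrtr_ge0.
have Es0 : 0 <= Es by exact: sqrtr_ge0.
move=> h; rewrite -(ler_pXn2r (n := 2))// ?nnegrE ?mulr_ge0 ?sqrtr_ge0 ?addr_ge0//.
rewrite exprMn (sqr_sqrtr (ltW C00)); apply: le_trans h _.
rewrite (ler_wpM2l (ltW C00))// sqrrD; have := mulr_ge0 En0 Os0; lra.
Qed.
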